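(* Let $k$ be a commutative ring, $G$ a finite group, and $V$ a $kG$-module that is free of finite rank as a $k$-module. Let $\mathbf{C}$ be one of the types of categories of complexes listed in the context, and let $\mathcal{K}_*$ be one of the four types of homotopy category listed there; for a subgroup $J\le G$ write $\mathcal{K}_*(\mathbf{C}_J)$ for the corresponding homotopy category of complexes of $kJ$-modules, formed with the restriction $V_{\downarrow J}$. Let $H$ be a subgroup of $G$. Then induction and restriction define functors $\mathrm{Ind}_H^G:\mathcal{K}_*(\mathbf{C}_H)\to\mathcal{K}_*(\mathbf{C}_G)$ and $\mathrm{Res}_H^G:\mathcal{K}_*(\mathbf{C}_G)\to\mathcal{K}_*(\mathbf{C}_H)$. Moreover, these functors satisfy the following. (a) For any subgroup $K$ of $G$ there is a natural transformation of functors $$\alpha:\mathrm{Res}_K^G\mathrm{Ind}_H^G(\,\cdot\,)\longrightarrow\bigoplus_{t\in K\backslash G/H}\mathrm{Ind}_{K\cap{}^tH}^K\bigl(t\otimes\mathrm{Res}^H_{K^t\cap H}(\,\cdot\,)\bigr)$$ (sum over representatives of the $K$-$H$-double cosets in $G$) that is an isomorphism on objects. (b) Assume that tensor products of objects in $\mathbf{C}_G$ and in $\mathbf{C}_H$ are defined. There is a natural transformation, of functors from $\mathcal{K}_*(\mathbf{C}_G)\times\mathcal{K}_*(\mathbf{C}_H)$ to $\mathcal{K}_*(\mathbf{C}_G)$, that is an isomorphism on objects: $\beta_{X,Y}:X\otimes\mathrm{Ind}_H^G(Y)\cong\mathrm{Ind}_H^G(\mathrm{Res}_H^G(X)\otimes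 Y)$. (c) The functors $\mathrm{Res}_H^G$ and $\mathrm{Ind}_H^G$ are adjoints of each other (each is both left and right adjoint to the other). (d) There is a functor $F:\mathcal{K}_*(\mathbf{C}_H)\to\mathcal{K}_*(\mathbf{C}_H)$ such that $\mathrm{Res}_H^G\mathrm{Ind}_H^G=1\oplus F$.
   Context: $\mathrm{Ind}_H^G(X)=kG\otimes_{kH}X$ and $\mathrm{Res}_H^G$ is restriction of the action. ${}^tH=tHt^{-1}$, $K^t=t^{-1}Kt$, and $t\otimes(\cdot)$ is the conjugation functor from complexes of $k(K^t\cap H)$-modules to complexes of $k(K\cap{}^tH)$-modules. $\otimes=\otimes_k$ with diagonal group action. Categories of complexes: for a finite group $J$, $\mathbf{C}_J$ is one of $\mathbf{Cpx}(kJ)$ (all cochain complexes of $kJ$-modules and chain maps), $\mathbf{cpx}(kJ)$ (complexes of finitely generated modules), $\mathbf{cpxFL}(kJ)$ (complexes whose terms have finite composition length), or the full subcategories $\mathbf{Cpx}^*,\mathbf{cpx}^*,\mathbf{cpxFL}^*$ with $*=+,-,b$ of complexes bounded above, bounded below, or both; the same type is used for all groups. Homotopy categories: an exact sequence $E$ of complexes is term split if it splits as a sequence of modules in each degree; $V$-split if $V\otimes E$ is split as a sequence of complexes; $V$-term split if $V\otimes E$ is term split; term+$V$-split if both term split and $V$-split. An object $P$ is $\mathscr{E}$-projective, for a class $\mathscr{E}$ of exact sequences, if $\mathrm{Hom}(P,-)$ is exact on every sequence in $\mathscr{E}$. The homotopy categories $\mathcal{K}(\mathbf{C})$, $\mathcal{K}_{V\text{-split}}(\mathbf{C})$,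 $\mathcal{K}_{V\text{-ts}}(\mathbf{C})$, $\mathcal{K}_{\mathrm{ts}+V\text{-split}}(\mathbf{C})$ have the objects of $\mathbf{C}$ and the morphisms of $\mathbf{C}$ modulo those factoring through an $\mathscr{E}$-projective object, with $\mathscr{E}$ the class of term split, $V$-split, $V$-term split, term+$V$-split sequences respectively.
   Formalization: In (b), for the V-split and V-term split homotopy categories, V is assumed to have positive rank: for V = 0 the tensor product need not be defined on the homotopy categories (G = 1, k = Z: Z = Z is projective, but its tensor product with Z/2 is not). *)

(* Defs.v *)
From HB Require Import structures.
From mathcomp Require Import all_boot all_order all_fingroup all_algebra.
From mathcomp Require Import boolp.

Set Implicit Arguments.
Unset Strict Implicit.
Unset Printing Implicit Defensive.

Import Order.TTheory GRing.Theory.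
Local Open Scope ring_scope.

(** * Categories

    Hom-sets carry an equivalence relation [heq] that plays the role of
    equality of morphisms; in the homotopy categories below, [heq] is the
    congruence by which one divides. *)

Record category := Category {
  ob :> Type;
  hom : ob -> ob -> Type;
  heq : forall x y, hom x y -> hom x y -> Prop;
  idm : forall x, hom x x;
  comp : forall x y z, hom y z -> hom x y -> hom x z;
  heq_refl : forall x y (f : hom x y), heq f f;
  heq_sym : forall x y (f g : hom x y), heq f g -> heq g f;
  heq_trans : forall x y (f g h : hom x y), heq f g -> heq g h -> heq f h;
  heq_comp : forall x y z (f f' : hom y z) (g g' : hom x y),
    heq f f' -> heq g g' -> heq (comp f g) (comp f' g');
  comp_idl : forall x y (f : hom x y), heq (comp (idm y) f) f;
  comp_idr : forall x y (f : hom x y), heq (comp f (idm x)) f;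
  compA : forall w x y z (f : hom y z) (g : hom x y) (h : hom w x),
    heq (comp f (comp g h)) (comp (comp f g) h) }.

Arguments hom {c} x y : rename.
Arguments heq {c x y} f g : rename.
Arguments idm {c} x : rename.
Arguments comp {c x y z} f g : rename.

Record functor (C D : category) := Functor {
  fob :> C -> D;
  fmap : forall x y : C, hom x y -> hom (fob x) (fob y);
  fmap_heq : forall (x y : C) (f g : hom x y), heq f g -> heq (fmap f) (fmap g);
  fmap_id : forall x : C, heq (fmap (idm x)) (idm (fob x));
  fmap_comp : forall (x y z : C) (f : hom y z) (g : hom x y),
    heq (fmap (comp f g)) (comp (fmap f) (fmap g)) }.

Arguments fmap {C D} F {x y} f : rename.

Definition idF (C : category) : functor C C :=
  @Functor C C id (fun _ _ f => f) (fun _ _ _ _ e => e)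
    (fun _ => heq_refl _) (fun _ _ _ _ _ => heq_refl _).

Program Definition compF (C D E : category) (F : functor D E) (F' : functor C D) :
    functor C E :=
  {| fob := fun x => F (F' x); fmap := fun _ _ f => fmap F (fmap F' f) |}.
Next Obligation. by do 2 apply: fmap_heq. Qed.
Next Obligation.
by apply: heq_trans (fmap_id _ _); apply: fmap_heq; apply: fmap_id.
Qed.
Next Obligation.
by apply: heq_trans (fmap_comp _ _ _); apply: fmap_heq; apply: fmap_comp.
Qed.

Program Definition prodC (C D : category) : category :=
  {| ob := (C * D)%type;
     hom := fun x y => (hom x.1 y.1 * hom x.2 y.2)%type;
     heq := fun _ _ f g => heq f.1 g.1 /\ heq f.2 g.2;
     idm := fun x => (idm x.1, idm x.2);
     comp := fun _ _ _ f g => (comp f.1 g.1, comp f.2 g.2) |}.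
Next Obligation. by split; apply: heq_refl. Qed.
Next Obligation. by split; apply: heq_sym. Qed.
Next Obligation. by split; [apply: heq_trans H0|apply: heq_trans H1]. Qed.
Next Obligation. by split; apply: heq_comp. Qed.
Next Obligation. by split; apply: comp_idl. Qed.
Next Obligation. by split; apply: comp_idr. Qed.
Next Obligation. by split; apply: compA. Qed.

Program Definition prodF (C C' D D' : category)
    (F : functor C D) (F' : functor C' D') : functor (prodC C C') (prodC D D') :=
  {| fob := fun x : prodC C C' => (F x.1, F' x.2) : prodC D D';
     fmap := fun _ _ f => (fmap F f.1, fmap F' f.2) |}.
Next Obligation. by split; apply: fmap_heq. Qed.
Next Obligation. by split; apply: fmap_id. Qed.
Next Obligation. by split; apply: fmap_comp. Qed.

Record nat_trans (C D : category) (F F' : functor C D) := NatTrans {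
  component :> forall x : C, hom (F x) (F' x);
  naturality : forall (x y : C) (f : hom x y),
    heq (comp (component y) (fmap F f)) (comp (fmap F' f) (component x)) }.

Definition is_iso (C : category) (x y : C) (f : hom x y) : Prop :=
  exists g : hom y x, heq (comp g f) (idm x) /\ heq (comp f g) (idm y).

Definition naturally_iso (C D : category) (F F' : functor C D) : Prop :=
  exists alpha : nat_trans F F', forall x, is_iso (alpha x).

(** [L] is left adjoint to [R]. *)
Definition adjoint (C D : category) (L : functor C D) (R : functor D C) : Prop :=
  exists (eta : nat_trans (idF C) (compF R L))
         (eps : nat_trans (compF L R) (idF D)),
    (forall x : C, heq (comp (eps (L x)) (fmap L (eta x))) (idm (L x))) /\
    (forall y : D, heq (comp (fmap R (eps y)) (eta (R y))) (idm (R y))).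

(** * Tensor products

    [tensor r l] is the [k]-module [\bigoplus_(a : A) M a (x) N a] divided by
    the relations [r a s m (x) n = m (x) l a s n], presented by generators
    [(a, m, n)] and relations: a word of generators stands for their sum.
    With [S = void] it is [\bigoplus_a M a (x)_k N a]; with [A = unit] and a
    group [S] acting on the right of [M] and on the left of [N], it is
    [M (x)_(kS) N]. *)

Section Linfun.
Variables (k : comPzRingType) (U W : lmodType k) (f : U -> W) (fP : linear f).
Definition mklinear : {linear U -> W} :=
  HB.pack_for {linear U -> W} f (GRing.isLinear.Build k U W *:%R f fP).
Lemma linear_fun0 : f 0 = 0. Proof. exact: (linear0 mklinear). Qed.
End Linfun.

Section Tensor.
Variables (k : comPzRingType) (A : choiceType) (M N : A -> lmodType k) (S : Type).
Variables (r : forall a, S -> {linear M a -> M a}).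
Variables (l : forall a, S -> {linear N a -> N a}).

Definition tgen := {a : A & (M a * N a)%type}.
Definition mkgen a m n : tgen := existT (fun a => M a * N a)%type a (m, n).

Inductive tens_eq : seq tgen -> seq tgen -> Prop :=
| te_refl w : tens_eq w w
| te_sym w w' : tens_eq w w' -> tens_eq w' w
| te_trans w w' w'' : tens_eq w w' -> tens_eq w' w'' -> tens_eq w w''
| te_cat v v' w w' : tens_eq v v' -> tens_eq w w' -> tens_eq (v ++ w) (v' ++ w')
| te_comm v w : tens_eq (v ++ w) (w ++ v)
| te_0 a n : tens_eq [:: mkgen (a := a) 0 n] [::]
| te_Dl a m m' n :
    tens_eq [:: mkgen (a := a) (m + m') n] [:: mkgen m n; mkgen m' n]
| te_Dr a m n n' :
    tens_eq [:: mkgen (a := a) m (n + n')] [:: mkgen m n; mkgen m n']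
| te_Z a c m n :
    tens_eq [:: mkgen (a := a) (c *: m) n] [:: mkgen m (c *: n)]
| te_bal a s m n :
    tens_eq [:: mkgen (a := a) (r a s m) n] [:: mkgen m (l a s n)].

Definition tens_rel : rel (seq tgen) := fun w w' => `[< tens_eq w w' >].

Lemma tens_relP : equiv_class_of tens_rel.
Proof.
split=> [w|w w'|w' w w''].
- by apply/asboolP; apply: te_refl.
- by apply/asboolP/asboolP; apply: te_sym.
- by move=> /asboolP h /asboolP h'; apply/asboolP; apply: te_trans h'.
Qed.

Canonical tens_equiv := EquivRelPack tens_relP.

Definition tensor : Type := {eq_quot tens_equiv}%qT.
HB.instance Definition _ := Choice.on tensor.

Definition tcl (w : seq tgen) : tensor := (\pi_({eq_quot tens_equiv}) w)%qT.
Definition trepr (t : tensor) : seq tgen :=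
  generic_quotient.repr (t : {eq_quot tens_equiv}%qT).

Lemma treprK t : tcl (trepr t) = t.
Proof. exact: reprK. Qed.

Lemma tclP w w' : tens_eq w w' <-> tcl w = tcl w'.
Proof.
split=> [h|]; first by apply/eqmodP; apply/asboolP.
by move/eqmodP/asboolP.
Qed.

Lemma trepr_cl w : tens_eq (trepr (tcl w)) w.
Proof. by apply/tclP; rewrite treprK. Qed.

Definition gscale c (g : tgen) : tgen :=
  mkgen (c *: (tagged g).1) (tagged g).2.
Definition tadd (t u : tensor) := tcl (trepr t ++ trepr u).
Definition tscale c (t : tensor) := tcl [seq gscale c g | g <- trepr t].

Lemma tens_eq_scale c w w' :
  tens_eq w w' -> tens_eq (map (gscale c) w) (map (gscale c) w').
Proof.
elim=> {w w'} /=.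
- by move=> w; apply: te_refl.
- by move=> w w' _; apply: te_sym.
- by move=> w w' w'' _ h _; apply: te_trans.
- by move=> v v' w w' _ h _ h'; rewrite !map_cat; apply: te_cat.
- by move=> v w; rewrite !map_cat; apply: te_comm.
- by move=> a n; rewrite /gscale /= scaler0; apply: te_0.
- by move=> a m m' n; rewrite /gscale /= scalerDr; apply: te_Dl.
- by move=> a m n n'; apply: te_Dr.
- move=> a d m n; rewrite /gscale /= scalerA mulrC -scalerA; exact: te_Z.
- by move=> a s m n; rewrite /gscale /= -linearZ; apply: te_bal.
Qed.

Lemma tadd_cl w w' : tadd (tcl w) (tcl w') = tcl (w ++ w').
Proof. by apply/tclP; apply: te_cat; apply: trepr_cl. Qed.

Lemma tscale_cl c w : tscale c (tcl w) = tcl (map (gscale c) w).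
Proof. by apply/tclP; apply: tens_eq_scale; apply: trepr_cl. Qed.

Lemma tcl_ind (P : tensor -> Prop) : (forall w, P (tcl w)) -> forall t, P t.
Proof. by move=> h t; rewrite -(treprK t). Qed.

Lemma taddA : associative tadd.
Proof.
elim/tcl_ind=> u; elim/tcl_ind=> v; elim/tcl_ind=> w.
by rewrite !tadd_cl catA.
Qed.
Lemma taddC : commutative tadd.
Proof.
elim/tcl_ind=> u; elim/tcl_ind=> v; rewrite !tadd_cl; apply/tclP.
exact: te_comm.
Qed.
Lemma tadd0 : left_id (tcl [::]) tadd.
Proof. by elim/tcl_ind=> u; rewrite tadd_cl. Qed.

Lemma tens_eq_scaleD c d w :
  tens_eq (map (gscale (c + d)) w) (map (gscale c) w ++ map (gscale d) w).
Proof.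
elim: w => [|[a [m n]] w IH] /=; first exact: te_refl.
apply: (te_trans (w' := [:: gscale c (mkgen m n); gscale d (mkgen m n)]
  ++ (map (gscale c) w ++ map (gscale d) w))).
  rewrite -cat1s; apply: te_cat IH.
  suff -> : gscale (c + d) (mkgen m n) = mkgen (c *: m + d *: m) n.
    exact: te_Dl.
  by rewrite /gscale [X in mkgen X]/= scalerDl.
rewrite -[X in tens_eq X _]/([:: gscale c (mkgen m n)] ++
  ([:: gscale d (mkgen m n)] ++ map (gscale c) w) ++ map (gscale d) w).
rewrite -[X in tens_eq _ X]/([:: gscale c (mkgen m n)] ++
  map (gscale c) w ++ [:: gscale d (mkgen m n)] ++ map (gscale d) w).
apply: te_cat; first exact: te_refl.
rewrite [X in tens_eq _ X]catA.
by apply: te_cat; [exact: te_comm|exact: te_refl].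
Qed.

Lemma tens_eq_scale0 w : tens_eq (map (gscale 0) w) [::].
Proof.
elim: w => [|[a [m n]] w IH] /=; first exact: te_refl.
rewrite -cat1s -[X in tens_eq _ X]cat0s; apply: te_cat => //.
by rewrite /gscale /= scale0r; apply: te_0.
Qed.

Lemma gscale1 : gscale 1 =1 id.
Proof. by case=> a [m n]; rewrite /gscale /= scale1r. Qed.

Lemma taddN : left_inverse (tcl [::]) (tscale (-1)) tadd.
Proof.
elim/tcl_ind=> w; rewrite tscale_cl tadd_cl; apply/tclP.
apply: te_trans (tens_eq_scale0 w); apply: te_sym.
rewrite -(addNr 1); apply: te_trans (tens_eq_scaleD _ _ _) _.
by rewrite (eq_map gscale1) map_id; apply: te_refl.
Qed.

HB.instance Definition _ := GRing.isZmodule.Build tensor taddA taddC tadd0 taddN.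

Lemma tscaleA c d t : tscale c (tscale d t) = tscale (c * d) t.
Proof.
elim/tcl_ind: t => w; rewrite !tscale_cl -map_comp; congr tcl.
by apply: eq_map => -[a [m n]]; rewrite /gscale /= scalerA.
Qed.
Lemma tscale1 : left_id 1 tscale.
Proof. by elim/tcl_ind=> w; rewrite tscale_cl (eq_map gscale1) map_id. Qed.
Lemma tscaleDr : right_distributive tscale +%R.
Proof.
move=> c; elim/tcl_ind=> u; elim/tcl_ind=> v.
by rewrite [_ + _]tadd_cl !tscale_cl [RHS]tadd_cl map_cat.
Qed.
Lemma tscaleDl t : {morph tscale^~ t : c d / c + d}.
Proof.
elim/tcl_ind: t => w c d; rewrite !tscale_cl [RHS]tadd_cl; apply/tclP.
exact: tens_eq_scaleD.
Qed.

HB.instance Definition _ :=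
  GRing.Zmodule_isLmodule.Build k tensor tscaleA tscale1 tscaleDr tscaleDl.

Definition pure a (m : M a) (n : N a) : tensor := tcl [:: mkgen m n].

Lemma tclE w : tcl w = \sum_(g <- w) pure (tagged g).1 (tagged g).2.
Proof.
elim: w => [|[a [m n]] w IH]; first by rewrite big_nil.
by rewrite big_cons -IH [RHS]tadd_cl.
Qed.

Lemma pureDl a m m' n : pure (a := a) (m + m') n = pure m n + pure m' n.
Proof. by rewrite [RHS]tadd_cl; apply/tclP; apply: te_Dl. Qed.
Lemma pureDr a m n n' : pure (a := a) m (n + n') = pure m n + pure m n'.
Proof. by rewrite [RHS]tadd_cl; apply/tclP; apply: te_Dr. Qed.
Lemma pureZl a c m n : pure (a := a) (c *: m) n = c *: pure m n.
Proof. by rewrite [RHS]tscale_cl. Qed.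
Lemma pureZr a c m n : pure (a := a) m (c *: n) = c *: pure m n.
Proof. by rewrite -pureZl; apply/esym/tclP; apply: te_Z. Qed.
Lemma pure_bal a s m n : pure (r a s m) n = pure m (l a s n).
Proof. by apply/tclP; apply: te_bal. Qed.
Lemma pure_linl a n : linear (fun m => pure (a := a) m n).
Proof. by move=> c m m'; rewrite pureDl pureZl. Qed.
Lemma pure_linr a m : linear (fun n => pure (a := a) m n).
Proof. by move=> c n n'; rewrite pureDr pureZr. Qed.

Variable P : lmodType k.

Definition balanced (b : forall a, M a -> N a -> P) : Prop :=
  [/\ forall a n, linear (fun m => b a m n),
      forall a m, linear (b a m)
    & forall a s m n, b a (r a s m) n = b a m (l a s n)].

Definition tlift_fun (b : forall a, M a -> N a -> P) (t : tensor) : P :=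
  \sum_(g <- trepr t) b (tag g) (tagged g).1 (tagged g).2.

Section Lift.
Variables (b : forall a, M a -> N a -> P) (bP : balanced b).

Lemma tens_eq_lift w w' : tens_eq w w' ->
  \sum_(g <- w) b (tagged g).1 (tagged g).2 =
  \sum_(g <- w') b (tagged g).1 (tagged g).2.
Proof.
case: bP => bl br bb; elim=> {w w'}.
- by [].
- by move=> w w' _ ->.
- by move=> w w' w'' _ -> _ ->.
- by move=> v v' w w' _ h _ h'; rewrite !big_cat /= h h'.
- by move=> v w; rewrite !big_cat /= addrC.
- by move=> a n; rewrite big_seq1 big_nil /= (linear_fun0 (bl a n)).
- move=> a m m' n; rewrite !big_cons big_nil /= !addr0.
  by have := bl a n 1 m m'; rewrite !scale1r.
- move=> a m n n'; rewrite !big_cons big_nil /= !addr0.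
  by have := br a m 1 n n'; rewrite !scale1r.
- move=> a c m n; rewrite !big_seq1 /=.
  have := bl a n c m 0; rewrite (linear_fun0 (bl a n)) !addr0 => ->.
  by have := br a m c n 0; rewrite (linear_fun0 (br a m)) !addr0 => ->.
- by move=> a s m n; rewrite !big_seq1 /= bb.
Qed.

Lemma tlift_cl w :
  tlift_fun b (tcl w) = \sum_(g <- w) b (tagged g).1 (tagged g).2.
Proof. exact: tens_eq_lift (trepr_cl w). Qed.

Lemma tlift_linear : linear (tlift_fun b).
Proof.
case: bP => bl br bb c; elim/tcl_ind=> u; elim/tcl_ind=> v.
rewrite [c *: _]tscale_cl [_ + _]tadd_cl !tlift_cl big_cat big_map /=.
congr (_ + _); rewrite scaler_sumr; apply: eq_bigr => -[a [m n]] _ /=.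
by have := bl a n c m 0; rewrite (linear_fun0 (bl a n)) !addr0.
Qed.

Definition tlift : {linear tensor -> P} := mklinear tlift_linear.

Lemma tlift_pure a (m : M a) (n : N a) : tlift (pure m n) = b m n.
Proof. by rewrite [LHS]tlift_cl big_seq1. Qed.
End Lift.

Lemma tensor_ext (f g : {linear tensor -> P}) :
  (forall a (m : M a) (n : N a), f (pure m n) = g (pure m n)) -> f =1 g.
Proof.
move=> h; elim/tcl_ind=> w; rewrite tclE !linear_sum.
by apply: eq_bigr => x _; apply: h.
Qed.

End Tensor.

Arguments pure {k A M N S} r l {a} m n.

Lemma tmap_balanced (k : comPzRingType) (A A' : choiceType)
    (M N : A -> lmodType k) (M' N' : A' -> lmodType k) (S : Type)
    (r : forall a, S -> {linear M a -> M a})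
    (l : forall a, S -> {linear N a -> N a})
    (r' : forall a, S -> {linear M' a -> M' a})
    (l' : forall a, S -> {linear N' a -> N' a})
    (u : A -> A')
    (f : forall a, M a -> M' (u a)) (h : forall a, N a -> N' (u a)) :
  (forall a, linear (f a)) -> (forall a, linear (h a)) ->
  (forall a s m, f a (r a s m) = r' (u a) s (f a m)) ->
  (forall a s n, h a (l a s n) = l' (u a) s (h a n)) ->
  balanced r l (fun a m n => pure r' l' (f a m) (h a n)).
Proof.
move=> fl hl fr hr; split.
- by move=> a n c m m'; rewrite fl pureDl pureZl.
- by move=> a m c n n'; rewrite hl pureDr pureZr.
- by move=> a s m n; rewrite fr hr pure_bal.
Qed.

#[local] Obligation Tactic := idtac.

Section Modules.
Variables (k : comPzRingType) (gT : finGroupType).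
Implicit Types (J G H L : {group gT}).

(** * Modules

    A [kJ]-module is a [k]-module with a [k]-linear action of [J].  As for
    [mx_representation], [act g] is irrelevant for [g] outside [J]. *)

Record gmod J := Gmod {
  gcar :> lmodType k;
  act : gT -> gcar -> gcar;
  act_linear : forall g, linear (act g);
  act1 : forall x, act 1%g x = x;
  actM : forall g h x, g \in J -> h \in J -> act (g * h)%g x = act g (act h x) }.

HB.instance Definition _ J (X : gmod J) g :=
  GRing.isLinear.Build k X X *:%R (@act J X g) (@act_linear J X g).

Lemma actD J (X : gmod J) g (x y : X) : act g (x + y) = act g x + act g y.
Proof. exact: linearD. Qed.
Lemma actZ J (X : gmod J) g c (x : X) : act g (c *: x) = c *: act g x.
Proof. exact: linearZZ. Qed.

Record ghom J (X Y : gmod J) := Ghom {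
  gfun :> X -> Y;
  gfun_linear : linear gfun;
  gfun_act : forall g x, g \in J -> gfun (act g x) = act g (gfun x) }.

HB.instance Definition _ J (X Y : gmod J) (f : ghom X Y) :=
  GRing.isLinear.Build k X Y *:%R (@gfun J X Y f) (@gfun_linear J X Y f).

Lemma ghomD J (X Y : gmod J) (f : ghom X Y) x y : f (x + y) = f x + f y.
Proof. exact: linearD. Qed.
Lemma ghomB J (X Y : gmod J) (f : ghom X Y) x y : f (x - y) = f x - f y.
Proof. exact: linearB. Qed.
Lemma ghomN J (X Y : gmod J) (f : ghom X Y) x : f (- x) = - f x.
Proof. exact: linearN. Qed.
Lemma ghomZ J (X Y : gmod J) (f : ghom X Y) c x : f (c *: x) = c *: f x.
Proof. exact: linearZZ. Qed.
Lemma ghom0 J (X Y : gmod J) (f : ghom X Y) : f 0 = 0.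
Proof. exact: linear0. Qed.

Program Definition MOD J : category :=
  {| ob := gmod J; hom := @ghom J; heq := fun _ _ f g => f =1 g;
     idm := fun X => @Ghom J X X id _ _;
     comp := fun X Y Z f g => @Ghom J X Z (fun x => f (g x)) _ _ |}.
Next Obligation. by []. Qed.
Next Obligation. by []. Qed.
Next Obligation. by move=> J X Y Z f g c x y /=; rewrite !linearP. Qed.
Next Obligation. by move=> J X Y Z f g h x hJ /=; rewrite !gfun_act. Qed.
Next Obligation. by []. Qed.
Next Obligation. by move=> J X Y f g e x; rewrite e. Qed.
Next Obligation. by move=> J X Y f g h e e' x; rewrite e e'. Qed.
Next Obligation. by move=> J X Y Z f f' g g' e e' x /=; rewrite e' e. Qed.
Next Obligation. by []. Qed.
Next Obligation. by []. Qed.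
Next Obligation. by []. Qed.

Definition free_of_rank J (V : gmod J) (n : nat) : Prop :=
  exists e : 'I_n -> V, forall v : V,
    exists! c : {ffun 'I_n -> k}, v = \sum_i c i *: e i.

Definition submodule J (X : gmod J) (W : X -> Prop) : Prop :=
  [/\ W 0, forall x y, W x -> W y -> W (x + y), forall c x, W x -> W (c *: x)
    & forall g x, g \in J -> W x -> W (act g x)].

Definition finitely_generated J (X : gmod J) : Prop :=
  exists s : seq X, forall W : X -> Prop,
    submodule W -> (forall x, x \in s -> W x) -> forall x, W x.

(** [W' / W] is simple: its submodules are the submodules between [W] and
    [W']. *)
Definition simple_step J (X : gmod J) (W W' : X -> Prop) : Prop :=
  [/\ forall x, W x -> W' x, exists2 x, W' x & ~ W x
    & forall U : X -> Prop, submodule U ->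
        (forall x, W x -> U x) -> (forall x, U x -> W' x) ->
        (forall x, U x -> W x) \/ (forall x, W' x -> U x)].

Definition finite_length J (X : gmod J) : Prop :=
  exists (n : nat) (W : nat -> X -> Prop),
    [/\ forall i, (i <= n)%N -> submodule (W i),
        forall x, W 0%N x <-> x = 0, forall x, W n x
      & forall i, (i < n)%N -> simple_step (W i) (W i.+1)].

Section Res.
Variables (H G : {group gT}) (sHG : H \subset G).

Program Definition res (X : gmod G) : gmod H :=
  @Gmod H X (@act G X) (@act_linear G X) (@act1 G X) _.
Next Obligation.
by move=> X g h x gH hH; rewrite actM ?(subsetP sHG).
Qed.

Program Definition ResM : functor (MOD G) (MOD H) :=
  @Functor (MOD G) (MOD H) res
    (fun X Y f => @Ghom H (res X) (res Y) f (@gfun_linear _ _ _ f) _) _ _ _.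
Next Obligation. by move=> X Y f g x gH; rewrite /= gfun_act ?(subsetP sHG). Qed.
Next Obligation. by move=> X Y f g e x; apply: e. Qed.
Next Obligation. by []. Qed.
Next Obligation. by []. Qed.
End Res.

(** [t (x) X], for [L = t^-1 L' t]: the elements [t (x) x], on which
    [g \in L'] acts by [g (t (x) x) = t (x) (t^-1 g t) x]. *)
Section Conj.
Variables (t : gT) (L L' : {group gT}) (eL : (L' :^ t)%g = L).

Program Definition conj_mod (X : gmod L) : gmod L' :=
  @Gmod L' X (fun g x => act (g ^ t)%g x) (fun g => @act_linear L X (g ^ t)%g) _ _.
Next Obligation. by move=> X x /=; rewrite conj1g act1. Qed.
Next Obligation.
by move=> X g h x gL hL /=; rewrite conjMg actM // -eL memJ_conjg.
Qed.

Program Definition ConjM : functor (MOD L) (MOD L') :=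
  @Functor (MOD L) (MOD L') conj_mod
    (fun X Y f =>
       @Ghom L' (conj_mod X) (conj_mod Y) f (@gfun_linear _ _ _ f) _) _ _ _.
Next Obligation.
by move=> X Y f g x gL; rewrite /= gfun_act // -eL memJ_conjg.
Qed.
Next Obligation. by move=> X Y f g e x; apply: e. Qed.
Next Obligation. by []. Qed.
Next Obligation. by []. Qed.
End Conj.

(** [kG] as a [k]-module is [{ffun [subg G] -> k^o}], the function [a]
    standing for [\sum_g a g * g]; [glmul g] and [grmul h] are left
    multiplication by [g] and right multiplication by [h]. *)
Section Ind.
Variables (G H : {group gT}).
Let kG : lmodType k := {ffun [subg G] -> k^o}.

Definition glmul (g : gT) (a : kG) : kG :=
  [ffun v => a ((subg G g)^-1 * v)%g].
Definition grmul (h : gT) (a : kG) : kG :=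
  [ffun v => a (v * (subg G h)^-1)%g].

Lemma glmul_linear g : linear (glmul g).
Proof. by move=> c a b; apply/ffunP => v; rewrite !ffunE. Qed.
Lemma grmul_linear h : linear (grmul h).
Proof. by move=> c a b; apply/ffunP => v; rewrite !ffunE. Qed.

Definition ind_r (_ : unit) (h : [subg H]) : {linear kG -> kG} :=
  mklinear (grmul_linear (sgval h)).
Definition ind_l (X : gmod H) (_ : unit) (h : [subg H]) : {linear X -> X} :=
  mklinear (@act_linear H X (sgval h)).

(** [kG (x)_(kH) X], meant for [H \subset G] (otherwise [subg G h] is junk) *)
Definition ind_car (X : gmod H) : lmodType k :=
  tensor (M := fun _ : unit => kG) (N := fun _ : unit => gcar X)
         ind_r (ind_l X).

Lemma ind_act_balanced (X : gmod H) g :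
  balanced ind_r (ind_l X)
    (fun a m x => pure ind_r (ind_l X) (a := a) (glmul g m) x).
Proof.
apply: (tmap_balanced (u := id)) => //; first by move=> a; apply: glmul_linear.
by move=> a h m; apply/ffunP => v; rewrite /= !ffunE mulgA.
Qed.

Definition ind_act (X : gmod H) g : {linear ind_car X -> ind_car X} :=
  tlift (ind_act_balanced X g).

Definition ipure (X : gmod H) (m : kG) (x : X) : ind_car X :=
  pure ind_r (ind_l X) (a := tt) m x.

Lemma ind_actE X g m x : ind_act X g (ipure m x) = ipure (glmul g m) x.
Proof. exact: tlift_pure. Qed.

Lemma ind_ext (X : gmod H) (P : lmodType k) (f g : {linear ind_car X -> P}) :
  (forall m x, f (ipure m x) = g (ipure m x)) -> f =1 g.
Proof. by move=> h; apply: tensor_ext => -[]; apply: h. Qed.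

Program Definition ind (X : gmod H) : gmod G :=
  @Gmod G (ind_car X) (ind_act X) _ _ _.
Next Obligation. by move=> X g c x y; rewrite linearP. Qed.
Next Obligation.
move=> X; apply: (ind_ext (f := ind_act X 1%g) (g := idfun)) => m x.
rewrite ind_actE; congr ipure; apply/ffunP => v; rewrite !ffunE.
by rewrite morph1 invg1 mul1g.
Qed.
Next Obligation.
move=> X g h t gG hG; move: t.
apply: (ind_ext (f := ind_act X (g * h)%g) (g := ind_act X g \o ind_act X h)).
move=> m x.
rewrite -[RHS]/(ind_act X g (ind_act X h (ipure m x))) !ind_actE.
congr ipure; apply/ffunP => v; rewrite !ffunE.
by rewrite morphM // invMg mulgA.
Qed.

Lemma ind_map_balanced (X Y : gmod H) (f : ghom X Y) :
  balanced ind_r (ind_l X)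
    (fun a m x => pure ind_r (ind_l Y) (a := a) m (f x)).
Proof.
apply: (tmap_balanced (u := id)) => //.
- by move=> a; apply: gfun_linear.
- by move=> a [h hH] x /=; rewrite gfun_act.
Qed.

Definition ind_map_lin (X Y : gmod H) (f : ghom X Y) :
  {linear ind_car X -> ind_car Y} := tlift (ind_map_balanced f).

Lemma ind_mapE X Y (f : ghom X Y) m x :
  ind_map_lin f (ipure m x) = ipure m (f x).
Proof. exact: tlift_pure. Qed.

Program Definition ind_map (X Y : gmod H) (f : ghom X Y) : ghom (ind X) (ind Y) :=
  @Ghom G (ind X) (ind Y) (ind_map_lin f) _ _.
Next Obligation. by move=> X Y f c x y; rewrite linearP. Qed.
Next Obligation.
move=> X Y f g t gG; move: t.
apply: (ind_ext (f := ind_map_lin f \o ind_act X g)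
                (g := ind_act Y g \o ind_map_lin f)) => m x.
rewrite -[LHS]/(ind_map_lin f (ind_act X g (ipure m x))).
rewrite -[RHS]/(ind_act Y g (ind_map_lin f (ipure m x))).
by rewrite ind_actE !ind_mapE ind_actE.
Qed.

Program Definition IndM : functor (MOD H) (MOD G) :=
  @Functor (MOD H) (MOD G) ind ind_map _ _ _.
Next Obligation.
move=> X Y f g e; apply: (ind_ext (f := ind_map_lin f) (g := ind_map_lin g)).
by move=> m x; rewrite !ind_mapE e.
Qed.
Next Obligation.
move=> X; apply: (ind_ext (f := ind_map_lin (idm (X : MOD H))) (g := idfun)).
by move=> m x; rewrite ind_mapE.
Qed.
Next Obligation.
move=> X Y Z f g.
apply: (ind_ext (f := ind_map_lin (comp (c := MOD H) f g))
                (g := ind_map_lin f \o ind_map_lin g)) => m x.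
by rewrite -[RHS]/(ind_map_lin f (ind_map_lin g (ipure m x))) !ind_mapE.
Qed.
End Ind.

(** [\bigoplus_a M a (x)_k N a] with diagonal action. *)
Section DiagonalTensor.
Variable J : {group gT}.

Definition no_op (A : choiceType) (M : A -> gmod J) (a : A) (s : void) :
  {linear M a -> M a} := match s with end.

Definition dt_car (A : choiceType) (M N : A -> gmod J) : lmodType k :=
  tensor (M := M) (N := N) (no_op M) (no_op N).

Definition dpure (A : choiceType) (M N : A -> gmod J) a (m : M a) (n : N a) :
  dt_car M N := pure (no_op M) (no_op N) m n.

Lemma dt_ext (A : choiceType) (M N : A -> gmod J) (P : lmodType k)
    (f g : {linear dt_car M N -> P}) :
  (forall a (m : M a) (n : N a), f (dpure m n) = g (dpure m n)) -> f =1 g.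
Proof. exact: tensor_ext. Qed.

Section Map.
Variables (A A' : choiceType) (M N : A -> gmod J) (M' N' : A' -> gmod J).
Variables (u : A -> A').
Variables (f : forall a, M a -> M' (u a)) (h : forall a, N a -> N' (u a)).
Hypotheses (fP : forall a, linear (@f a)) (hP : forall a, linear (@h a)).

Lemma dt_balanced : balanced (no_op M) (no_op N)
  (fun a m n => dpure (N := N') (f m) (h n)).
Proof. exact: tmap_balanced. Qed.

Definition dt_lin : {linear dt_car M N -> dt_car M' N'} := tlift dt_balanced.

Lemma dt_linE a (m : M a) (n : N a) :
  dt_lin (dpure m n) = dpure (f m) (h n).
Proof. exact: tlift_pure. Qed.
End Map.

Section Mod.
Variables (A : choiceType) (M N : A -> gmod J).

Definition dt_act (g : gT) : {linear dt_car M N -> dt_car M N} :=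
  dt_lin (u := id) (fun a => @act_linear J (M a) g)
                   (fun a => @act_linear J (N a) g).

Lemma dt_actE g a (m : M a) (n : N a) :
  dt_act g (dpure m n) = dpure (act g m) (act g n).
Proof. exact: dt_linE. Qed.

Program Definition dtens : gmod J := @Gmod J (dt_car M N) dt_act _ _ _.
Next Obligation. by move=> g c x y; rewrite linearP. Qed.
Next Obligation.
apply: (dt_ext (f := dt_act 1%g) (g := idfun)) => a m n.
by rewrite dt_actE !act1.
Qed.
Next Obligation.
move=> g h t gJ hJ; move: t.
apply: (dt_ext (f := dt_act (g * h)%g) (g := dt_act g \o dt_act h)) => a m n.
rewrite -[RHS]/(dt_act g (dt_act h (dpure m n))).
by rewrite !dt_actE !actM.
Qed.
End Mod.

Section Hom.
Variables (A : choiceType) (M N M' N' : A -> gmod J).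
Variables (f : forall a, ghom (M a) (M' a)) (h : forall a, ghom (N a) (N' a)).

Definition dt_map_lin : {linear dt_car M N -> dt_car M' N'} :=
  dt_lin (u := id) (fun a => @gfun_linear J _ _ (f a))
                   (fun a => @gfun_linear J _ _ (h a)).

Lemma dt_mapE a (m : M a) (n : N a) :
  dt_map_lin (dpure m n) = dpure (f a m) (h a n).
Proof. exact: dt_linE. Qed.

Program Definition dt_map : ghom (dtens M N) (dtens M' N') :=
  @Ghom J (dtens M N) (dtens M' N') dt_map_lin _ _.
Next Obligation. by move=> c x y; rewrite linearP. Qed.
Next Obligation.
move=> g t gJ; move: t.
apply: (dt_ext (f := dt_map_lin \o dt_act M N g)
               (g := dt_act M' N' g \o dt_map_lin)) => a m n.
rewrite -[LHS]/(dt_map_lin (dt_act M N g (dpure m n))).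
rewrite -[RHS]/(dt_act M' N' g (dt_map_lin (dpure m n))).
by rewrite dt_actE !dt_mapE dt_actE !gfun_act.
Qed.
End Hom.

Section TensorWith.
Variable V : gmod J.

Definition vtens (X : gmod J) : gmod J :=
  dtens (fun _ : unit => V) (fun _ : unit => X).

Definition vmap (X Y : gmod J) (f : ghom X Y) : ghom (vtens X) (vtens Y) :=
  dt_map (fun _ : unit => idm (V : MOD J)) (fun _ : unit => f).

Definition vpure (X : gmod J) (v : V) (x : X) : vtens X :=
  dpure (M := fun _ : unit => V) (N := fun _ : unit => X) (a := tt) v x.

Lemma vmapE X Y (f : ghom X Y) v x : vmap f (vpure v x) = vpure v (f x).
Proof. exact: dt_mapE. Qed.

Lemma vtens_ext (X : gmod J) (P : lmodType k) (f g : {linear vtens X -> P}) :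
  (forall v x, f (vpure v x) = g (vpure v x)) -> f =1 g.
Proof. by move=> h; apply: dt_ext => -[]; apply: h. Qed.

Program Definition TensM : functor (MOD J) (MOD J) :=
  @Functor (MOD J) (MOD J) vtens vmap _ _ _.
Next Obligation.
move=> X Y f g e; apply: (vtens_ext (f := vmap f) (g := vmap g)) => v x.
by rewrite -[LHS]/(vmap f (vpure v x)) -[RHS]/(vmap g (vpure v x)) !vmapE e.
Qed.
Next Obligation.
move=> X; apply: (vtens_ext (f := vmap (idm (X : MOD J))) (g := idfun)) => v x.
exact: vmapE.
Qed.
Next Obligation.
move=> X Y Z f g.
apply: (vtens_ext (f := vmap (comp (c := MOD J) f g))
                  (g := vmap f \o vmap g)) => v x.
rewrite -[LHS]/(vmap (comp (c := MOD J) f g) (vpure v x)).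
by rewrite -[RHS]/(vmap f (vmap g (vpure v x))) !vmapE.
Qed.
End TensorWith.
End DiagonalTensor.

Record complex J := Complex {
  term :> int -> gmod J;
  diff : forall n, ghom (term n) (term (n + 1));
  diff_diff : forall n x, diff (n + 1) (diff n x) = 0 }.

Record chain J (X Y : complex J) := Chain {
  cmap :> forall n, ghom (X n) (Y n);
  cmap_diff : forall n x, cmap (n + 1) (diff X n x) = diff Y n (cmap n x) }.

Program Definition CX J : category :=
  {| ob := complex J; hom := @chain J;
     heq := fun _ _ f g => forall n, f n =1 g n;
     idm := fun X => @Chain J X X (fun n => idm (X n : MOD J)) _;
     comp := fun X Y Z f g =>
       @Chain J X Z (fun n => comp (c := MOD J) (f n) (g n)) _ |}.
Next Obligation. by []. Qed.
Next Obligation. by move=> J X Y Z f g n x; rewrite /= !cmap_diff. Qed.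
Next Obligation. by []. Qed.
Next Obligation. by move=> J X Y f g e n x; rewrite e. Qed.
Next Obligation. by move=> J X Y f g h e e' n x; rewrite e e'. Qed.
Next Obligation. by move=> J X Y Z f f' g g' e e' n x; rewrite /= e' e. Qed.
Next Obligation. by []. Qed.
Next Obligation. by []. Qed.
Next Obligation. by []. Qed.

Section Degreewise.
Variables (J J' : {group gT}) (F : functor (MOD J) (MOD J')).
Hypothesis F0 : forall (X Y : gmod J) (f : ghom X Y),
  (forall x, f x = 0) -> forall y, fmap F f y = 0.

Program Definition dw_complex (X : complex J) : complex J' :=
  @Complex J' (fun n => F (X n)) (fun n => fmap F (diff X n)) _.
Next Obligation.
move=> X n x.
apply: etrans (esym (fmap_comp F (diff X (n + 1)) (diff X n) x)) _.
by apply: F0 => y; apply: diff_diff.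
Qed.

Program Definition dw_chain (X Y : complex J) (f : chain X Y) :
    chain (dw_complex X) (dw_complex Y) :=
  @Chain J' (dw_complex X) (dw_complex Y) (fun n => fmap F (f n)) _.
Next Obligation.
move=> X Y f n x.
apply: etrans (esym (fmap_comp F (f (n + 1)) (diff X n) x)) _.
apply: etrans (fmap_comp F (diff Y n) (f n) x).
by apply: (@fmap_heq _ _ F) => y; apply: cmap_diff.
Qed.

Program Definition degreewise : functor (CX J) (CX J') :=
  @Functor (CX J) (CX J') dw_complex dw_chain _ _ _.
Next Obligation. by move=> X Y f g e n; apply: (@fmap_heq _ _ F); apply: e. Qed.
Next Obligation. by move=> X n; apply: (@fmap_id _ _ F). Qed.
Next Obligation. by move=> X Y Z f g n; apply: (@fmap_comp _ _ F). Qed.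
End Degreewise.

Section ComplexFunctors.
Variables G H : {group gT}.

Lemma ResM0 (sHG : H \subset G) (X Y : gmod G) (f : ghom X Y) :
  (forall x, f x = 0) -> forall y, fmap (ResM sHG) f y = 0.
Proof. by []. Qed.
Definition Res (sHG : H \subset G) : functor (CX G) (CX H) :=
  degreewise (@ResM0 sHG).

Lemma ConjM0 t (eHG : (H :^ t)%g = G) (X Y : gmod G) (f : ghom X Y) :
  (forall x, f x = 0) -> forall y, fmap (ConjM eHG) f y = 0.
Proof. by []. Qed.
Definition Conj t (eHG : (H :^ t)%g = G) : functor (CX G) (CX H) :=
  degreewise (@ConjM0 t eHG).

Lemma IndM0 (X Y : gmod H) (f : ghom X Y) :
  (forall x, f x = 0) -> forall y, fmap (IndM G H) f y = 0.
Proof.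
move=> f0; apply: (ind_ext (f := ind_map_lin G f) (g := \0)) => m x.
rewrite ind_mapE f0; exact: (linear_fun0 (@pure_linr _ _ _ _ _ _ _ _ _)).
Qed.
Definition Ind : functor (CX H) (CX G) := degreewise (@IndM0).

Lemma TensM0 (V X Y : gmod H) (f : ghom X Y) :
  (forall x, f x = 0) -> forall y, fmap (TensM V) f y = 0.
Proof.
move=> f0; apply: (vtens_ext (f := vmap V f) (g := \0)) => v x.
rewrite -[LHS]/(vmap V f (vpure v x)) vmapE f0.
exact: (linear_fun0 (@pure_linr _ _ _ _ _ _ _ _ _)).
Qed.
Definition Tens_with (V : gmod H) : functor (CX H) (CX H) :=
  degreewise (@TensM0 V).
End ComplexFunctors.

(** ** Tensor product of complexes

    [(X (x) Y)^n] is the direct sum of the [X^i (x)_k Y^j], [i + j = n], and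
    [d (x (x) y) = d x (x) y + (-1)^i x (x) d y] for [x] in [X^i]. *)
Section TensorComplex.
Variable J : {group gT}.

Definition bideg (n : int) : choiceType := {p : int * int | p.1 + p.2 == n}.

Lemma bideg1_proof n (p : bideg n) : (val p).1 + 1 + (val p).2 == n + 1.
Proof. by case: p => p /= /eqP <-; rewrite addrAC. Qed.
Lemma bideg2_proof n (p : bideg n) : (val p).1 + ((val p).2 + 1) == n + 1.
Proof. by case: p => p /= /eqP <-; rewrite addrA. Qed.
Definition bideg1 n (p : bideg n) : bideg (n + 1) :=
  exist _ ((val p).1 + 1, (val p).2) (bideg1_proof p).
Definition bideg2 n (p : bideg n) : bideg (n + 1) :=
  exist _ ((val p).1, (val p).2 + 1) (bideg2_proof p).

Section Objects.
Variables X Y : complex J.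

Definition tc_term (n : int) : gmod J :=
  dtens (fun p : bideg n => X (val p).1) (fun p : bideg n => Y (val p).2).

Definition tpure n (p : bideg n) (x : X (val p).1) (y : Y (val p).2) : tc_term n :=
  dpure (M := fun p : bideg n => X (val p).1)
        (N := fun p : bideg n => Y (val p).2) x y.

Lemma tc_ext n (P : lmodType k) (f g : {linear tc_term n -> P}) :
  (forall p (x : X (val p).1) (y : Y (val p).2),
     f (tpure x y) = g (tpure x y)) -> f =1 g.
Proof. by move=> h; apply: dt_ext. Qed.

Definition koszul (i : int) : k := (-1) ^+ `|i|%N.

Lemma koszulS i : koszul (i + 1) = - koszul i.
Proof.
rewrite /koszul; case: i => n.
  by rewrite -PoszD /= addn1 exprS mulN1r.
by rewrite NegzE -addn1 PoszD opprD addrNK -opprD -PoszD !abszN !absz_nat addn1 exprS mulN1r opprK.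
Qed.

Definition tc_diff_fun n (p : bideg n) (x : X (val p).1) (y : Y (val p).2) :
    tc_term (n + 1) :=
  tpure (p := bideg1 p) (diff X _ x) y +
  koszul (val p).1 *: tpure (p := bideg2 p) x (diff Y _ y).

Lemma tpure_linl n (p : bideg n) y : linear (fun x => @tpure n p x y).
Proof. exact: pure_linl. Qed.
Lemma tpure_linr n (p : bideg n) x : linear (@tpure n p x).
Proof. exact: pure_linr. Qed.

Lemma tc_diff_balanced n :
  balanced (no_op (fun p : bideg n => X (val p).1))
           (no_op (fun p : bideg n => Y (val p).2)) (@tc_diff_fun n).
Proof.
split=> [p y c x x'|p x c y y'|p []].
- rewrite /tc_diff_fun linearP !tpure_linl scalerDr addrACA; congr (_ + _).
  by rewrite scalerDr !scalerA mulrC.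
- rewrite /tc_diff_fun linearP !tpure_linr scalerDr addrACA; congr (_ + _).
  by rewrite scalerDr !scalerA mulrC.
Qed.

Definition tc_diff_lin n : {linear tc_term n -> tc_term (n + 1)} :=
  tlift (tc_diff_balanced n).

Lemma tc_diffE n (p : bideg n) x y :
  tc_diff_lin n (@tpure n p x y) = tc_diff_fun x y.
Proof. exact: tlift_pure. Qed.

Lemma tc_actE n g (p : bideg n) x y :
  act g (@tpure n p x y) = @tpure n p (act g x) (act g y).
Proof. exact: dt_actE. Qed.

Program Definition tc_diff n : ghom (tc_term n) (tc_term (n + 1)) :=
  @Ghom J (tc_term n) (tc_term (n + 1)) (tc_diff_lin n) _ _.
Next Obligation. by move=> n c x y; rewrite linearP. Qed.
Next Obligation.
move=> n g t gJ; move: t.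
apply: (tc_ext (f := tc_diff_lin n \o @act J (tc_term n) g)
               (g := @act J (tc_term (n + 1)) g \o tc_diff_lin n)) => p x y.
rewrite -[LHS]/(tc_diff_lin n (act g (tpure x y))).
rewrite -[RHS]/(act g (tc_diff_lin n (tpure x y))).
rewrite tc_actE !tc_diffE /tc_diff_fun actD actZ.
by rewrite !tc_actE !gfun_act.
Qed.

Lemma tpure_irr n (q : int * int) (e e' : q.1 + q.2 == n) (x : X q.1) (y : Y q.2) :
  tpure (p := exist _ q e) x y = tpure (p := exist _ q e') x y.
Proof. by rewrite (bool_irrelevance e e'). Qed.

Lemma tpure_swap n (p : bideg n) (x : X ((val p).1 + 1)) (y : Y ((val p).2 + 1)) :
  tpure (p := bideg1 (bideg2 p)) x y = tpure (p := bideg2 (bideg1 p)) x y.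
Proof.
exact: (@tpure_irr _ ((val p).1 + 1, (val p).2 + 1) (bideg1_proof (bideg2 p))
                   (bideg2_proof (bideg1 p))).
Qed.

Program Definition tc : complex J := @Complex J tc_term tc_diff _.
Next Obligation.
move=> n.
apply: (tc_ext (f := tc_diff_lin (n + 1) \o tc_diff_lin n) (g := \0)) => p x y.
rewrite -[LHS]/(tc_diff_lin (n + 1) (tc_diff_lin n (tpure x y))) tc_diffE.
rewrite {1}/tc_diff_fun linearD linearZZ !tc_diffE /tc_diff_fun !diff_diff.
rewrite (linear_fun0 (@tpure_linl _ _ _)) (linear_fun0 (@tpure_linr _ _ _)).
rewrite scaler0 add0r addr0 koszulS scaleNr.
by rewrite tpure_swap addNr.
Qed.
End Objects.

Section Maps.
Variables (X X' Y Y' : complex J) (f : chain X X') (h : chain Y Y').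

Definition tc_map_deg n : ghom (tc_term X Y n) (tc_term X' Y' n) :=
  dt_map (fun p : bideg n => f (val p).1) (fun p : bideg n => h (val p).2).

Lemma tc_mapE n (p : bideg n) x y :
  tc_map_deg n (@tpure X Y n p x y) = @tpure X' Y' n p (f _ x) (h _ y).
Proof. exact: dt_mapE. Qed.

Program Definition tc_map : chain (tc X Y) (tc X' Y') :=
  @Chain J (tc X Y) (tc X' Y') tc_map_deg _.
Next Obligation.
move=> n.
apply: (tc_ext (f := tc_map_deg (n + 1) \o tc_diff_lin X Y n)
               (g := tc_diff_lin X' Y' n \o tc_map_deg n)) => p x y.
rewrite -[LHS]/(tc_map_deg (n + 1) (tc_diff_lin X Y n (tpure x y))).
rewrite -[RHS]/(tc_diff_lin X' Y' n (tc_map_deg n (tpure x y))).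
rewrite tc_mapE !tc_diffE /tc_diff_fun ghomD ghomZ !tc_mapE.
by rewrite !cmap_diff.
Qed.
End Maps.

Program Definition Tens : functor (prodC (CX J) (CX J)) (CX J) :=
  @Functor (prodC (CX J) (CX J)) (CX J)
    (fun X => tc X.1 X.2) (fun X Y f => tc_map f.1 f.2) _ _ _.
Next Obligation.
move=> X Y f g [e e'] n.
apply: (tc_ext (f := tc_map_deg f.1 f.2 n) (g := tc_map_deg g.1 g.2 n)).
move=> p x y; rewrite -[LHS]/(tc_map_deg f.1 f.2 n (tpure x y)).
rewrite -[RHS]/(tc_map_deg g.1 g.2 n (tpure x y)).
by rewrite !tc_mapE e e'.
Qed.
Next Obligation.
move=> X n.
apply: (tc_ext (f := tc_map_deg (idm (X.1 : CX J)) (idm (X.2 : CX J)) n)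
               (g := idfun)) => p x y.
exact: tc_mapE.
Qed.
Next Obligation.
move=> X Y Z f g n.
apply: (tc_ext (f := tc_map_deg (comp (c := CX J) f.1 g.1)
                                (comp (c := CX J) f.2 g.2) n)
               (g := tc_map_deg f.1 f.2 n \o tc_map_deg g.1 g.2 n)) => p x y.
rewrite -[LHS]/(tc_map_deg (comp (c := CX J) f.1 g.1)
                           (comp (c := CX J) f.2 g.2) n (tpure x y)).
rewrite -[RHS]/(tc_map_deg f.1 f.2 n (tc_map_deg g.1 g.2 n (tpure x y))).
by rewrite !tc_mapE.
Qed.
End TensorComplex.

Section Sums.
Variable J : {group gT}.

Program Definition zmodule : gmod J :=
  @Gmod J 'rV[k]_0 (fun _ => idfun) _ _ _.
Next Obligation. by []. Qed.
Next Obligation. by []. Qed.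
Next Obligation. by []. Qed.

Lemma zmodule0 (x : zmodule) : x = 0.
Proof. exact: (@thinmx0 k 1 x). Qed.

Program Definition zero_hom (X Y : gmod J) : ghom X Y :=
  @Ghom J X Y (fun _ => 0) _ _.
Next Obligation. by move=> X Y c x y; rewrite scaler0 addr0. Qed.
Next Obligation. by move=> X Y g x _; rewrite linear0. Qed.

Program Definition zcomplex : complex J :=
  @Complex J (fun _ => zmodule) (fun _ => zero_hom _ _) _.
Next Obligation. by []. Qed.

Program Definition zero_chain (X Y : complex J) : chain X Y :=
  @Chain J X Y (fun n => zero_hom _ _) _.
Next Obligation. by move=> X Y n x; rewrite ghom0. Qed.

Program Definition opp_chain (X Y : complex J) (f : chain X Y) : chain X Y :=
  @Chain J X Y (fun n => @Ghom J (X n) (Y n) (fun x => - f n x) _ _) _.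
Next Obligation.
by move=> X Y f n c x y; rewrite /= ghomD ghomZ opprD scalerN.
Qed.
Next Obligation.
by move=> X Y f n g x gJ; rewrite /= gfun_act // (linearN (@act J (Y n) g)).
Qed.
Next Obligation. by move=> X Y f n x /=; rewrite cmap_diff ghomN. Qed.

Program Definition add_chain (X Y : complex J) (f g : chain X Y) : chain X Y :=
  @Chain J X Y (fun n => @Ghom J (X n) (Y n) (fun x => f n x + g n x) _ _) _.
Next Obligation.
by move=> X Y f g n c x y; rewrite /= !ghomD !ghomZ addrACA scalerDr.
Qed.
Next Obligation.
by move=> X Y f f' n g x gJ; rewrite /= !gfun_act // actD.
Qed.
Next Obligation. by move=> X Y f g n x /=; rewrite !cmap_diff ghomD. Qed.

Program Definition msum (X Y : gmod J) : gmod J :=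
  @Gmod J (X * Y)%type (fun g p => (act g p.1, act g p.2)) _ _ _.
Next Obligation. by move=> X Y g c [x y] [x' y']; congr pair; rewrite /= linearP. Qed.
Next Obligation. by move=> X Y [x y]; rewrite /= !act1. Qed.
Next Obligation. by move=> X Y g h [x y] gJ hJ; rewrite /= !actM. Qed.

Program Definition msum_map (X Y X' Y' : gmod J) (f : ghom X X') (h : ghom Y Y') :
    ghom (msum X Y) (msum X' Y') :=
  @Ghom J (msum X Y) (msum X' Y') (fun p => (f p.1, h p.2)) _ _.
Next Obligation.
by move=> X Y X' Y' f h c [x y] [x' y']; congr pair; rewrite /= linearP.
Qed.
Next Obligation.
by move=> X Y X' Y' f h g [x y] gJ; rewrite /= !gfun_act.
Qed.

Program Definition csum (X Y : complex J) : complex J :=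
  @Complex J (fun n => msum (X n) (Y n))
    (fun n => msum_map (diff X n) (diff Y n)) _.
Next Obligation. by move=> X Y n [x y]; rewrite /= !diff_diff. Qed.

Program Definition csum_map (X Y X' Y' : complex J) (f : chain X X')
    (h : chain Y Y') : chain (csum X Y) (csum X' Y') :=
  @Chain J (csum X Y) (csum X' Y') (fun n => msum_map (f n) (h n)) _.
Next Obligation. by move=> X Y X' Y' f h n [x y]; rewrite /= !cmap_diff. Qed.

Program Definition cpair (X Y Z : complex J) (f : chain Z X) (h : chain Z Y) :
    chain Z (csum X Y) :=
  @Chain J Z (csum X Y)
    (fun n => @Ghom J (Z n) (msum (X n) (Y n)) (fun z => (f n z, h n z)) _ _) _.
Next Obligation. by move=> X Y Z f h n c x y; congr pair; rewrite /= linearP. Qed.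
Next Obligation. by move=> X Y Z f h n g x gJ; rewrite /= !gfun_act. Qed.
Next Obligation. by move=> X Y Z f h n x; rewrite /= !cmap_diff. Qed.

Program Definition cfst (X Y : complex J) : chain (csum X Y) X :=
  @Chain J (csum X Y) X
    (fun n => @Ghom J (msum (X n) (Y n)) (X n) (fun z => z.1) _ _) _.
Next Obligation. by []. Qed.
Next Obligation. by []. Qed.
Next Obligation. by []. Qed.

Program Definition csnd (X Y : complex J) : chain (csum X Y) Y :=
  @Chain J (csum X Y) Y
    (fun n => @Ghom J (msum (X n) (Y n)) (Y n) (fun z => z.2) _ _) _.
Next Obligation. by []. Qed.
Next Obligation. by []. Qed.
Next Obligation. by []. Qed.

Definition cinl (X Y : complex J) : chain X (csum X Y) :=
  cpair (idm (X : CX J)) (zero_chain X Y).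
Definition cinr (X Y : complex J) : chain Y (csum X Y) :=
  cpair (zero_chain Y X) (idm (Y : CX J)).
End Sums.

Inductive term_type := AllModules | FinitelyGenerated | FiniteLength.
Inductive bound_type := Unbounded | BoundedAbove | BoundedBelow | Bounded.

Definition has_term_type J (s : term_type) (M : gmod J) : Prop :=
  match s with
  | AllModules => True
  | FinitelyGenerated => finitely_generated M
  | FiniteLength => finite_length M
  end.

Definition bounded_above J (X : complex J) : Prop :=
  exists N : int, forall n, N < n -> forall x : X n, x = 0.
Definition bounded_below J (X : complex J) : Prop :=
  exists N : int, forall n, n < N -> forall x : X n, x = 0.

Definition has_bound_type J (b : bound_type) (X : complex J) : Prop :=
  match b with
  | Unbounded => True
  | BoundedAbove => bounded_above X
  | BoundedBelow => bounded_below X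
  | Bounded => bounded_above X /\ bounded_below X
  end.

(** The twelve types of categories [C_J] are the pairs [c]; an object of [C_J]
    is a complex [X] with [in_C c X]. *)
Definition in_C J (c : term_type * bound_type) (X : complex J) : Prop :=
  (forall n, has_term_type c.1 (X n)) /\ has_bound_type c.2 X.

(** [0 -> seqA -> seqB -> seqC -> 0], not assumed exact *)
Record cseq J := Cseq {
  seqA : complex J; seqB : complex J; seqC : complex J;
  seq_i : chain seqA seqB; seq_p : chain seqB seqC }.

Definition exact J (E : cseq J) : Prop :=
  forall n, [/\ injective (seq_i E n),
    forall y, seq_p E n y = 0 <-> exists x, y = seq_i E n x
    & forall z, exists y, seq_p E n y = z].

Definition tensor_seq J (V : gmod J) (E : cseq J) : cseq J :=
  Cseq (fmap (Tens_with V) (seq_i E)) (fmap (Tens_with V) (seq_p E)).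

(** Splitting is expressed by a section of [seq_p]; this is the usual notion
    for the sequences considered, which are exact. *)
Definition split_seq J (E : cseq J) : Prop :=
  exists s : chain (seqC E) (seqB E), forall n z, seq_p E n (s n z) = z.
Definition term_split J (E : cseq J) : Prop :=
  forall n, exists s : ghom (seqC E n) (seqB E n), forall z, seq_p E n (s z) = z.

Inductive homotopy_type := TermSplit | VSplit | VTermSplit | TermVSplit.

Definition in_E J (h : homotopy_type) (V : gmod J) (E : cseq J) : Prop :=
  match h with
  | TermSplit => term_split E
  | VSplit => split_seq (tensor_seq V E)
  | VTermSplit => term_split (tensor_seq V E)
  | TermVSplit => term_split E /\ split_seq (tensor_seq V E)
  end.

Definition hom_exact J (P : complex J) (E : cseq J) : Prop :=
  [/\ forall f f' : chain P (seqA E),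
        (forall n x, seq_i E n (f n x) = seq_i E n (f' n x)) ->
        forall n x, f n x = f' n x,
      forall f : chain P (seqB E),
        (forall n x, seq_p E n (f n x) = 0) <->
        exists g : chain P (seqA E), forall n x, f n x = seq_i E n (g n x)
    & forall f : chain P (seqC E),
        exists g : chain P (seqB E), forall n x, seq_p E n (g n x) = f n x].

Section Homotopy.
Variables (J : {group gT}) (c : term_type * bound_type) (h : homotopy_type).
Variable V : gmod J.

Definition E_projective (P : complex J) : Prop :=
  in_C c P /\
  forall E : cseq J,
    in_C c (seqA E) -> in_C c (seqB E) -> in_C c (seqC E) ->
    exact E -> in_E h V E -> hom_exact P E.

Definition hequiv (X Y : complex J) (f g : chain X Y) : Prop :=
  exists P (a : chain X P) (b : chain P Y),
    E_projective P /\ forall n x, f n x - g n x = b n (a n x).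

Lemma finitely_generated0 : finitely_generated (zmodule J).
Proof. by exists [::] => W [W0 _ _ _] _ x; rewrite (zmodule0 x). Qed.

Lemma finitely_generated_sum (X Y : gmod J) :
  finitely_generated X -> finitely_generated Y -> finitely_generated (msum X Y).
Proof.
move=> [s sP] [s' sP'].
exists ([seq (x, 0) | x <- s] ++ [seq (0, y) | y <- s']) => W [W0 WD WZ WA] Ws [x y].
have -> : (x, y) = ((x, 0) + (0, y) : msum X Y) by congr pair; rewrite ?addr0 ?add0r.
apply: (WD _ _).
- apply: (sP (fun x => W (x, 0))) => [|z zs].
    split=> // [a b Wa Wb|d a Wa|g a gJ Wa].
    + by have := WD _ _ Wa Wb; rewrite /GRing.add /= /add_pair /= addr0.
    + by have := WZ d _ Wa; rewrite /GRing.scale /= /scale_pair /= scaler0.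
    + by have := WA g _ gJ Wa; rewrite /= linear0.
  by apply: Ws; rewrite mem_cat map_f.
- apply: (sP' (fun y => W (0, y))) => [|z zs].
    split=> // [a b Wa Wb|d a Wa|g a gJ Wa].
    + by have := WD _ _ Wa Wb; rewrite /GRing.add /= /add_pair /= addr0.
    + by have := WZ d _ Wa; rewrite /GRing.scale /= /scale_pair /= scaler0.
    + by have := WA g _ gJ Wa; rewrite /= linear0.
  by apply: Ws; rewrite mem_cat [X in _ || X]map_f ?orbT.
Qed.

Lemma finite_length0 : finite_length (zmodule J).
Proof.
exists 0%N, (fun _ x => x = 0); split=> //; last exact: zmodule0.
by move=> i _; split=> *; apply: zmodule0.
Qed.

Lemma finite_length_sum (X Y : gmod J) :
  finite_length X -> finite_length Y -> finite_length (msum X Y).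
Proof.
move=> [n [W [Wsub W0 Wn Ws]]] [n' [W' [Wsub' W0' Wn' Ws']]].
have chain0 m (Z : gmod J) (U : nat -> Z -> Prop) i :
    (forall j, (j <= m)%N -> submodule (U j)) -> (i <= m)%N -> U i 0.
  by move=> Usub im; case: (Usub _ im).
pose T i (p : msum X Y) :=
  if (i <= n)%N then W i p.1 /\ p.2 = 0 else W' (i - n)%N p.2.
have TX i : (i <= n)%N -> T i = fun p => W i p.1 /\ p.2 = 0.
  by move=> le; apply/funext => p; rewrite /T le.
have TY i : T (n + i)%N = fun p => W' i p.2.
  apply/funext => p; rewrite /T; case: i => [|i].
    rewrite addn0 leqnn; apply/propext; split=> [[_ ->]|/W0' ->].
      by apply/W0'.
    by split=> //; apply: Wn.
  by rewrite addnS ltnNge leq_addr /= -addnS addKn.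
exists (n + n')%N, T; split.
- move=> i le; case: (leqP i n) => [lei|/ltnW gti].
    rewrite TX //; case: (Wsub _ lei) => w0 wD wZ wA; split=> //.
    + by move=> p q [? p0] [? q0]; split; [apply: wD|rewrite /= p0 q0 addr0].
    + by move=> d p [? p0]; split; [apply: wZ|rewrite /= p0 scaler0].
    + by move=> g p gJ [? p0]; split; [apply: wA|rewrite /= p0 linear0].
  rewrite -(subnKC gti) TY.
  have lei : (i - n <= n')%N by rewrite leq_subLR.
  case: (Wsub' _ lei) => w0 wD wZ wA; split=> //.
  + by move=> p q ? ?; apply: wD.
  + by move=> d p ?; apply: wZ.
  + by move=> g p gJ ?; apply: wA.
- move=> [x y]; rewrite TX //; split=> [[/= /W0 -> ->] //|[-> ->]].
  by split=> //; apply/W0.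
- by move=> p; rewrite TY; apply: Wn'.
- move=> i lti; case: (ltnP i n) => [lei|gei].
    rewrite !TX //; last exact: ltnW.
    case: (Ws _ lei) => le [x Wx nWx] max; split.
    + by move=> p [? ?]; split=> //; apply: le.
    + by exists (x, 0) => // -[].
    + move=> U [U0 UD UZ UA] leU Ule.
      case: (max (fun x => U (x, 0))).
      * split=> // [a b Ua Ub|d a Ua|g a gJ Ua].
        - by have := UD _ _ Ua Ub; rewrite /GRing.add /= /add_pair /= addr0.
        - by have := UZ d _ Ua; rewrite /GRing.scale /= /scale_pair /= scaler0.
        - by have := UA g _ gJ Ua; rewrite /= linear0.
      * by move=> a Wa; apply: leU.
      * by move=> a /Ule [].
      * by move=> UW; left=> -[a b] Uab; case: (Ule _ Uab) (Uab) => /= _ -> /UW.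
      * by move=> WU; right=> -[a b] [/= /WU Ua ->].
  rewrite -(subnKC gei) -addnS !TY.
  have lei : (i - n < n')%N by rewrite ltn_subLR.
  case: (Ws' _ lei) => le [y Wy nWy] max; split.
  + by move=> p ?; apply: le.
  + by exists (0, y).
  + move=> U [U0 UD UZ UA] leU Ule.
    have UX a b : U (a, b) <-> U (0, b).
      have Ua a' : U (a', 0).
        by apply: leU; apply: (chain0 _ _ _ _ Wsub'); apply: ltnW.
      split=> Ub.
        have := UD _ _ Ub (Ua (- a)).
        by rewrite /GRing.add /= /add_pair /= addrN addr0.
      have := UD _ _ Ub (Ua a).
      by rewrite /GRing.add /= /add_pair /= add0r addr0.
    case: (max (fun y => U (0, y))).
    * split=> // [a b Ua Ub|d a Ua|g a gJ Ua].
      - by have := UD _ _ Ua Ub; rewrite /GRing.add /= /add_pair /= addr0.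
      - by have := UZ d _ Ua; rewrite /GRing.scale /= /scale_pair /= scaler0.
      - by have := UA g _ gJ Ua; rewrite /= linear0.
    * by move=> a Wa; apply: leU.
    * by move=> a /Ule.
    * by move=> UW; left=> -[a b] /UX /UW.
    * by move=> WU; right=> -[a b] /= /WU Ub; apply/UX.
Qed.

Lemma in_C0 : in_C c (zcomplex J).
Proof.
split=> [n|].
  by case: c.1 => //; [apply: finitely_generated0|apply: finite_length0].
by case: c.2 => //=; [| |split]; exists 0 => n _ x; apply: zmodule0.
Qed.

Lemma bounded_above_sum (X Y : complex J) :
  bounded_above X -> bounded_above Y -> bounded_above (csum X Y).
Proof.
move=> [N NP] [N' NP']; exists (Order.max N N') => n.
by rewrite gt_max => /andP[lt lt'] [x y]; rewrite (NP _ lt x) (NP' _ lt' y).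
Qed.

Lemma bounded_below_sum (X Y : complex J) :
  bounded_below X -> bounded_below Y -> bounded_below (csum X Y).
Proof.
move=> [N NP] [N' NP']; exists (Order.min N N') => n.
by rewrite lt_min => /andP[lt lt'] [x y]; rewrite (NP _ lt x) (NP' _ lt' y).
Qed.

Lemma in_C_sum (X Y : complex J) : in_C c X -> in_C c Y -> in_C c (csum X Y).
Proof.
move=> [tX bX] [tY bY]; split=> [n|].
  move: (tX n) (tY n); case: c.1 => //=.
    exact: finitely_generated_sum.
  exact: finite_length_sum.
move: bX bY; case: c.2 => //=.
- exact: bounded_above_sum.
- exact: bounded_below_sum.
- move=> [? ?] [? ?]; split; first exact: bounded_above_sum.
  exact: bounded_below_sum.
Qed.

Lemma E_projective0 : E_projective (zcomplex J).
Proof.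
split=> [|E _ _ _ exE _]; first exact: in_C0.
split=> [f f' _ n x|f|f]; first by rewrite (zmodule0 x) !ghom0.
- split=> [_|_ n x]; last by rewrite (zmodule0 x) !ghom0.
  by exists (zero_chain _ _) => n x; rewrite (zmodule0 x) !ghom0.
- by exists (zero_chain _ _) => n x; rewrite (zmodule0 x) !ghom0.
Qed.

Lemma E_projective_sum (P Q : complex J) :
  E_projective P -> E_projective Q -> E_projective (csum P Q).
Proof.
move=> [cP pP] [cQ pQ]; split=> [|E cA cB cC exE inE]; first exact: in_C_sum.
have [injP midP surP] := pP E cA cB cC exE inE.
have [injQ midQ surQ] := pQ E cA cB cC exE inE.
split.
- move=> f f' e n x; case: (exE n) => inj _ _; apply: inj; exact: e.
- move=> f; split=> [e|[g e] n x]; last first.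
    by rewrite /= e; case: (exE n) => _ mid _; apply/mid; eexists.
  have [gP eP] : exists g : chain P (seqA E),
      forall n x, f n (cinl P Q n x) = seq_i E n (g n x).
    by apply/(midP (comp (c := CX J) f (cinl P Q))) => n x; apply: e.
  have [gQ eQ] : exists g : chain Q (seqA E),
      forall n x, f n (cinr P Q n x) = seq_i E n (g n x).
    by apply/(midQ (comp (c := CX J) f (cinr P Q))) => n x; apply: e.
  exists (add_chain (comp (c := CX J) gP (cfst P Q)) (comp (c := CX J) gQ (csnd P Q))).
  move=> n [x y] /=; rewrite ghomD.
  rewrite -[seq_i E n (gP n x)](eP n x) -[seq_i E n (gQ n y)](eQ n y) -ghomD.
  by congr (f n _); congr pair; rewrite /= ?addr0 ?add0r.
- move=> f.
  have [gP eP] := surP (comp (c := CX J) f (cinl P Q)).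
  have [gQ eQ] := surQ (comp (c := CX J) f (cinr P Q)).
  exists (add_chain (comp (c := CX J) gP (cfst P Q)) (comp (c := CX J) gQ (csnd P Q))).
  move=> n [x y] /=; rewrite ghomD.
  rewrite [seq_p E n (gP n x)]eP [seq_p E n (gQ n y)]eQ /= -ghomD.
  by congr (f n _); congr pair; rewrite /= ?addr0 ?add0r.
Qed.

Lemma hequiv_heq (X Y : complex J) (f g : hom (X : CX J) Y) : heq f g -> hequiv f g.
Proof.
move=> e; exists (zcomplex J), (zero_chain _ _), (zero_chain _ _).
by split=> [|n x]; [apply: E_projective0|rewrite /= e subrr].
Qed.

Lemma hequiv2 (X Y P Q : complex J) (f g : chain X Y)
    (a : chain X P) (b : chain P Y) (a' : chain X Q) (b' : chain Q Y) :
  E_projective P -> E_projective Q ->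
  (forall n x, f n x - g n x = b n (a n x) + b' n (a' n x)) -> hequiv f g.
Proof.
move=> pP pQ e; exists (csum P Q), (cpair a a').
exists (add_chain (comp (c := CX J) b (cfst P Q)) (comp (c := CX J) b' (csnd P Q))).
by split=> [|n x]; [apply: E_projective_sum|rewrite /= e].
Qed.

Lemma hequiv_sym (X Y : complex J) (f g : chain X Y) : hequiv f g -> hequiv g f.
Proof.
move=> [P [a [b [pP e]]]]; exists P, a, (opp_chain b); split=> // n x /=.
by rewrite -e opprB.
Qed.

Lemma hequiv_trans (X Y : complex J) (f g g' : chain X Y) :
  hequiv f g -> hequiv g g' -> hequiv f g'.
Proof.
move=> [P [a [b [pP e]]]] [Q [a' [b' [pQ e']]]].
by apply: (hequiv2 pP pQ (a := a) (b := b) (a' := a') (b' := b')) => n x;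
   rewrite -e -e' addrA subrK.
Qed.

Lemma hequiv_comp (X Y Z : complex J) (f f' : chain Y Z) (g g' : chain X Y) :
  hequiv f f' -> hequiv g g' ->
  hequiv (comp (c := CX J) f g) (comp (c := CX J) f' g').
Proof.
move=> [P [a [b [pP e]]]] [Q [a' [b' [pQ e']]]].
apply: (hequiv2 pP pQ (a := comp (c := CX J) a g) (b := b) (a' := a')
                (b' := comp (c := CX J) f' b')) => n x /=.
by rewrite -e -e' ghomB addrA subrK.
Qed.

Lemma hequiv_sum (X Y X' Y' : complex J) (f f' : chain X X') (g g' : chain Y Y') :
  hequiv f f' -> hequiv g g' -> hequiv (csum_map f g) (csum_map f' g').
Proof.
move=> [P [a [b [pP e]]]] [Q [a' [b' [pQ e']]]].
exists (csum P Q), (csum_map a a'), (csum_map b b').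
split=> [|n [x y]]; first exact: E_projective_sum.
by rewrite /= -e -e'.
Qed.

Definition Kcat : category :=
  @Category {X : complex J | in_C c X}
    (fun X Y => chain (sval X) (sval Y))
    (fun X Y => @hequiv (sval X) (sval Y))
    (fun X => idm (sval X : CX J))
    (fun X Y Z => @comp (CX J) (sval X) (sval Y) (sval Z))
    (fun X Y f => hequiv_heq (heq_refl (c := CX J) f))
    (fun X Y => @hequiv_sym (sval X) (sval Y))
    (fun X Y => @hequiv_trans (sval X) (sval Y))
    (fun X Y Z => @hequiv_comp (sval X) (sval Y) (sval Z))
    (fun X Y f => hequiv_heq (comp_idl (c := CX J) f))
    (fun X Y f => hequiv_heq (comp_idr (c := CX J) f))
    (fun W X Y Z f g g' => hequiv_heq (compA (c := CX J) f g g')).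

Definition K0 : Kcat := exist _ (zcomplex J) in_C0.
Definition Ksum (X Y : Kcat) : Kcat :=
  exist _ (csum (sval X) (sval Y)) (in_C_sum (svalP X) (svalP Y)).

Program Definition zeroF (D : category) : functor D Kcat :=
  @Functor D Kcat (fun _ => K0) (fun _ _ _ => idm K0) _ _ _.
Next Obligation. by move=> D X Y f g _; apply: heq_refl. Qed.
Next Obligation. by move=> D X; apply: heq_refl. Qed.
Next Obligation. by move=> D X Y Z f g; apply: heq_sym; apply: comp_idl. Qed.

Program Definition sumF (D : category) (F F' : functor D Kcat) : functor D Kcat :=
  @Functor D Kcat (fun X => Ksum (F X) (F' X))
    (fun X Y f => csum_map (fmap F f) (fmap F' f)) _ _ _.
Next Obligation.
move=> D F F' X Y f g e.
by apply: hequiv_sum; apply: (@fmap_heq D Kcat).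
Qed.
Next Obligation.
move=> D F F' X; apply: hequiv_trans (hequiv_sum (fmap_id F X) (fmap_id F' X)) _.
by apply: hequiv_heq => n [].
Qed.
Next Obligation.
move=> D F F' X Y Z f g.
apply: hequiv_trans (hequiv_sum (fmap_comp F f g) (fmap_comp F' f g)) _.
by apply: hequiv_heq.
Qed.
End Homotopy.

Section Induced.
Variables (c : term_type * bound_type) (h : homotopy_type).
Variables (J J' : {group gT}) (V : gmod J) (V' : gmod J').

(** [F] maps [C_J] to [C_J'] and is compatible with the congruences of the
    homotopy categories. *)
Definition induces (F : functor (CX J) (CX J')) : Prop :=
  (forall X, in_C c X -> in_C c (F X)) /\
  (forall (X Y : complex J) (f g : chain X Y),
     in_C c X -> in_C c Y -> hequiv c h V f g ->
     hequiv c h V' (fmap F f) (fmap F g)).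

Program Definition Kfunctor (F : functor (CX J) (CX J')) (iF : induces F) :
    functor (Kcat c h V) (Kcat c h V') :=
  @Functor (Kcat c h V) (Kcat c h V')
    (fun X => exist _ (F (sval X)) (iF.1 _ (svalP X)))
    (fun X Y f => fmap F f) _ _ _.
Next Obligation.
by move=> F iF X Y f g; apply: iF.2; apply: svalP.
Qed.
Next Obligation. by move=> F iF X; apply: hequiv_heq; apply: (@fmap_id _ _ F). Qed.
Next Obligation.
by move=> F iF X Y Z f g; apply: hequiv_heq; apply: (@fmap_comp _ _ F).
Qed.

Definition induces2 (F : functor (prodC (CX J) (CX J)) (CX J)) : Prop :=
  (forall X Y, in_C c X -> in_C c Y -> in_C c (F (X, Y))) /\
  (forall (X X' Y Y' : complex J) (f f' : chain X X') (g g' : chain Y Y'),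
     in_C c X -> in_C c X' -> in_C c Y -> in_C c Y' ->
     hequiv c h V f f' -> hequiv c h V g g' ->
     hequiv c h V (fmap F (x := (X, Y)) (y := (X', Y')) (f, g))
                  (fmap F (x := (X, Y)) (y := (X', Y')) (f', g'))).

Program Definition Kfunctor2 (F : functor (prodC (CX J) (CX J)) (CX J))
    (iF : induces2 F) : functor (prodC (Kcat c h V) (Kcat c h V)) (Kcat c h V) :=
  @Functor (prodC (Kcat c h V) (Kcat c h V)) (Kcat c h V)
    (fun X => exist _ (F (sval X.1, sval X.2))
                (iF.1 _ _ (svalP X.1) (svalP X.2)))
    (fun X Y f => fmap F (x := (sval X.1, sval X.2)) (y := (sval Y.1, sval Y.2))
                    (f.1, f.2)) _ _ _.
Next Obligation.
by move=> F iF X Y f g [e e']; apply: iF.2 => //; apply: svalP.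
Qed.
Next Obligation.
move=> F iF X; apply: hequiv_heq.
exact: (fmap_id F (sval X.1, sval X.2)).
Qed.
Next Obligation.
move=> F iF X Y Z f g; apply: hequiv_heq.
exact: (fmap_comp F (x := (sval X.1, sval X.2)) (y := (sval Y.1, sval Y.2))
          (z := (sval Z.1, sval Z.2)) (f.1, f.2) (g.1, g.2)).
Qed.
End Induced.

Lemma conj_double_coset (K H : {group gT}) (t : gT) :
  ((K :&: H :^ t^-1) :^ t = K :^ t :&: H)%g.
Proof. by rewrite conjIg conjsgKV. Qed.

Definition double_cosets (K G H : {group gT}) : {set {set gT}} :=
  [set (K :* t * H)%g | t in G].

End Modules.

(* Main.v *)
(** [Ind] and [Res] are adjoint to each other on both sides already for complexes,
    preserve exactness and, because [V (x) Ind Y] is [Ind (Res V (x) Y)], the four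
    classes of sequences.  A left adjoint of a functor preserving the class preserves
    projectivity, so both functors descend, and the isomorphisms of (a), (b) and the
    adjunctions descend from natural isomorphisms of complexes.  An induced module is
    handled through its coordinates, as the functions [f : G -> X] with
    [f (g h) = h^-1 f g].  In (d), the complement of the identity is the kernel of the
    counit [Res Ind X -> X], which is split by the unit [X -> Res Ind X].

    For (b), the tensor product descends because [P (x) Y] is projective when [P] is.
    Comparing [P] with the cover [End(V1) (x) P (+) Cone(End(V2) (x) P) -> P] given by
    traces, projectivity means that [1_P] is the trace of a map [P -> End(V1) (x) P]
    plus [d s + s d] with [s] the trace of maps [P^(n+1) -> End(V2) (x) P^n], a
    condition that is visibly inherited by [P (x) Y].

    Finite length is preserved since it can be read off the [k]-module: a simple
    [kG]-module has finite length over [k], by intersecting the translates of a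
    maximal [k]-submodule. *)
From HB Require Import structures.
From mathcomp Require Import all_boot all_order all_fingroup all_algebra.
From mathcomp Require Import boolp.
From mathcomp Require classical_sets.
Require Import Defs.

Set Implicit Arguments.
Unset Strict Implicit.
Unset Printing Implicit Defensive.

Import Order.TTheory GRing.Theory Num.Theory.
Local Open Scope ring_scope.

(** * Finite length and finite generation over k *)

(** The obstacle in (b) is that the right adjoint of - (x) Y would be a Hom complex, which in
    general leaves C: it has products over degrees, and boundedness and finiteness can fail. So
    projectivity of P is turned into data on P alone, which can be tensored with Y. End(V) enters
    because a section of V (x) p amounts to a map C -> End(V) (x) B over z |-> 1 (x) z; trace and
    product of End(V) turn such maps into lifts, and the Casimir element, the sum of the e_ij (x)
    e_ji, shows that the trace cover itself lies in the class. If V1 and V2 were both 0, the cover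
    would vanish. This is the case V = 0 of the V-split and V-term split types, where every exact
    sequence is in the class. A second obstacle is that k is arbitrary: a kernel between finitely
    generated modules need not be finitely generated. Kernels are only formed for maps with a
    k-linear section; they are then k-quotients of the source, and this suffices because the term
    types are read off the k-module. *)

Section LinearFiniteness.
Variable k : comPzRingType.
Implicit Types X Y : lmodType k.

Definition subspace X (W : X -> Prop) : Prop :=
  [/\ W 0, forall x y, W x -> W y -> W (x + y) & forall c x, W x -> W (c *: x)].

Lemma subspaceB X (W : X -> Prop) x y : subspace W -> W x -> W y -> W (x - y).
Proof. by case=> _ WD WZ Wx Wy; apply: WD => //; rewrite -scaleN1r; apply: WZ. Qed.

(** [W] has finite length: its subspaces carry a strictly monotone rank. *)
Definition ranked X (W : X -> Prop) : Prop :=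
  exists r : (X -> Prop) -> nat, forall U U', subspace U -> subspace U' ->
    (forall x, U x -> U' x) -> (forall x, U' x -> W x) ->
    (r U <= r U')%N /\ ((r U' <= r U)%N -> forall x, U' x -> U x).

Lemma ranked_ext X (W W' : X -> Prop) :
  (forall x, W' x -> W x) -> ranked W -> ranked W'.
Proof.
move=> sW [r rP]; exists r => U U' sU sU' UU' U'W.
by apply: rP => // x /U'W /sW.
Qed.

Lemma ranked0 X (W : X -> Prop) : (forall x, W x -> x = 0) -> ranked W.
Proof.
move=> W0; exists (fun=> 0%N) => U U' [U0 _ _] _ _ U'W; split=> // _ x /U'W /W0 ->.
exact: U0.
Qed.

Lemma subspaceI X (U W : X -> Prop) :
  subspace U -> subspace W -> subspace (fun x => U x /\ W x).
Proof.
move=> [U0 UD UZ] [W0 WD WZ]; split=> //.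
- by move=> x y [? ?] [? ?]; split; [apply: UD|apply: WD].
- by move=> c x [? ?]; split; [apply: UZ|apply: WZ].
Qed.

(** The third hypothesis says that D'/D is simple or zero. One bit, telling whether U leaves D, then
    extends the rank of the intersection of U and D; both terms are monotone, so equality of the
    totals forces equality of each. *)
Lemma ranked_step X (D D' : X -> Prop) :
  subspace D -> (forall x, D x -> D' x) ->
  (forall U, subspace U -> (forall x, U x -> D' x) ->
     (forall x, U x -> D x) \/ forall x, D' x -> exists2 u, U u & D (x - u)) ->
  ranked D -> ranked D'.
Proof.
move=> sD DD' max [r rP].
pose b (U : X -> Prop) : nat := ~~ `[< forall x, U x -> D x >].
exists (fun U => r (fun x => U x /\ D x) + b U)%N => U U' sU sU' UU' U'D'.
have [le1 eq1] : _ /\ _ := rP _ _ (subspaceI sU sD) (subspaceI sU' sD)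
  (fun x h => conj (UU' x h.1) h.2) (fun x h => h.2).
have le2 : (b U <= b U')%N.
  rewrite /b; case: asboolP => // nU; case: asboolP => // U'D.
  by case: nU => x /UU' /U'D.
split=> [|le x U'x]; first exact: leq_add.
have le1' : (r (fun x => U' x /\ D x) <= r (fun x => U x /\ D x))%N.
  by move: le; rewrite leqNgt; apply: contraNT; rewrite -ltnNge => lt; rewrite -addSn leq_add.
have le2' : (b U' <= b U)%N.
  by move: le; rewrite leqNgt; apply: contraNT; rewrite -ltnNge => lt; rewrite -addnS leq_add.
have {}eq1 y : U' y -> D y -> U y by move=> ? ?; case: (eq1 le1' y).
case: (max U sU (fun x h => U'D' x (UU' x h))) => [UD|h].
  apply: eq1 => //; move: le2'; rewrite /b.
  by case: (asboolP (forall x, U x -> D x)) => // _; case: asboolP => // h _; apply: h.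
have [u Uu Dxu] := h x (U'D' x U'x).
have : U (x - u) by apply: eq1 => //; apply: subspaceB => //; apply: UU'.
by case: sU => _ UD _ /UD /(_ Uu); rewrite subrK.
Qed.

(** Additivity of length along W and W + f(X): U is measured by its intersection with W and by
    [pre U], the vectors whose image under f lies in U + W. *)
Lemma ranked_add X Y (W : Y -> Prop) (f : {linear X -> Y}) :
  subspace W -> ranked W -> ranked (fun _ : X => True) ->
  ranked (fun y => exists x, W (y - f x)).
Proof.
move=> sW [r rP] [r' r'P].
pose pre (U : Y -> Prop) x := exists2 w, W w & U (f x + w).
have spre U : subspace U -> subspace (pre U).
  move=> [U0 UD UZ]; case: (sW) => W0 WD WZ; split.
  - by exists 0 => //; rewrite linear0 addr0.
  - move=> x y [w Ww Uw] [w' Ww' Uw']; exists (w + w'); first exact: WD.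
    by rewrite linearD addrACA; apply: UD.
  - move=> c x [w Ww Uw]; exists (c *: w); first exact: WZ.
    by rewrite linearZ -scalerDr; apply: UZ.
exists (fun U => r (fun x => U x /\ W x) + r' (pre U))%N => U U' sU sU' UU' U'W.
have [le1 eq1] : _ /\ _ := rP _ _ (subspaceI sU sW) (subspaceI sU' sW)
  (fun x h => conj (UU' x h.1) h.2) (fun x h => h.2).
have prele x : pre U x -> pre U' x by case=> w Ww /UU'; exists w.
have [le2 eq2] : _ /\ _ := r'P _ _ (spre _ sU) (spre _ sU') prele (fun _ _ => I).
split=> [|le y U'y]; first exact: leq_add.
have le1' : (r (fun x => U' x /\ W x) <= r (fun x => U x /\ W x))%N.
  by move: le; rewrite leqNgt; apply: contraNT; rewrite -ltnNge => lt; rewrite -addSn leq_add.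
have le2' : (r' (pre U') <= r' (pre U))%N.
  by move: le; rewrite leqNgt; apply: contraNT; rewrite -ltnNge => lt; rewrite -addnS leq_add.
have [x Wx] := U'W y U'y.
have [w Ww Uw] : pre U x.
  by apply: (eq2 le2'); exists (y - f x) => //; rewrite addrC subrK.
have : U (y - (f x + w)).
  apply: (eq1 le1' _ (conj _ _)).1; first exact: subspaceB (UU' _ Uw).
  by rewrite opprD addrA; apply: subspaceB.
by case: sU => _ UD _ /UD /(_ Uw); rewrite subrK.
Qed.

Definition linear_term_type (s : term_type) X : Prop :=
  match s with
  | AllModules => True
  | FinitelyGenerated => exists s : seq X, forall W : X -> Prop,
      subspace W -> (forall x, x \in s -> W x) -> forall x, W x
  | FiniteLength => ranked (fun _ : X => True)
  end.

(** This carries term types to new k-modules: an induced module is a sum of images of X indexed by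
    cosets, End(V) (x) X one indexed by matrix units, and a split kernel is a quotient. *)
Lemma linear_term_type_cover (I : finType) X Y (f : I -> {linear X -> Y}) s :
  (forall y, exists z : I -> X, y = \sum_i f i (z i)) ->
  linear_term_type s X -> linear_term_type s Y.
Proof.
move=> cov; case: s => //= [[s sP]|rX].
  exists [seq f i x | i <- index_enum I, x <- s] => W sW Ws y.
  have Wf i x : W (f i x).
    case: (sW) => W0 WD WZ.
    apply: (sP (fun x => W (f i x))).
      split=> [|a b Wa Wb|c a Wa]; first by rewrite linear0.
      - by rewrite linearD; apply: WD.
      - by rewrite linearZ; apply: WZ.
    by move=> a sa; apply: Ws; apply/allpairsP; exists (i, a); rewrite mem_index_enum.
  have [z ->] := cov y.
  by case: sW => W0 WD _; apply: big_ind.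
(* Images are added one at a time, so that [ranked_add] applies at each step; the full list of
   indices gives all of Y. *)
pose span (s : seq I) := foldr (fun i W y => exists x, W (y - f i x)) (fun y => y = 0) s.
have sspan s : subspace (span s).
  elim: s => [|i s [S0 SD SZ]] /=.
    by split=> // [x y -> ->|c x ->]; rewrite ?addr0 ?scaler0.
  split.
  - by exists 0; rewrite linear0 subr0.
  - by move=> x y [a Sa] [b Sb]; exists (a + b); rewrite linearD opprD addrACA; apply: SD.
  - by move=> c x [a Sa]; exists (c *: a); rewrite linearZ -scalerBr; apply: SZ.
have rspan s : ranked (span s).
  by elim: s => [|i s IH] /=; [apply: ranked0|apply: ranked_add].
apply: ranked_ext (rspan (index_enum I)) => y _; have [z ->] := cov y.
elim: (index_enum I) => [|i s IH]; first by rewrite big_nil.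
by rewrite big_cons /=; exists (z i); rewrite addrAC subrr add0r.
Qed.

Lemma linear_term_type_surj X Y (f : {linear X -> Y}) s :
  (forall y, exists x, y = f x) -> linear_term_type s X -> linear_term_type s Y.
Proof.
move=> sur; apply: (@linear_term_type_cover unit _ _ (fun=> f)) => y.
by have [x ->] := sur y; exists (fun=> x); rewrite (bigD1 tt) //= big1 ?addr0 // => -[].
Qed.
End LinearFiniteness.

(** * The finiteness conditions on kJ-modules, read off the k-module *)

Section TermTypes.
Variables (k : comPzRingType) (gT : finGroupType).
Implicit Types J : {group gT}.

Lemma submodule_subspace J (X : gmod k J) (W : X -> Prop) : submodule W -> subspace W.
Proof. by case. Qed.

Lemma finitely_generated_linear J (X : gmod k J) :
  finitely_generated X <-> linear_term_type FinitelyGenerated X.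
Proof.
split=> [[s sP]|[s sP]]; last first.
  by exists s => W /submodule_subspace sW; apply: sP.
exists [seq act g x | g <- enum J, x <- s] => W [W0 WD WZ] Ws x.
(* Asking for all translates at once gives a J-submodule, although W is only a k-subspace. *)
suff : forall g, g \in J -> W (act g x) by move/(_ _ (group1 J)); rewrite act1.
apply: (sP (fun x => forall g, g \in J -> W (act g x))) => [|a sa g gJ].
  split.
  - by move=> g _; rewrite linear0.
  - by move=> a b Wa Wb g gJ; rewrite actD; apply: WD; [apply: Wa|apply: Wb].
  - by move=> c a Wa g gJ; rewrite actZ; apply/WZ/Wa.
  - by move=> h a hJ Wa g gJ; rewrite -actM //; apply: Wa; rewrite groupM.
by apply: Ws; apply/allpairsP; exists (g, a); rewrite mem_enum.
Qed.

Lemma ranked_finite_length J (X : gmod k J) :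
  ranked (fun _ : X => True) -> finite_length X.
Proof.
move=> [r rP].
pose top := fun _ : X => True.
have stop : submodule top by [].
suff chain m (U : X -> Prop) : submodule U -> (r top - r U <= m)%N ->
    exists n (W : nat -> X -> Prop),
    [/\ forall i, (i <= n)%N -> submodule (W i), W 0%N = U, forall x, W n x
      & forall i, (i < n)%N -> simple_step (W i) (W i.+1)].
  have s0 : submodule (fun x : X => x = 0).
    by split=> // [x y -> ->|c x ->|g x _ ->]; rewrite ?addr0 ?scaler0 ?linear0.
  have [n [W [W1 W2 W3 W4]]] := chain _ _ s0 (leqnn _).
  by exists n, W; split=> // x; rewrite W2.
elim: m U => [|m IH] U sU.
  rewrite leqn0 subn_eq0 => le; exists 0%N, (fun _ => U); split=> // x.
  have [_ h] := rP U top (submodule_subspace sU) (submodule_subspace stop)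
                   (fun _ _ => I) (fun _ _ => I).
  exact: h.
move=> le; case: (pselect (forall x, U x)) => [Ut|nUt].
  by exists 0%N, (fun _ => U); split.
(* A submodule of least rank among those strictly above U is minimal among them, as a strictly
   smaller one would have strictly smaller rank; hence the step from U to it is simple. *)
pose Q (q : nat) := `[< exists U' : X -> Prop, [/\ submodule U', forall x, U x -> U' x,
                          exists2 x, U' x & ~ U x & r U' = q] >].
have exQ : exists q, Q q.
  exists (r top); apply/asboolP; exists top; split=> //.
  by apply: contrapT => h; apply: nUt => x; apply: contrapT => nx; apply: h; exists x.
case: (ex_minnP exQ) => q /asboolP [U' [sU' UU' ex' rU']] minq.
have [x0 U'x0 nUx0] := ex'.
have ltr : (r U < r U')%N.
  have [_ h] := rP U U' (submodule_subspace sU) (submodule_subspace sU') UU' (fun _ _ => I).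
  by rewrite ltnNge; apply/negP => /h /(_ x0 U'x0).
have leq' : (r top - r U' <= m)%N.
  rewrite -ltnS; apply: leq_trans le; apply: ltn_sub2l => //.
  have [h _] := rP U' top (submodule_subspace sU') (submodule_subspace stop)
                   (fun _ _ => I) (fun _ _ => I).
  exact: leq_trans ltr h.
have [n [W [W1 W2 W3 W4]]] := IH U' sU' leq'.
exists n.+1, (fun i => if i is i'.+1 then W i' else U); split=> //.
- by case=> [|i] //; apply: W1.
- case=> [_|i]; last exact: W4.
  rewrite W2; split=> // U'' sU'' UU'' U''U'.
  case: (pselect (forall x, U'' x -> U x)) => [|nU'']; first by left.
  right; have [_ h] := rP U'' U' (submodule_subspace sU'') (submodule_subspace sU')
     U''U' (fun _ _ => I).
  apply: h; rewrite rU'; apply: minq; apply/asboolP; exists U''; split=> //.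
  apply: contrapT => h; apply: nU'' => x U''x; apply: contrapT => nx.
  by apply: h; exists x.
Qed.

(** A maximal [k]-submodule [M] of a simple step exists because the step is
    generated over [k] by the [J]-translates of one element; the intersection
    of the translates of [M] is a [J]-submodule, so the translates filter the
    step by [k]-subspaces with simple or trivial quotients. *)
Lemma ranked_simple_step J (X : gmod k J) (W W' : X -> Prop) :
  submodule W -> submodule W' -> simple_step W W' -> ranked W -> ranked W'.
Proof.
move=> sW sW' [WW' [x W'x nWx] simple] rW.
(* Zorn's lemma is applied to the k-subspaces between W and W' that miss some translate of x;
   containing all translates is what forces a subspace to be W'. *)
pose good (M : X -> Prop) := [/\ subspace M, forall y, W y -> M y, forall y, M y -> W' y
  & ~ forall g, g \in J -> M (act g x)].
have goodW : good W.
  split=> //; first exact: submodule_subspace.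
  by move/(_ _ (group1 J)); rewrite act1.
pose T := {M : X -> Prop | good M}.
pose R (M N : T) := `[< forall y, sval M y -> sval N y >].
have [||A Atot|M maxM] := @classical_sets.ZL_preorder T (exist _ W goodW) R.
- by move=> M; apply/asboolP.
- by move=> M N L /asboolP MN /asboolP NL; apply/asboolP => y /MN /NL.
- case: (pselect (exists M, A M)) => [[M0 AM0]|nA]; last first.
    by exists (exist _ W goodW) => M AM; case: nA; exists M.
  pose U y := exists2 M, A M & sval M y.
  have common M N : A M -> A N -> exists L, [/\ A L, forall y, sval M y -> sval L y
      & forall y, sval N y -> sval L y].
    by move=> AM AN; case: (Atot M N AM AN) => /asboolP h; [exists N|exists M].
  have gU : good U.
    split.
    - split=> [|a b [M AM Ma] [N AN Nb]|c a [M AM Ma]].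
      + by exists M0 => //; case: (svalP M0) => -[].
      + have [L [AL ML NL]] := common M N AM AN; exists L => //.
        by case: (svalP L) => -[_ LD _ _] _ _; apply: LD; [apply: ML|apply: NL].
      + by exists M => //; case: (svalP M) => -[_ _ MZ _] _ _; apply: MZ.
    - by move=> y Wy; exists M0 => //; case: (svalP M0) => _ h _ _; apply: h.
    - by move=> y [M AM My]; case: (svalP M) => _ _ h _; apply: h.
    - move=> allU.
      (* J is finite, so the members of the chain that contain the various translates of x lie below
         a single member. *)
      have [M AM Ms] : exists2 M, A M & forall g, g \in enum J -> sval M (act g x).
        have : forall g, g \in enum J -> U (act g x).
          by move=> g; rewrite mem_enum; apply: allU.
        elim: (enum J) => [|g s IH] h; first by exists M0.
        have [M AM Mg] := h g (mem_head _ _).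
        have [|N AN Ns] := IH; first by move=> g' sg'; apply: h; rewrite inE sg' orbT.
        have [L [AL ML NL]] := common M N AM AN; exists L => // g'.
        by rewrite inE => /orP[/eqP ->|/Ns]; [apply: ML|apply: NL].
      by case: (svalP M) => _ _ _; apply=> g gJ; apply: Ms; rewrite mem_enum.
  by exists (exist _ U gU) => M AM; apply/asboolP => y My; exists M.
case: M maxM => M [sM WM MW' nM] maxM.
have max U : subspace U -> (forall y, M y -> U y) -> (forall y, U y -> W' y) ->
    (forall y, U y -> M y) \/ forall y, W' y -> U y.
  move=> sU MU UW'; case: (pselect (forall g, g \in J -> U (act g x))) => [Ux|nU].
    (* The largest J-stable part of U. It contains W and x, so simplicity makes it all of W'. *)
    right; pose U1 y := W' y /\ forall g, g \in J -> U (act g y).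
    case: (sW') => W'0 W'D W'Z W'A; case: (sW) => _ _ _ WA; case: (sU) => U0 UD UZ.
    have sU1 : submodule U1.
      split.
      - by split=> // g _; rewrite linear0.
      - move=> a b [? Ua] [? Ub]; split; first exact: W'D.
        by move=> g gJ; rewrite actD; apply: UD; [apply: Ua|apply: Ub].
      - move=> c a [? Ua]; split; first exact: W'Z.
        by move=> g gJ; rewrite actZ; apply: UZ; apply: Ua.
      - move=> h a hJ [? Ua]; split; first exact: W'A.
        by move=> g gJ; rewrite -actM //; apply: Ua; rewrite groupM.
    case: (simple U1 sU1) => [y Wy|y []//|h|h y /h [_]].
    - by split=> [|g gJ]; [apply: WW'|apply/MU/WM/WA].
    - by case: nWx; apply: h.
    - by move/(_ _ (group1 J)); rewrite act1.
  left=> y Uy; have gU : good U by split=> // z /WM /MU.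
  have /asboolP := maxM (exist _ U gU) (introT (asboolP _) MU).
  exact.
pose D (s : seq gT) y := W' y /\ forall g, g \in s -> M (act g^-1 y).
case: (sM) => M0 MD MZ; case: (sW') => W'0 W'D W'Z W'A; case: (sW) => _ _ _ WA.
have sD s : subspace (D s).
  split.
  - by split=> // g _; rewrite linear0.
  - move=> a b [? Ma] [? Mb]; split; first exact: W'D.
    by move=> g gs; rewrite actD; apply: MD; [apply: Ma|apply: Mb].
  - move=> c a [? Ma]; split; first exact: W'Z.
    by move=> g gs; rewrite actZ; apply/MZ/Ma.
have subD : submodule (D (enum J)).
  case: (sD (enum J)) => D0 DD DZ; split=> // g y gJ [W'y My]; split; first exact: W'A.
  move=> h; rewrite mem_enum => hJ.
  rewrite -actM ?groupV // -[(h^-1 * g)%g]invgK invMg invgK; apply: My.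
  by rewrite mem_enum groupM ?groupV.
have DW y : D (enum J) y -> W y.
  case: (simple _ subD) => [z Wz|z []//|h|W'D'].
  - split=> [|g]; first exact: WW'.
    by rewrite mem_enum => gJ; apply/WM/WA; rewrite ?groupV.
  - exact: h.
  - move=> _; exfalso; apply: (nM) => g gJ; have [_ /(_ 1%g)] := W'D' _ (W'A g x gJ W'x).
    by rewrite mem_enum group1 invg1 act1; apply.
suff {DW subD} step s : (forall g, g \in s -> g \in J) -> ranked (D s) -> ranked (D [::]).
  apply: (@ranked_ext _ _ (D [::])) => [y W'y|]; first by split.
  apply: (step (enum J)) => [g|]; first by rewrite mem_enum.
  exact: ranked_ext DW rW.
elim: s => [//|g s IH] sJ rD.
have gJ : g \in J by rewrite sJ ?mem_head.
apply: IH => [h hs|]; first by rewrite sJ // inE hs orbT.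
apply: (ranked_step (sD (g :: s))) rD => [y [W'y h]|U sU UD].
  by split=> // g' sg'; apply: h; rewrite inE sg' orbT.
(* The action of g^-1 embeds D s / D (g :: s) into W'/M. So U is tested through g^-1 U + M, to which
   the maximality of M applies. *)
pose Mg (V : X -> Prop) y := exists2 u, V u & M (y - act g^-1 u).
have sMU : subspace (Mg U).
  case: (sU) => U0 UAdd UZ; split.
  - by exists 0 => //; rewrite linear0 subr0.
  - move=> a b [u Uu Ma] [v Uv Mb]; exists (u + v); first exact: UAdd.
    by rewrite actD opprD addrACA; apply: MD.
  - move=> c a [u Uu Ma]; exists (c *: u); first exact: UZ.
    by rewrite actZ -scalerBr; apply: MZ.
case: (max (Mg U) sMU) => [y My|y [u Uu Mu]|h|h].
- by exists 0; [case: sU|rewrite linear0 subr0].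
- have [W'u _] := UD _ Uu; rewrite -[y](subrK (act g^-1 u)).
  by apply: W'D; [apply: (MW')|apply: W'A; rewrite ?groupV].
- left=> y Uy; have [W'y Dy] := UD _ Uy; split=> // g'.
  rewrite inE => /orP[/eqP ->|/Dy//]; apply: h; exists y => //.
  by rewrite subrr.
- right=> y [W'y Dy].
  have [u Uu Mu] := h _ (W'A g^-1%g y (groupVr gJ) W'y).
  exists u => //; have [W'u Du] := UD _ Uu; split.
    exact: (subspaceB (submodule_subspace sW')).
  move=> g'; rewrite inE => /orP[/eqP ->|g's].
    by rewrite linearB.
  by rewrite linearB; apply: (subspaceB sM); [apply: Dy|apply: Du].
Qed.

Lemma finite_length_linear J (X : gmod k J) :
  finite_length X <-> linear_term_type FiniteLength X.
Proof.
split=> [[n [W [Wsub W0 Wn Ws]]]|]; last exact: ranked_finite_length.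
apply: (@ranked_ext _ _ (W n)) => [x _|]; first exact: Wn.
elim: n Wsub Ws {Wn} => [|n IH] Wsub Ws; first by apply: ranked0 => x /W0.
apply: ranked_simple_step (Ws n (ltnSn n)) _; [exact: Wsub|exact: Wsub|].
by apply: IH => i lt; [apply: Wsub; apply: leqW|apply: Ws; apply: ltnW].
Qed.

Lemma has_term_type_linear J (X : gmod k J) s :
  has_term_type s X <-> linear_term_type s X.
Proof.
case: s => //=; first exact: finitely_generated_linear.
exact: finite_length_linear.
Qed.
End TermTypes.

(** * Coordinates on induced modules *)

Section CosetSums.
Variables (gT : finGroupType) (G H : {group gT}) (P : zmodType).
Hypothesis sHG : H \subset G.

Definition coset_sum (f : gT -> P) : P := \sum_(C in lcosets H G) f (repr C).

Lemma repr_lcosets C : C \in lcosets H G -> repr C \in G /\ (repr C *: H = C)%g.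
Proof.
case/lcosetsP => g gG ->; have : repr (g *: H)%g \in (g *: H)%g.
  by apply: (mem_repr g); apply: lcoset_refl.
move=> rC; split; last exact/lcoset_eqP.
by case/lcosetP: rC => h hH ->; rewrite groupM // (subsetP sHG).
Qed.

Lemma mem_lcosets g : g \in G -> (g *: H)%g \in lcosets H G.
Proof. by move=> gG; apply/lcosetsP; exists g. Qed.

Lemma eq_coset_sum f f' : {in G, f =1 f'} -> coset_sum f = coset_sum f'.
Proof. by move=> e; apply: eq_bigr => C /repr_lcosets[rG _]; apply: e. Qed.

Section Invariant.
Variable f : gT -> P.
Hypothesis fH : forall g h, g \in G -> h \in H -> f (g * h)%g = f g.

Lemma coset_fun_repr g : g \in G -> f (repr (g *: H)%g) = f g.
Proof.
move=> gG; have /lcosetP[h hH ->] : repr (g *: H)%g \in (g *: H)%g.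
  by apply: (mem_repr g); apply: lcoset_refl.
exact: fH.
Qed.

Lemma coset_sum1 g : g \in G ->
  (forall g', g' \in G -> (g^-1 * g')%g \notin H -> f g' = 0) -> coset_sum f = f g.
Proof.
move=> gG f0; rewrite /coset_sum (bigD1 (g *: H)%g) ?mem_lcosets //=.
rewrite coset_fun_repr // big1 ?addr0 // => C /andP[/repr_lcosets[rG rC] neq].
apply: f0 => //; apply: contra neq => gr.
by rewrite -rC; apply/eqP/lcoset_eqP; rewrite mem_lcoset // -groupV invMg invgK.
Qed.
End Invariant.

End CosetSums.

Section InducedModule.
Variables (k : comPzRingType) (gT : finGroupType) (G H : {group gT}).
Hypothesis sHG : H \subset G.
Implicit Types X Y : gmod k H.

Let kG : lmodType k := {ffun [subg G] -> k^o}.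

Definition ind_basis (g : gT) : kG := [ffun v => (v == subg G g)%:R].

Lemma kG_sum (a : kG) : a = \sum_v a v *: ind_basis (sgval v).
Proof.
apply/ffunP => v; rewrite sum_ffunE (bigD1 v) //= !ffunE sgvalK eqxx.
rewrite big1 => [|u uv]; first by rewrite addr0 [_ *: _]mulr1.
by rewrite !ffunE sgvalK eq_sym (negPf uv) scaler0.
Qed.

(** [g (x) x] *)
Definition ind_gen X (g : gT) (x : X) : ind G X := ipure (ind_basis g) x.

Lemma ind_gen_linear X g : linear (@ind_gen X g).
Proof. exact: pure_linr. Qed.
HB.instance Definition _ X g :=
  GRing.isLinear.Build k X (ind_car G X) *:%R (@ind_gen X g) (@ind_gen_linear X g).

Lemma ind_ext_gen X (P : lmodType k) (f f' : {linear ind_car G X -> P}) :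
  (forall g x, g \in G -> f (ind_gen g x) = f' (ind_gen g x)) -> f =1 f'.
Proof.
move=> e; apply: ind_ext => a x.
have -> : ipure a x = \sum_v a v *: ind_gen (sgval v) x :> ind_car G X.
  pose q := mklinear (pure_linl (@ind_r k gT G H) (ind_l X) (a := tt) x).
  rewrite -[LHS]/(q a) {1}[a]kG_sum linear_sum.
  by apply: eq_bigr => v _; rewrite linearZZ.
by rewrite !linear_sum; apply: eq_bigr => v _; rewrite !linearZZ e // subgP.
Qed.

Lemma act_ind_gen X u g (x : X) : u \in G -> g \in G ->
  act u (ind_gen g x) = ind_gen (u * g)%g x.
Proof.
move=> uG gG; rewrite -[LHS]/(ind_act G X u (ind_gen g x)) ind_actE.
congr ipure; apply/ffunP => v; rewrite !ffunE; congr (_%:R : k).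
by rewrite morphM //= -(inj_eq (mulgI (subg G u))) mulKVg.
Qed.

Lemma ind_gen_act X g h (x : X) : g \in G -> h \in H ->
  ind_gen g (act h x) = ind_gen (g * h)%g x.
Proof.
move=> gG hH; have hG := subsetP sHG _ hH.
have := pure_bal (@ind_r k gT G H) (ind_l X) (a := tt) (subg H h) (ind_basis g) x.
rewrite /= subgK // => e; rewrite -[LHS]/(pure (@ind_r k gT G H) (ind_l X) (a := tt) _ _) -e.
rewrite /ind_gen /ipure; congr (pure _ _ _ _); apply/ffunP => v; rewrite !ffunE; congr (_%:R : k).
by rewrite morphM //= -(inj_eq (mulIg (subg G h))) mulgKV.
Qed.

Lemma ind_map_gen X Y (f : ghom X Y) g x : ind_map G f (ind_gen g x) = ind_gen g (f x).
Proof. exact: ind_mapE. Qed.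

Section Elim.
Variables (X : gmod k H) (P : lmodType k) (f : gT -> X -> P).
Hypothesis flin : forall g, linear (f g).
Hypothesis fH : forall g h x, g \in G -> h \in H -> f (g * h)%g x = f g (act h x).

Lemma ind_elim_balanced : balanced (@ind_r k gT G H) (ind_l X)
  (fun _ (a : kG) x => \sum_v a v *: f (sgval v) x).
Proof.
split=> [i x c a b|i a c x y|i h a x].
- rewrite scaler_sumr -big_split; apply: eq_bigr => v _.
  by rewrite !ffunE scalerDl scalerA.
- rewrite scaler_sumr -big_split; apply: eq_bigr => v _.
  by rewrite flin scalerDr !scalerA mulrC.
- rewrite [LHS](reindex_inj (mulIg (subg G (sgval h)))); apply: eq_bigr => v _ /=.
  by rewrite !ffunE mulgK subgK ?fH ?subgP // (subsetP sHG) ?subgP.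
Qed.

Definition ind_elim : {linear ind_car G X -> P} := tlift ind_elim_balanced.

Lemma ind_elimE g x : g \in G -> ind_elim (ind_gen g x) = f g x.
Proof.
move=> gG; rewrite [LHS]tlift_pure (bigD1 (subg G g)) //= ffunE eqxx scale1r subgK //.
by rewrite big1 ?addr0 // => v nv; rewrite ffunE (negPf nv) scale0r.
Qed.
End Elim.

Section Coordinates.
Variable X : gmod k H.

Definition ind_coord_fun (u g : gT) (x : X) : X :=
  if (u^-1 * g)%g \in H then act (u^-1 * g)%g x else 0.

Lemma ind_coord_linear u g : linear (ind_coord_fun u g).
Proof.
move=> c x y; rewrite /ind_coord_fun; case: ifP => _; first exact: linearP.
by rewrite scaler0 addr0.
Qed.

Lemma ind_coord_bal u g h x : g \in G -> h \in H ->
  ind_coord_fun u (g * h)%g x = ind_coord_fun u g (act h x).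
Proof.
move=> _ hH; rewrite /ind_coord_fun mulgA groupMr //.
by case: ifP => // ?; rewrite actM.
Qed.

(** the value at [u] of [z], seen as a function [f] from [G] to [X] with
    [f (g h) = h^-1 f g] *)
Definition ind_coord u : {linear ind_car G X -> X} :=
  ind_elim (ind_coord_linear u) (@ind_coord_bal u).

Lemma ind_coord_gen u g x : g \in G ->
  ind_coord u (ind_gen g x) = if (u^-1 * g)%g \in H then act (u^-1 * g)%g x else 0.
Proof. exact: ind_elimE. Qed.

Lemma ind_coordM u h z : h \in H -> ind_coord (u * h)%g z = act h^-1%g (ind_coord u z).
Proof.
move=> hH; move: z.
apply: (ind_ext_gen (f := ind_coord (u * h)%g) (f' := @act _ _ H X h^-1%g \o ind_coord u)).
move=> g x gG; rewrite -[RHS]/(act h^-1%g (ind_coord u (ind_gen g x))).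
rewrite !ind_coord_gen // invMg -mulgA groupMl ?groupV //.
by case: ifP => [?|_]; [rewrite actM ?groupV|rewrite linear0].
Qed.

Lemma ind_coord_act u g (z : ind G X) : g \in G ->
  ind_coord u (act g z) = ind_coord (g^-1 * u)%g z.
Proof.
move=> gG; move: z.
apply: (ind_ext_gen (f := ind_coord u \o ind_act G X g) (f' := ind_coord (g^-1 * u)%g)).
move=> v x vG; rewrite -[LHS]/(ind_coord u (act g (ind_gen v x : ind G X))).
have gvG := groupM gG vG.
by rewrite act_ind_gen // !ind_coord_gen // invMg invgK mulgA.
Qed.

Definition coind_fun (y : gT -> X) : Prop :=
  forall g h, g \in G -> h \in H -> y (g * h)%g = act h^-1%g (y g).

Lemma coind_fun_coord z : coind_fun (ind_coord^~ z).
Proof. by move=> g h _ hH; rewrite ind_coordM. Qed.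

(** Inverse of taking coordinates. It reads y at coset representatives only, hence makes sense for
    every y; the choice of representatives is immaterial once [coind_fun y] holds. *)
Definition coind (y : gT -> X) : ind G X := coset_sum G H (fun g => ind_gen g (y g) : ind_car G X).

Lemma coind_inv (y : gT -> X) : coind_fun y -> forall g h, g \in G -> h \in H ->
  ind_gen (g * h) (y (g * h)%g) = ind_gen g (y g) :> ind G X.
Proof.
move=> yP g h gG hH; rewrite yP // -ind_gen_act // -actM ?groupV //.
by rewrite mulgV act1.
Qed.

Lemma coind_coord_linear : linear (fun z => coind (ind_coord^~ z) : ind_car G X).
Proof.
move=> c x y; rewrite /coind /coset_sum scaler_sumr -big_split.
by apply: eq_bigr => C _; rewrite !linearP.
Qed.

Lemma ind_coordK (z : ind G X) : coind (ind_coord^~ z) = z.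
Proof.
pose F : {linear ind_car G X -> ind_car G X} := mklinear coind_coord_linear.
suff e : F =1 idfun by exact: (e z).
apply: ind_ext_gen => g x gG.
rewrite -[LHS]/(coind (ind_coord^~ (ind_gen g x))) /coind.
rewrite (coset_sum1 _ _ (g := g)) //.
- by rewrite ind_coord_gen // mulVg group1 act1.
- exact/coind_inv/coind_fun_coord.
- move=> g' g'G; rewrite -groupV invMg invgK ind_coord_gen // => /negPf ->.
  exact: linear0.
Qed.

(** Elements of the tensor quotient have no normal form; coordinates are the means of proving two of
    them equal. *)
Lemma ind_coord_inj (z z' : ind G X) :
  (forall g, g \in G -> ind_coord g z = ind_coord g z') -> z = z'.
Proof.
move=> e; rewrite -(ind_coordK z) -(ind_coordK z').
by apply: eq_coset_sum => // g gG; rewrite e.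
Qed.

Lemma ind_coord_coind y g : coind_fun y -> g \in G -> ind_coord g (coind y) = y g.
Proof.
move=> yP gG; rewrite /coind /coset_sum linear_sum.
rewrite -[LHS]/(coset_sum G H (fun r => ind_coord g (ind_gen r (y r)))).
rewrite (coset_sum1 _ _ (g := g)) //.
- by rewrite ind_coord_gen // mulVg group1 act1.
- by move=> r h rG hH; congr (ind_coord g _); apply: coind_inv.
- by move=> g' g'G /negPf nH; rewrite ind_coord_gen // nH.
Qed.

Lemma act_coind (y : gT -> X) u : coind_fun y -> u \in G ->
  act u (coind y) = coind (fun g => y (u^-1 * g)%g).
Proof.
move=> yP uG; apply: ind_coord_inj => g gG.
rewrite ind_coord_act // !ind_coord_coind ?groupM ?groupV // => v h vG hH.
by rewrite mulgA yP // groupM ?groupV.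
Qed.
End Coordinates.

Lemma ind_coord_map X Y (f : ghom X Y) u (z : ind G X) :
  ind_coord Y u (ind_map G f z) = f (ind_coord X u z).
Proof.
move: z; apply: (ind_ext_gen (f := ind_coord Y u \o ind_map_lin G f)
  (f' := f \o ind_coord X u)) => g x gG.
rewrite -[LHS]/(ind_coord Y u (ind_map G f (ind_gen g x))) ind_map_gen.
rewrite -[RHS]/(f (ind_coord X u (ind_gen g x))) !ind_coord_gen //; case: ifP => [gH|_]; last by
  rewrite linear0.
by rewrite gfun_act.
Qed.

Lemma ind_map_coind X Y (f : ghom X Y) (y : gT -> X) :
  ind_map G f (coind y) = coind (fun g => f (y g)).
Proof.
rewrite /coind /coset_sum linear_sum.
by apply: eq_bigr => C _; apply: ind_map_gen.
Qed.
End InducedModule.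

(** * Projectivity and adjoint functors *)

Section Projectives.
Variables (k : comPzRingType) (gT : finGroupType) (J : {group gT}).
Variables (c : term_type * bound_type) (h : homotopy_type) (V : gmod k J).

Definition has_lifts (P : complex k J) (E : cseq k J) : Prop :=
  forall f : chain P (seqC E),
    exists g : chain P (seqB E), forall n x, seq_p E n (g n x) = f n x.

Lemma exact_factor (P : complex k J) (E : cseq k J) (f : chain P (seqB E)) :
  Defs.exact E -> (forall n x, seq_p E n (f n x) = 0) ->
  exists g : chain P (seqA E), forall n x, f n x = seq_i E n (g n x).
Proof.
move=> exE pf.
have ex n x : exists y, f n x = seq_i E n y by have [_ mid _] := exE n; apply/mid.
pose g n x := projT1 (cid (ex n x)).
have gP n x : f n x = seq_i E n (g n x) by rewrite /g; case: cid.
have inj n : injective (seq_i E n) by case: (exE n).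
have glin n : linear (g n).
  by move=> a x y; apply: inj; rewrite -gP ghomD ghomZ !gP -ghomZ -ghomD.
have gact n u x : u \in J -> g n (act u x) = act u (g n x).
  by move=> uJ; apply: inj; rewrite -gP !gfun_act // gP.
pose G n : ghom (P n) (seqA E n) := Ghom (glin n) (@gact n).
have Gd n x : G (n + 1) (diff P n x) = diff (seqA E) n (G n x).
  by apply: inj; rewrite cmap_diff -!gP cmap_diff.
by exists (Chain Gd) => n x; apply: gP.
Qed.

(** Hom(P, -) is left exact on any exact sequence, by [exact_factor], so the only content of
    projectivity is lifting along the last map. *)
Lemma E_projectiveP P : E_projective c h V P <-> in_C c P /\
  forall E : cseq k J, in_C c (seqA E) -> in_C c (seqB E) -> in_C c (seqC E) ->
    Defs.exact E -> in_E h V E -> has_lifts P E.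
Proof.
split=> [[cP pP]|[cP lP]]; split=> // E cA cB cC exE inE.
  by case: (pP E cA cB cC exE inE).
split.
- by move=> f f' e n x; case: (exE n) => inj _ _; apply: inj; apply: e.
- move=> f; split=> [pf|[g e] n x]; first exact: exact_factor.
  by rewrite e; case: (exE n) => _ mid _; apply/mid; eexists.
- exact: lP.
Qed.
End Projectives.

Definition map_seq (k : comPzRingType) (gT : finGroupType) (J J' : {group gT})
    (F : functor (CX k J) (CX k J')) (E : cseq k J) : cseq k J' :=
  Cseq (fmap F (seq_i E)) (fmap F (seq_p E)).

(** * Functors of complexes: adjoints, exactness and the four classes *)

Section Functors.
Variables (k : comPzRingType) (gT : finGroupType) (J J' : {group gT}).

(** A map f : L P -> C is transposed to R f o eta, lifted through R E, and transposed back by the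
    counit; naturality of the counit and the triangle identity return f. *)
Lemma adjoint_projective (L : functor (CX k J) (CX k J')) (R : functor (CX k J') (CX k J))
    c h (V : gmod k J) (V' : gmod k J') :
  adjoint L R -> (forall X, in_C c X -> in_C c (R X)) ->
  (forall E, Defs.exact E -> in_E h V' E ->
     Defs.exact (map_seq R E) /\ in_E h V (map_seq R E)) ->
  forall P, in_C c (L P) -> E_projective c h V P -> E_projective c h V' (L P).
Proof.
move=> [eta [eps [tL tR]]] RC RE P cLP /E_projectiveP[cP lP].
apply/E_projectiveP; split=> // E cA cB cC exE inE f.
have [exRE inRE] := RE E exE inE.
have [g gP] := lP (map_seq R E) (RC _ cA) (RC _ cB) (RC _ cC) exRE inRE
  (comp (c := CX k J) (fmap R f) (eta P)).
exists (comp (c := CX k J') (eps (seqB E)) (fmap L g)).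
have {gP} e : heq (comp (c := CX k J) (fmap R (seq_p E)) g)
               (comp (c := CX k J) (fmap R f) (eta P)) := gP.
suff : heq (comp (c := CX k J') (seq_p E) (comp (c := CX k J') (eps (seqB E)) (fmap L g))) f by [].
apply: heq_trans (compA _ _ _) _.
apply: (heq_trans (heq_comp (heq_sym (naturality eps (seq_p E))) (heq_refl _))).
apply: (heq_trans (heq_sym (compA _ _ _))).
apply: (heq_trans (heq_comp (heq_refl _) (heq_sym (fmap_comp L (fmap R (seq_p E)) g)))).
apply: (heq_trans (heq_comp (heq_refl _) (fmap_heq L e))).
apply: (heq_trans (heq_comp (heq_refl _) (fmap_comp L _ _))).
apply: (heq_trans (compA _ _ _)).
apply: (heq_trans (heq_comp (naturality eps f) (heq_refl _))).
apply: (heq_trans (heq_sym (compA _ _ _))).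
apply: (heq_trans (heq_comp (heq_refl _) (tL P))).
exact: comp_idr.
Qed.

Lemma adjoint_Kfunctor (L : functor (CX k J) (CX k J')) (R : functor (CX k J') (CX k J))
    c h (V : gmod k J) (V' : gmod k J') (iL : induces c h V V' L) (iR : induces c h V' V R) :
  adjoint L R -> adjoint (Kfunctor iL) (Kfunctor iR).
Proof.
move=> [eta [eps [tL tR]]].
exists (@NatTrans (Kcat c h V) (Kcat c h V) (idF _) (compF (Kfunctor iR) (Kfunctor iL))
  (fun X => eta (sval X)) (fun X Y f => hequiv_heq c h V (naturality eta f))).
exists (@NatTrans (Kcat c h V') (Kcat c h V') (compF (Kfunctor iL) (Kfunctor iR)) (idF _)
  (fun X => eps (sval X)) (fun X Y f => hequiv_heq c h V' (naturality eps f))).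
split=> X; apply: hequiv_heq; [exact: tL|exact: tR].
Qed.

Section Degreewise.
Variable F : functor (MOD k J) (MOD k J').
Hypothesis F0 : forall (X Y : gmod k J) (f : ghom X Y),
  (forall x, f x = 0) -> forall y, fmap F f y = 0.

Lemma functor_zero_module (X : gmod k J) :
  (forall x : X, x = 0) -> forall y : F X, y = 0.
Proof.
move=> X0 y; rewrite -[LHS]/(idm (F X : MOD k J') y) -[LHS](fmap_id F X y).
by apply: F0 => x; apply: X0.
Qed.

Lemma degreewise_in_C c :
  (forall X, has_term_type c.1 X -> has_term_type c.1 (F X)) ->
  forall X : complex k J, in_C c X -> in_C c (degreewise F0 X).
Proof.
move=> tF X [tX bX]; split=> [n|]; first by apply: tF; apply: tX.
have ab Y : bounded_above Y -> bounded_above (degreewise F0 Y).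
  by move=> [N NP]; exists N => n /NP; apply: functor_zero_module.
have be Y : bounded_below Y -> bounded_below (degreewise F0 Y).
  by move=> [N NP]; exists N => n /NP; apply: functor_zero_module.
by case: c.2 bX => [|/ab|/be|[/ab ? /be ?]].
Qed.

Lemma degreewise_exact :
  (forall (A B C : gmod k J) (i : ghom A B) (p : ghom B C),
     [/\ injective i, forall y, p y = 0 <-> exists x, y = i x & forall z, exists y, p y = z] ->
     [/\ injective (fmap F i), forall y, fmap F p y = 0 <-> exists x, y = fmap F i x
       & forall z, exists y, fmap F p y = z]) ->
  forall E, Defs.exact E -> Defs.exact (map_seq (degreewise F0) E).
Proof. by move=> exF E exE n; apply: exF; apply: exE. Qed.

Lemma degreewise_term_split E : term_split E -> term_split (map_seq (degreewise F0) E).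
Proof.
move=> sE n; have [s sP] := sE n; exists (fmap F s) => z.
rewrite -[RHS](fmap_id F _ z) -[LHS](fmap_comp F (seq_p E n) s z).
by apply: (@fmap_heq _ _ F) => y; apply: sP.
Qed.

Lemma degreewise_induces c h V V' :
  (forall (X Y Z : gmod k J) (f g : ghom X Y) (a : ghom X Z) (b : ghom Z Y),
     (forall x, f x - g x = b (a x)) ->
     forall y, fmap F f y - fmap F g y = fmap F b (fmap F a y)) ->
  (forall X, in_C c X -> in_C c (degreewise F0 X)) ->
  (forall P, E_projective c h V P -> E_projective c h V' (degreewise F0 P)) ->
  induces c h V V' (degreewise F0).
Proof.
move=> FB FC FP; split=> // X Y f g _ _ [P [a [b [pP e]]]].
exists (degreewise F0 P), (fmap (degreewise F0) a), (fmap (degreewise F0) b).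
by split=> [|n]; [apply: FP|apply: FB; apply: e].
Qed.

Section VSplit.
Variables (V : gmod k J) (V' : gmod k J').
Variable alpha : nat_trans (compF (TensM V') F) (compF F (TensM V)).
Variable beta : nat_trans (compF F (TensM V)) (compF (TensM V') F).
Hypothesis alphaK : forall X, heq (comp (beta X) (alpha X)) (idm _).

(** By [alphaK], V' (x) F X is a natural retract of F (V (x) X), so a section s of V (x) p yields
    the section beta F(s) alpha; naturality in X makes it commute with the differentials. *)
Lemma degreewise_tensor_split E :
  split_seq (tensor_seq V E) -> split_seq (tensor_seq V' (map_seq (degreewise F0) E)).
Proof.
move=> [s sP].
have nA X Y (u : ghom X Y) x : alpha Y (vmap V' (fmap F u) x) = fmap F (vmap V u) (alpha X x).
  exact: (naturality alpha u x).
have nB X Y (u : ghom X Y) x : beta Y (fmap F (vmap V u) x) = vmap V' (fmap F u) (beta X x).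
  exact: (naturality beta u x).
have fc X Y Z (u : ghom Y Z) (v : ghom X Y) x :
    fmap F u (fmap F v x) = fmap F (comp (c := MOD k J) u v) x.
  exact: (esym (fmap_comp F u v x)).
pose f n : ghom (vtens V' (F (seqC E n))) (vtens V' (F (seqB E n))) :=
  comp (c := MOD k J') (beta (seqB E n)) (comp (c := MOD k J') (fmap F (s n)) (alpha (seqC E n))).
have fd n x : f (n + 1) (vmap V' (fmap F (diff (seqC E) n)) x) =
              vmap V' (fmap F (diff (seqB E) n)) (f n x).
  rewrite -[LHS]/(beta _ (fmap F (s (n + 1)) (alpha _ (vmap V' (fmap F (diff (seqC E) n)) x)))).
  rewrite -[RHS]/(vmap V' (fmap F (diff (seqB E) n)) (beta _ (fmap F (s n) (alpha _ x)))).
  rewrite nA -nB !fc; congr (beta _ _).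
  by apply: (@fmap_heq _ _ F) => z; apply: (cmap_diff s).
exists (@Chain _ _ _ (seqC (tensor_seq V' (map_seq (degreewise F0) E)))
  (seqB (tensor_seq V' (map_seq (degreewise F0) E))) f fd) => n z.
rewrite -[LHS]/(vmap V' (fmap F (seq_p E n)) (beta _ (fmap F (s n) (alpha _ z)))) -nB fc.
rewrite -[RHS](alphaK z) /=; congr (beta _ _).
by apply: etrans (fmap_id F _ _); apply: (@fmap_heq _ _ F) => y; apply: sP.
Qed.

Lemma degreewise_tensor_term_split E :
  term_split (tensor_seq V E) -> term_split (tensor_seq V' (map_seq (degreewise F0) E)).
Proof.
move=> sE n; have [s sP] := sE n.
exists (comp (c := MOD k J') (beta (seqB E n))
        (comp (c := MOD k J') (fmap F s) (alpha (seqC E n)))) => z.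
rewrite -[LHS](naturality beta (seq_p E n)) -[RHS](alphaK z) /=; congr (beta _ _).
apply: etrans (esym (fmap_comp F (vmap V (seq_p E n)) s _)) _.
by apply: etrans (fmap_id F _ _); apply: (@fmap_heq _ _ F) => y; apply: sP.
Qed.

Lemma degreewise_in_E h E :
  in_E h V E -> in_E h V' (map_seq (degreewise F0) E).
Proof.
case: h => /=.
- exact: degreewise_term_split.
- exact: degreewise_tensor_split.
- exact: degreewise_tensor_term_split.
- by move=> [? ?]; split; [apply: degreewise_term_split|apply: degreewise_tensor_split].
Qed.
End VSplit.
End Degreewise.

Lemma degreewise_adjoint (L : functor (MOD k J) (MOD k J')) (R : functor (MOD k J') (MOD k J))
    (L0 : forall (X Y : gmod k J) (f : ghom X Y),
       (forall x, f x = 0) -> forall y, fmap L f y = 0)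
    (R0 : forall (X Y : gmod k J') (f : ghom X Y),
       (forall x, f x = 0) -> forall y, fmap R f y = 0) :
  adjoint L R -> adjoint (degreewise L0) (degreewise R0).
Proof.
move=> [eta [eps [tL tR]]].
pose eta' (X : complex k J) : chain X (degreewise R0 (degreewise L0 X)) :=
  @Chain _ _ _ X (degreewise R0 (degreewise L0 X)) (fun n => eta (X n))
    (fun n x => naturality eta (diff X n) x).
pose eps' (X : complex k J') : chain (degreewise L0 (degreewise R0 X)) X :=
  @Chain _ _ _ (degreewise L0 (degreewise R0 X)) X (fun n => eps (X n))
    (fun n x => naturality eps (diff X n) x).
exists (@NatTrans _ _ (idF _) (compF (degreewise R0) (degreewise L0)) eta'
  (fun X Y f n => naturality eta (f n))).
exists (@NatTrans _ _ (compF (degreewise L0) (degreewise R0)) (idF _) eps'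
  (fun X Y f n => naturality eps (f n))).
by split=> X n; [apply: tL|apply: tR].
Qed.
End Functors.

(** * The two adjunctions between induction and restriction of modules *)

Section RestrictionInduction.
Variables (k : comPzRingType) (gT : finGroupType) (G H : {group gT}).
Hypothesis sHG : H \subset G.

Local Notation actG Y g x := (@act k gT G Y g x).

Lemma ind_lift_bal (X : gmod k H) (Y : gmod k G) (f : ghom X (res sHG Y)) g h x :
  g \in G -> h \in H -> actG Y (g * h)%g (f x) = actG Y g (f (act h x)).
Proof. by move=> gG hH; rewrite (gfun_act f x hH); apply: (@actM _ _ G Y) => //; apply: (subsetP
  sHG). Qed.

Lemma ind_lift_linear (X : gmod k H) (Y : gmod k G) (f : ghom X (res sHG Y)) g :
  linear (fun x => actG Y g (f x)).
Proof. by move=> c x y; rewrite linearP actD actZ. Qed.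

Definition ind_lift_lin (X : gmod k H) (Y : gmod k G) (f : ghom X (res sHG Y)) :
  {linear ind_car G X -> Y} := ind_elim sHG (ind_lift_linear f) (@ind_lift_bal X Y f).

Lemma ind_liftE X Y (f : ghom X (res sHG Y)) g x : g \in G ->
  ind_lift_lin f (ind_gen G g x) = actG Y g (f x).
Proof. exact: ind_elimE. Qed.

Lemma ind_lift_act X Y (f : ghom X (res sHG Y)) g (z : ind G X) : g \in G ->
  ind_lift_lin f (act g z) = act g (ind_lift_lin f z).
Proof.
move=> gG; move: z; apply: (ind_ext_gen (f := ind_lift_lin f \o ind_act G X g)
  (f' := @act _ _ G Y g \o ind_lift_lin f)) => u x uG.
rewrite -[LHS]/(ind_lift_lin f (actG (ind G X) g (ind_gen G u x))).
rewrite -[RHS]/(act g (ind_lift_lin f (ind_gen G u x))).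
by rewrite act_ind_gen // !ind_liftE ?groupM // actM.
Qed.

Definition ind_lift X Y (f : ghom X (res sHG Y)) : ghom (ind G X) Y :=
  @Ghom _ _ G (ind G X) Y (ind_lift_lin f) (fun c x y => linearP (ind_lift_lin f) c x y)
    (@ind_lift_act X Y f).

Definition ind_unit_fun (X : gmod k H) (x : X) : res sHG (ind G X) := ind_gen G 1%g x.

Lemma ind_unit_act X g x : g \in H -> @ind_unit_fun X (act g x) = act g (ind_unit_fun x).
Proof.
move=> gH; have gG := subsetP sHG _ gH.
rewrite -[RHS]/(actG (ind G X) g (ind_gen G 1%g x)) act_ind_gen //.
by rewrite /ind_unit_fun ind_gen_act // mul1g mulg1.
Qed.

Definition ind_unit (X : gmod k H) : ghom X (res sHG (ind G X)) :=
  @Ghom _ _ H X (res sHG (ind G X)) (@ind_unit_fun X) (@ind_gen_linear _ _ _ _ X 1%g)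
   (@ind_unit_act X).

Lemma Ind_Res_adjoint : adjoint (IndM k G H) (ResM k sHG).
Proof.
pose eps (Y : gmod k G) : ghom (ind G (res sHG Y)) Y := ind_lift (idm (res sHG Y : MOD k H)).
have [eta etaE] : exists eta : nat_trans (idF _) (compF (ResM k sHG) (IndM k G H)),
    forall X, eta X = ind_unit X.
  by exists (@NatTrans _ _ (idF _) (compF (ResM k sHG) (IndM k G H)) ind_unit
    (fun X Y f x => esym (ind_map_gen G f 1%g x))).
have epsP (X Y : gmod k G) (f : ghom X Y) z :
    eps Y (ind_map G (fmap (ResM k sHG) f) z) = f (eps X z).
  move: z; apply: (ind_ext_gen (f := eps Y \o ind_map_lin G (fmap (ResM k sHG) f))
    (f' := f \o eps X)) => g x gG.
  rewrite -[LHS]/(eps Y (ind_map G (fmap (ResM k sHG) f) (ind_gen G g x))) ind_map_gen.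
  rewrite -[RHS]/(f (eps X (ind_gen G g x))).
  rewrite -[LHS]/(ind_lift_lin _ _) -[eps X _]/(ind_lift_lin _ _) !ind_liftE //=.
  by rewrite gfun_act.
exists eta, (@NatTrans _ _ (compF (IndM k G H) (ResM k sHG)) (idF _) eps epsP).
split=> [X z|Y y]; last first.
  rewrite etaE -[LHS]/(ind_lift_lin (idm (res sHG Y : MOD k H)) (ind_gen G 1%g y)).
  by rewrite ind_liftE // act1.
rewrite etaE -[LHS]/(eps (ind G X) (ind_map G (ind_unit X) z)).
move: z; apply: (ind_ext_gen (f := eps (ind G X) \o ind_map_lin G (ind_unit X)) (f' := idfun)).
move=> g x gG; rewrite -[LHS]/(eps (ind G X) (ind_map G (ind_unit X) (ind_gen G g x))).
rewrite ind_map_gen -[LHS]/(ind_lift_lin _ _) ind_liftE //.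
by rewrite -[LHS]/(actG (ind G X) g (ind_gen G 1%g x)) act_ind_gen // mulg1.
Qed.

(** The relative trace element, the sum of the g (x) g^-1 y over left cosets gH. It is the unit of
    the adjunction with Res on the left, whose counit is the coordinate at 1. *)
Definition coind_unit_fun (Y : gmod k G) (y : Y) : ind G (res sHG Y) :=
  coind G (X := res sHG Y) (fun g => act g^-1%g y).

Lemma coind_unit_coind (Y : gmod k G) (y : Y) :
  coind_fun G (X := res sHG Y) (fun g => act g^-1%g y).
Proof.
by move=> g h gG hH; rewrite invMg /= actM ?groupV // (subsetP sHG).
Qed.

Lemma coind_unit_linear Y : linear (@coind_unit_fun Y).
Proof.
move=> c x y; apply: (@ind_coord_inj _ _ _ _ sHG (res sHG Y)) => g gG.
rewrite (linearP (ind_coord sHG _ g)) !ind_coord_coind //; try exact: coind_unit_coind.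
exact: (@act_linear _ _ G Y g^-1%g).
Qed.

Lemma coind_unit_act Y g y : g \in G ->
  @coind_unit_fun Y (act g y) = act g (coind_unit_fun y).
Proof.
move=> gG; rewrite act_coind //; last exact: coind_unit_coind.
apply: eq_coset_sum => // u uG; congr ind_gen.
by rewrite invMg invgK /= actM ?groupV.
Qed.

Definition coind_unit (Y : gmod k G) : ghom Y (ind G (res sHG Y)) :=
  Ghom (@coind_unit_linear Y) (@coind_unit_act Y).

Lemma coind_counit_act (X : gmod k H) g (z : res sHG (ind G X)) : g \in H ->
  ind_coord sHG X 1%g (act g z) = act g (ind_coord sHG X 1%g z).
Proof.
move=> gH; rewrite -[act g z]/(actG (ind G X) g z) ind_coord_act ?(subsetP sHG) //.
by rewrite mulg1 -[(g^-1)%g]mul1g ind_coordM ?groupV // invgK.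
Qed.

Definition coind_counit (X : gmod k H) : ghom (res sHG (ind G X)) X :=
  @Ghom _ _ H (res sHG (ind G X)) X (ind_coord sHG X 1%g)
    (fun c x y => linearP (ind_coord sHG X 1%g) c x y) (@coind_counit_act X).

Lemma Res_Ind_adjoint : adjoint (ResM k sHG) (IndM k G H).
Proof.
have etaP (X Y : gmod k G) (f : ghom X Y) x :
    coind_unit Y (f x) = ind_map G (fmap (ResM k sHG) f) (coind_unit X x).
  rewrite ind_map_coind; apply: eq_coset_sum => // g gG; congr ind_gen.
  by rewrite /= gfun_act ?groupV.
exists (@NatTrans _ _ (idF _) (compF (IndM k G H) (ResM k sHG)) coind_unit etaP).
exists (@NatTrans _ _ (compF (ResM k sHG) (IndM k G H)) (idF _) coind_counit
  (fun X Y f z => ind_coord_map sHG f 1%g z)).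
split=> [Y y|X z].
  rewrite -[LHS]/(ind_coord sHG (res sHG Y) 1%g (coind_unit_fun y)).
  rewrite ind_coord_coind ?invg1 ?act1 //; exact: coind_unit_coind.
rewrite -[LHS]/(ind_map G (coind_counit X) (coind_unit_fun z)).
rewrite ind_map_coind -[RHS](ind_coordK sHG z); apply: eq_coset_sum => // g gG.
congr ind_gen; rewrite -[LHS]/(ind_coord sHG X 1%g (actG (ind G X) g^-1%g z)).
by rewrite ind_coord_act ?groupV // invgK mulg1.
Qed.

Lemma Ind_exact (A B C : gmod k H) (i : ghom A B) (p : ghom B C) :
   [/\ injective i, forall y, p y = 0 <-> exists x, y = i x & forall z, exists y, p y = z] ->
   [/\ injective (ind_map G i), forall y, ind_map G p y = 0 <-> exists x, y = ind_map G i x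
     & forall z, exists y, ind_map G p y = z].
Proof.
move=> [inj mid sur]; split=> [z z' e|z|z].
- apply: (@ind_coord_inj _ _ _ _ sHG A) => g gG; apply: inj.
  by rewrite -!(ind_coord_map sHG i) e.
- split=> [e|[x ->]].
    have ex g : exists x, ind_coord sHG B g z = i x.
      by apply/mid; rewrite -(ind_coord_map sHG p) e linear0.
    (* The preimages are chosen separately for each g and need not form a [coind_fun]: [coind] and
       [ind_map_coind] accept any function. *)
    exists (coind G (fun g => projT1 (cid (ex g)))).
    rewrite ind_map_coind -[LHS](ind_coordK sHG z); apply: eq_coset_sum => // g _.
    by case: cid => x /= ->.
  apply: (@ind_coord_inj _ _ _ _ sHG C) => g gG; rewrite linear0 !ind_coord_map.
  by apply/mid; eexists.
- pose y g := projT1 (cid (sur (ind_coord sHG C g z))).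
  exists (coind G y); rewrite ind_map_coind -[RHS](ind_coordK sHG z).
  by apply: eq_coset_sum => // g _; rewrite /y; case: cid => x /= ->.
Qed.

Lemma Ind_term_type s (X : gmod k H) : has_term_type s X -> has_term_type s (ind G X).
Proof.
move=> /has_term_type_linear tX; apply/has_term_type_linear.
(* The index type is all sets of group elements; a set that is not a coset contributes 0. *)
apply: (@linear_term_type_cover _ {set gT} _ _ (fun C => GRing.Linear.clone _ _ _ _ (@ind_gen _
  _ G _ X (repr C)) _)) _ tX => z.
exists (fun C => if C \in lcosets H G then ind_coord sHG X (repr C) z else 0).
rewrite -[LHS](ind_coordK sHG z) /coind /coset_sum big_mkcond; apply: eq_bigr => C _.
by case: ifP => // _; rewrite linear0.
Qed.
End RestrictionInduction.

(** * The projection formula for families of modules *)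

Section ProjectionFormula.
Variables (k : comPzRingType) (gT : finGroupType) (G H : {group gT}).
Hypothesis sHG : H \subset G.
Variables (A : choiceType) (M : A -> gmod k G) (N : A -> gmod k H).

Let MN := dtens (fun a => res sHG (M a)) N.
Let MIN := dtens M (fun a => ind G (N a)).

Lemma dpure_linl (J : {group gT}) (U W : A -> gmod k J) a (y : W a) :
  linear (fun x : U a => dpure (N := W) x y).
Proof. exact: pure_linl. Qed.
Lemma dpure_linr (J : {group gT}) (U W : A -> gmod k J) a (x : U a) :
  linear (fun y : W a => dpure (M := U) x y).
Proof. exact: pure_linr. Qed.

Lemma dtens_ind_ext (P : lmodType k) (f f' : {linear MIN -> P}) :
  (forall a (x : M a) g (y : N a), g \in G ->
     f (dpure x (ind_gen G g y : ind G (N a))) = f' (dpure x (ind_gen G g y : ind G (N a)))) ->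
  f =1 f'.
Proof.
move=> e; apply: dt_ext => a x z.
pose q : {linear ind G (N a) -> MIN} := mklinear (@dpure_linr G M (fun a => ind G (N a)) a x).
move: z; apply: (ind_ext_gen (f := f \o q) (f' := f' \o q)) => g y gG.
exact: e.
Qed.

(** In terms of functions on G, x (x) z goes to g |-> g^-1 x (x) z(g). Families indexed by A cover
    two uses at once: A = unit for V (x) -, and A = [bideg n] for a term of a tensor product of
    complexes. *)
Lemma projection_balanced : balanced (no_op M) (no_op (fun a => ind G (N a)))
  (fun a (x : M a) (z : ind G (N a)) =>
     coind G (X := MN) (fun g => dpure (M := fun a => res sHG (M a)) (N := N)
       (@act _ _ G (M a) g^-1%g x) (ind_coord sHG (N a) g z))).
Proof.
have lin (W : lmodType k) (F : gT -> W -> MN) : (forall g, linear (F g)) ->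
    linear (fun w => coind G (X := MN) (fun g => F g w)).
  move=> Flin c w w'; rewrite /coind /coset_sum scaler_sumr -big_split.
  by apply: eq_bigr => C _; rewrite Flin linearP.
split=> [a z|a x|a []].
- apply: (lin _ (fun g x => _)) => g c x x'.
  by rewrite act_linear (@dpure_linl H (fun a => res sHG (M a)) N).
- apply: (lin _ (fun g x => _)) => g c z z'.
  by rewrite linearP (@dpure_linr H (fun a => res sHG (M a)) N).
Qed.

Definition projection_lin : {linear MIN -> ind G MN} := tlift projection_balanced.

Lemma projection_gen a (x : M a) g (y : N a) : g \in G ->
  projection_lin (dpure x (ind_gen G g y : ind G (N a))) =
  ind_gen G (X := MN) g (dpure (M := fun a => res sHG (M a)) (@act _ _ G (M a) g^-1%g x) y).
Proof.
move=> gG; rewrite [LHS]tlift_pure /coind (coset_sum1 sHG _ (g := g)) //.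
- by rewrite ind_coord_gen // mulVg group1 act1.
- move=> u h uG hH; have hG := subsetP sHG _ hH.
  rewrite ind_coordM // -ind_gen_act // invMg.
  rewrite -[@act _ _ H MN h _]/(dt_act _ _ h _) dt_actE.
  rewrite -(@actM _ _ G (M a) h) ?groupM ?groupV // mulgA mulgV mul1g.
  by rewrite -actM ?groupV // mulgV act1.
- move=> g' g'G; rewrite -groupV invMg invgK ind_coord_gen // => /negPf ->.
  by rewrite (linear_fun0 (@dpure_linr H (fun a => res sHG (M a)) N _ _)) linear0.
Qed.

Lemma projection_act g (z : MIN) : g \in G ->
  projection_lin (act g z) = act g (projection_lin z).
Proof.
move=> gG; move: z; apply: (dtens_ind_ext (f := projection_lin \o dt_act M (fun a => ind G (N a)) g)
  (f' := ind_act G MN g \o projection_lin)) => a x u y uG.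
rewrite -[LHS]/(projection_lin (dt_act M (fun a => ind G (N a)) g
   (dpure x (ind_gen G u y : ind G (N a))))).
rewrite -[RHS]/(@act _ _ G (ind G MN) g (projection_lin (dpure x (ind_gen G u y : ind G (N a))))).
have guG := groupM gG uG.
rewrite dt_actE (@act_ind_gen _ _ G H (N a)) // projection_gen //.
rewrite projection_gen // act_ind_gen // invMg.
by rewrite -(@actM _ _ G (M a)) ?groupM ?groupV // mulgKV.
Qed.

Definition projection : ghom MIN (ind G MN) :=
  @Ghom _ _ G MIN (ind G MN) projection_lin (fun c x y => linearP projection_lin c x y)
    projection_act.

Definition projection_unit : {linear MN -> MIN} :=
  dt_map_lin (fun a => idm (res sHG (M a) : MOD k H)) (fun a => ind_unit sHG (N a)).

Lemma projection_unit_act g z : g \in H -> projection_unit (act g z) = act g (projection_unit z).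
Proof.
exact: (gfun_act (dt_map (fun a => idm (res sHG (M a) : MOD k H)) (fun a => ind_unit sHG (N a)))).
Qed.

(** By adjunction, a map out of the induced module is given by an H-map; here it is x (x) y |-> x
    (x) (1 (x) y), the identity tensored with the unit. *)
Definition projection_inv : ghom (ind G MN) MIN :=
  ind_lift (@Ghom _ _ H MN (res sHG MIN) projection_unit
    (fun c x y => linearP projection_unit c x y) projection_unit_act).

Lemma projection_inv_gen a (x : M a) g (y : N a) : g \in G ->
  projection_inv (ind_gen G (X := MN) g (dpure (M := fun a => res sHG (M a)) x y)) =
  dpure (M := M) (N := fun a => ind G (N a)) (act g x) (ind_gen G g y).
Proof.
move=> gG; rewrite [LHS]ind_liftE //.
rewrite -[LHS]/(dt_act M (fun a => ind G (N a)) g (projection_unit (dpure (M := fun a => res sHG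
  (M a)) x y))).
rewrite [projection_unit _]dt_mapE -[LHS]/(dt_act M (fun a => ind G (N a)) g (dpure (x : M a)
  (ind_gen G 1%g y : ind G (N a)))).
by rewrite dt_actE act_ind_gen // mulg1.
Qed.

Lemma projectionK z : projection_inv (projection z) = z.
Proof.
move: z; apply: (dtens_ind_ext (f := projection_inv \o projection_lin) (f' := idfun)) => a x g y gG.
rewrite -[LHS]/(projection_inv (projection_lin (dpure x (ind_gen G g y : ind G (N a))))).
rewrite projection_gen // projection_inv_gen //.
by rewrite -(@actM _ _ G (M a)) ?groupV // mulgV act1.
Qed.

Lemma projection_invK z : projection (projection_inv z) = z.
Proof.
move: z; apply: (ind_ext_gen (f := projection_lin \o projection_inv) (f' := idfun)) => g w gG.
pose q : {linear MN -> ind_car G MN} := mklinear (@ind_gen_linear _ _ G H MN g).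
move: w; apply: (dt_ext (f := projection_lin \o projection_inv \o q) (g := q)) => a x y.
rewrite -[LHS]/(projection_lin (projection_inv (ind_gen G (X := MN) g (dpure (M := fun a => res
  sHG (M a)) x y)))).
rewrite projection_inv_gen // projection_gen //.
by rewrite -(@actM _ _ G (M a)) ?groupV // mulVg act1.
Qed.
End ProjectionFormula.

Section ProjectionNaturality.
Variables (k : comPzRingType) (gT : finGroupType) (G H : {group gT}).
Hypothesis sHG : H \subset G.
Variables (A : choiceType) (M M' : A -> gmod k G) (N N' : A -> gmod k H).
Variables (f : forall a, ghom (M a) (M' a)) (h : forall a, ghom (N a) (N' a)).

(** Naturality is checked on the inverse, which is explicit on the generators g (x) (x (x) y), and
    passes to [projection] because the two are mutually inverse. *)
Lemma projection_inv_natural (w : ind G (dtens (fun a => res sHG (M a)) N)) :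
  projection_inv sHG M' N' (ind_map G (dt_map (fun a => fmap (ResM k sHG) (f a)) h) w) =
  dt_map f (fun a => ind_map G (h a)) (projection_inv sHG M N w).
Proof.
pose r a : ghom (res sHG (M a)) (res sHG (M' a)) := fmap (ResM k sHG) (f a).
pose u : {linear _ -> _} := ind_map_lin G (dt_map r h).
pose v : {linear _ -> _} := dt_map_lin f (fun a => ind_map G (h a)).
move: w; apply: (ind_ext_gen (f := projection_inv sHG M' N' \o u)
  (f' := v \o projection_inv sHG M N)) => g w gG.
pose q : {linear dtens (fun a => res sHG (M a)) N -> ind_car G (dtens (fun a => res sHG (M a))
  N)} :=
  mklinear (@ind_gen_linear _ _ G H (dtens (fun a => res sHG (M a)) N) g).
move: w; apply: (dt_ext (f := projection_inv sHG M' N' \o u \o q)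
  (g := v \o projection_inv sHG M N \o q)) => a x y.
rewrite -[LHS]/(projection_inv sHG M' N' (ind_map G (dt_map r h)
   (ind_gen G (X := dtens (fun a => res sHG (M a)) N) g (dpure (M := fun a => res sHG (M a)) (N
     := N) x y)))).
rewrite -[RHS]/(dt_map_lin f (fun a => ind_map G (h a)) (projection_inv sHG M N
   (ind_gen G (X := dtens (fun a => res sHG (M a)) N) g (dpure (M := fun a => res sHG (M a)) (N
     := N) x y)))).
rewrite projection_inv_gen // dt_mapE gfun_act // ind_map_gen ind_map_gen.
by rewrite -[dt_map r h _]/(dt_map_lin r h _) dt_mapE projection_inv_gen.
Qed.

Lemma projection_natural (z : dtens M (fun a => ind G (N a))) :
  projection sHG M' N' (dt_map f (fun a => ind_map G (h a)) z) =
  ind_map G (dt_map (fun a => fmap (ResM k sHG) (f a)) h) (projection sHG M N z).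
Proof.
by rewrite -{1}(projectionK sHG z) -projection_inv_natural projection_invK.
Qed.
End ProjectionNaturality.

(** * Descent of induction, restriction and conjugation *)

Section InducedFunctors.
Variables (k : comPzRingType) (gT : finGroupType).
Implicit Types (G H K L : {group gT}).

Lemma Ind_tensor_in_E G H (sHG : H \subset G) (V : gmod k G) h E :
  in_E h (res sHG V) E -> in_E h V (map_seq (Ind k G H) E).
Proof.
pose alpha X := projection sHG (fun _ : unit => V) (fun _ : unit => X).
pose beta X := projection_inv sHG (fun _ : unit => V) (fun _ : unit => X).
refine (@degreewise_in_E _ _ _ _ _ _ _ _
  (@NatTrans _ _ (compF (TensM V) (IndM k G H)) (compF (IndM k G H) (TensM (res sHG V)))
     alpha (fun X Y f z => projection_natural sHG (fun _ : unit => idm (V : MOD k G)) (fun=> f) z))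
  (@NatTrans _ _ (compF (IndM k G H) (TensM (res sHG V))) (compF (TensM V) (IndM k G H))
     beta (fun X Y f z => projection_inv_natural (sHG := sHG) (fun _ : unit => idm (V : MOD k
       G)) (fun=> f) z)) _ h E).
by move=> X z; apply: projectionK.
Qed.

Lemma Res_tensor_in_E G H (sHG : H \subset G) (V : gmod k G) h E :
  in_E h V E -> in_E h (res sHG V) (map_seq (Res k sHG) E).
Proof.
pose alpha (X : gmod k G) : ghom (vtens (res sHG V) (res sHG X)) (res sHG (vtens V X)) :=
  @Ghom _ _ H (vtens (res sHG V) (res sHG X)) (res sHG (vtens V X)) id
    (fun _ _ _ => erefl) (fun _ _ _ => erefl).
pose beta (X : gmod k G) : ghom (res sHG (vtens V X)) (vtens (res sHG V) (res sHG X)) :=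
  @Ghom _ _ H (res sHG (vtens V X)) (vtens (res sHG V) (res sHG X)) id
    (fun _ _ _ => erefl) (fun _ _ _ => erefl).
refine (@degreewise_in_E _ _ _ _ _ _ _ _
  (@NatTrans _ _ (compF (TensM (res sHG V)) (ResM k sHG)) (compF (ResM k sHG) (TensM V))
     alpha (fun X Y f z => erefl))
  (@NatTrans _ _ (compF (ResM k sHG) (TensM V)) (compF (TensM (res sHG V)) (ResM k sHG))
     beta (fun X Y f z => erefl)) _ h E).
by [].
Qed.

Section Conjugation.
Variables (G L L' : {group gT}) (t : gT).
Hypotheses (sL : L \subset G) (sL' : L' \subset G) (tG : t \in G).
Hypothesis eL : (L' :^ t)%g = L.

(** V is a module for all of G and t lies in G, so acting by t^-1 is an isomorphism from the
    restriction of V to L' onto the conjugate of its restriction to L. *)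
Lemma Conj_tensor_in_E (V : gmod k G) h E :
  in_E h (res sL V) E -> in_E h (res sL' V) (map_seq (Conj k eL) E).
Proof.
have w_act g v : g \in L' -> @act _ _ G V t^-1%g (act g v) = act (g ^ t)%g (act t^-1%g v).
  move=> gL'; have gG := subsetP sL' _ gL'.
  by rewrite -!actM ?groupV ?groupJ // conjgE -!mulgA mulgV mulg1.
have w'_act g v : g \in L' -> @act _ _ G V t (act (g ^ t)%g v) = act g (act t v).
  move=> gL'; have gG := subsetP sL' _ gL'.
  by rewrite -!actM ?groupJ // conjgE !mulgA mulgV mul1g.
pose w : ghom (res sL' V) (conj_mod eL (res sL V)) :=
  @Ghom _ _ L' (res sL' V) (conj_mod eL (res sL V)) (@act _ _ G V t^-1%g)
    (@act_linear _ _ G V t^-1%g) w_act.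
pose w' : ghom (conj_mod eL (res sL V)) (res sL' V) :=
  @Ghom _ _ L' (conj_mod eL (res sL V)) (res sL' V) (@act _ _ G V t)
    (@act_linear _ _ G V t) w'_act.
pose U X := vtens (conj_mod eL (res sL V)) (conj_mod eL X).
pose c1 X : ghom (U X) (conj_mod eL (vtens (res sL V) X)) :=
  @Ghom _ _ L' (U X) (conj_mod eL (vtens (res sL V) X)) id
    (fun _ _ _ => erefl) (fun _ _ _ => erefl).
pose c2 X : ghom (conj_mod eL (vtens (res sL V) X)) (U X) :=
  @Ghom _ _ L' (conj_mod eL (vtens (res sL V) X)) (U X) id
    (fun _ _ _ => erefl) (fun _ _ _ => erefl).
pose a1 X : ghom (vtens (res sL' V) (conj_mod eL X)) (U X) :=
  dt_map (fun _ : unit => w) (fun _ : unit => idm (conj_mod eL X : MOD k L')).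
pose a2 X : ghom (U X) (vtens (res sL' V) (conj_mod eL X)) :=
  dt_map (fun _ : unit => w') (fun _ : unit => idm (conj_mod eL X : MOD k L')).
have a1P X Y (f : ghom X Y) z : a1 Y (vmap (res sL' V) (fmap (ConjM k eL) f) z) =
    vmap (res sL V) f (a1 X z).
  move: z; apply: (vtens_ext (f := a1 Y \o vmap (res sL' V) (fmap (ConjM k eL) f))
    (g := vmap (conj_mod eL (res sL V)) (fmap (ConjM k eL) f) \o a1 X)) => v x.
  rewrite -[LHS]/(dt_map_lin _ _ (dt_map_lin _ _ (vpure v x))).
  rewrite -[RHS]/(dt_map_lin _ _ (dt_map_lin _ _ (vpure v x))).
  by rewrite !dt_mapE.
have a2P X Y (f : ghom X Y) z : a2 Y (vmap (res sL V) f z) =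
    vmap (res sL' V) (fmap (ConjM k eL) f) (a2 X z).
  move: z; apply: (vtens_ext (g := vmap (res sL' V) (fmap (ConjM k eL) f) \o a2 X)
    (f := a2 Y \o vmap (conj_mod eL (res sL V)) (fmap (ConjM k eL) f))) => v x.
  rewrite -[LHS]/(dt_map_lin _ _ (dt_map_lin _ _ (vpure v x))).
  rewrite -[RHS]/(dt_map_lin _ _ (dt_map_lin _ _ (vpure v x))).
  by rewrite !dt_mapE.
refine (@degreewise_in_E _ _ _ _ _ _ _ _
  (@NatTrans _ _ (compF (TensM (res sL' V)) (ConjM k eL)) (compF (ConjM k eL) (TensM (res sL V)))
     (fun X => comp (c := MOD k L') (c1 X) (a1 X)) a1P)
  (@NatTrans _ _ (compF (ConjM k eL) (TensM (res sL V))) (compF (TensM (res sL' V)) (ConjM k eL))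
     (fun X => comp (c := MOD k L') (a2 X) (c2 X)) a2P) _ h E).
move=> X z; rewrite -[LHS]/(a2 X (a1 X z)).
move: z; apply: (vtens_ext (f := a2 X \o a1 X) (g := idfun)) => v x.
rewrite -[LHS]/(dt_map_lin _ _ (dt_map_lin _ _ (vpure v x))) !dt_mapE /=.
by rewrite -[@act _ _ G V t _](@actM _ _ G V) ?groupV // mulgV act1.
Qed.

Lemma Conj_adjoint (eL' : (L :^ t^-1)%g = L') : adjoint (ConjM k eL) (ConjM k eL').
Proof.
pose eta (X : gmod k L) : ghom X (conj_mod eL' (conj_mod eL X)) :=
  @Ghom _ _ L X (conj_mod eL' (conj_mod eL X)) id (fun _ _ _ => erefl)
    (fun g x _ => congr1 (fun u => @act _ _ L X u x) (esym (conjgKV t g))).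
pose eps (X : gmod k L') : ghom (conj_mod eL (conj_mod eL' X)) X :=
  @Ghom _ _ L' (conj_mod eL (conj_mod eL' X)) X id (fun _ _ _ => erefl)
    (fun g x _ => congr1 (fun u => @act _ _ L' X u x) (conjgK t g)).
exists (@NatTrans _ _ (idF _) (compF (ConjM k eL') (ConjM k eL)) eta (fun _ _ _ _ => erefl)).
exists (@NatTrans _ _ (compF (ConjM k eL) (ConjM k eL')) (idF _) eps (fun _ _ _ _ => erefl)).
by split.
Qed.
End Conjugation.

Section Induced.
Variables (c : term_type * bound_type) (h : homotopy_type) (G H : {group gT}).
Hypothesis sHG : H \subset G.
Variable V : gmod k G.

Lemma Res_in_C X : in_C c X -> in_C c (Res k sHG X).
Proof. by apply: degreewise_in_C => Y /has_term_type_linear ?; apply/has_term_type_linear. Qed.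

Lemma Ind_in_C X : in_C c X -> in_C c (Ind k G H X).
Proof. by apply: degreewise_in_C => Y; apply: Ind_term_type. Qed.

(** Here Res is the left adjoint, so Ind has to preserve the classes, which rests on the projection
    formula. For [Ind_induces] the roles are exchanged. *)
Lemma Res_induces : induces c h V (res sHG V) (Res k sHG).
Proof.
apply: degreewise_induces => [X Y Z f g a b e y|X|P eP]; [exact: e|exact: Res_in_C|].
have [cP _] := eP; apply: (adjoint_projective (degreewise_adjoint (@ResM0 k gT G H sHG) (@IndM0
  k gT G H)
  (Res_Ind_adjoint k sHG))) eP.
- exact: Ind_in_C.
- move=> E exE inE; split; last exact: Ind_tensor_in_E.
  by apply: degreewise_exact exE => A B C i p; apply: Ind_exact.
- by apply: Res_in_C.
Qed.

Lemma Ind_induces : induces c h (res sHG V) V (Ind k G H).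
Proof.
apply: degreewise_induces => [X Y Z f g a b e|X|P eP].
- move=> z; apply: (@ind_coord_inj _ _ _ _ sHG Y) => g' g'G.
  by rewrite linearB !ind_coord_map.
- exact: Ind_in_C.
- have [cP _] := eP; apply: (adjoint_projective (degreewise_adjoint (@IndM0 k gT G H) (@ResM0 k
  gT G H sHG)
    (Ind_Res_adjoint k sHG))) eP.
  + exact: Res_in_C.
  + move=> E exE inE; split; last exact: Res_tensor_in_E.
    exact: degreewise_exact exE.
  + by apply: Ind_in_C.
Qed.
End Induced.

Lemma Conj_induces c h (G L L' : {group gT}) (t : gT) (sL : L \subset G) (sL' : L' \subset G)
    (tG : t \in G) (eL : (L' :^ t)%g = L) (V : gmod k G) :
  induces c h (res sL V) (res sL' V) (Conj k eL).
Proof.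
have eL' : (L :^ t^-1)%g = L' by rewrite -eL conjsgK.
have CC (J J' : {group gT}) s (e : (J' :^ s)%g = J) X : in_C c X -> in_C c (Conj k e X).
  by apply: degreewise_in_C => Y /has_term_type_linear ?; apply/has_term_type_linear.
apply: degreewise_induces => [X Y Z f g a b e y|X|P eP]; [exact: e|exact: CC|].
have [cP _] := eP; apply: (adjoint_projective (degreewise_adjoint (@ConjM0 k gT L L' t eL)
  (@ConjM0 k gT L' L t^-1 eL')
  (Conj_adjoint eL eL'))) eP.
- exact: CC.
- move=> E exE inE; split; last by apply: (Conj_tensor_in_E _ _ eL') inE; rewrite groupV.
  exact: degreewise_exact exE.
- by apply: CC.
Qed.
End InducedFunctors.

(** * Kernels and direct summands *)

Section Kernel.
Variables (k : comPzRingType) (gT : finGroupType) (J : {group gT}).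

Section Module.
Variables (X Y : gmod k J) (f : ghom X Y).

Definition ker_pred : {pred X} := [pred x | f x == 0].
Lemma ker_submod_closed : submod_closed ker_pred.
Proof.
split=> [|c x y]; rewrite !inE; first by rewrite ghom0.
by move=> /eqP fx /eqP fy; rewrite ghomD ghomZ fx fy scaler0 addr0.
Qed.
HB.instance Definition _ := GRing.isSubmodClosed.Build k X ker_pred ker_submod_closed.

Record ker_car := KerCar { ker_val : X; _ : ker_val \in ker_pred }.
HB.instance Definition _ := [isSub for ker_val].
HB.instance Definition _ := [Choice of ker_car by <:].
HB.instance Definition _ := [SubChoice_isSubLmodule of ker_car by <:].

Lemma ker_valP (x : ker_car) : f (ker_val x) = 0.
Proof. by case: x => x /= /eqP. Qed.

Lemma ker_intro_proof x : f x = 0 -> x \in ker_pred.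
Proof. by move=> fx; rewrite inE fx. Qed.
Definition ker_intro x (fx : f x = 0) : ker_car := KerCar (ker_intro_proof fx).

Lemma ker_val_inj : injective ker_val.
Proof. exact: val_inj. Qed.

Lemma ker_val_linear : linear ker_val.
Proof. by move=> c x y; rewrite -[LHS]/(val (c *: x + y)) linearP. Qed.

Lemma ker_act_closed g x : g \in J -> f x = 0 -> f (act g x) = 0.
Proof. by move=> gJ fx; rewrite gfun_act // fx linear0. Qed.

(** [act g] need not preserve the kernel for [g] outside [J]. *)
Definition ker_act (g : gT) (x : ker_car) : ker_car :=
  if boolP (g \in J) is AltTrue gJ then ker_intro (ker_act_closed gJ (ker_valP x)) else 0.

Lemma ker_actE g x : g \in J -> ker_val (ker_act g x) = act g (ker_val x).
Proof. by move=> gJ; rewrite /ker_act; case: {-}_ / boolP => //; rewrite gJ. Qed.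

Lemma ker_act_linear g : linear (ker_act g).
Proof.
move=> c x y; apply: ker_val_inj; rewrite ker_val_linear.
have [gJ|gJ] := boolP (g \in J); first by rewrite !ker_actE // ker_val_linear linearP.
rewrite /ker_act; case: {-}_ / boolP => [gJ'|_]; first by rewrite gJ' in gJ.
by rewrite -ker_val_linear scaler0 addr0.
Qed.

Lemma ker_act1 x : ker_act 1%g x = x.
Proof. by apply: ker_val_inj; rewrite ker_actE // act1. Qed.

Lemma ker_actM g h x : g \in J -> h \in J -> ker_act (g * h)%g x = ker_act g (ker_act h x).
Proof.
by move=> gJ hJ; apply: ker_val_inj; rewrite !ker_actE ?groupM // actM.
Qed.

Definition ker_mod : gmod k J := Gmod ker_act_linear ker_act1 ker_actM.

Definition ker_inc : ghom ker_mod X :=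
  @Ghom _ _ J ker_mod X ker_val ker_val_linear (fun g x => @ker_actE g x).

Section Factor.
Variables (Z : gmod k J) (u : ghom Z X).
Hypothesis fu : forall z, f (u z) = 0.

Definition ker_lift_fun z : ker_mod := ker_intro (fu z).
Lemma ker_lift_linear : linear ker_lift_fun.
Proof. by move=> c x y; apply: ker_val_inj; rewrite ker_val_linear /= ghomD ghomZ. Qed.
Lemma ker_lift_act g z : g \in J -> ker_lift_fun (act g z) = act g (ker_lift_fun z).
Proof. by move=> gJ; apply: ker_val_inj; rewrite ker_actE //= gfun_act. Qed.
Definition ker_lift : ghom Z ker_mod := Ghom ker_lift_linear ker_lift_act.
End Factor.

(** The map x |-> x - r (f x) is a k-linear projection of X onto the kernel, which is thereby a
    quotient of X. *)
Lemma ker_term_type (r : Y -> X) t : linear r -> (forall y, f (r y) = y) ->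
  has_term_type t X -> has_term_type t ker_mod.
Proof.
move=> rlin rP /has_term_type_linear tX; apply/has_term_type_linear.
have e x : f (x - r (f x)) = 0 by rewrite ghomB rP subrr.
have lin : linear (fun x => ker_intro (e x)).
  move=> c x y; apply: ker_val_inj; rewrite ker_val_linear /= ghomD ghomZ rlin.
  by rewrite scalerBr opprD addrACA.
apply: (linear_term_type_surj (f := mklinear lin)) tX => x; exists (ker_val x).
by apply: ker_val_inj; rewrite /= ker_valP (linear_fun0 rlin) subr0.
Qed.
End Module.

Section Complex.
Variables (X Y : complex k J) (f : chain X Y).

Lemma ker_diff_closed n x : f n (ker_inc (f n) x) = 0 -> f (n + 1) (diff X n (ker_inc (f n) x)) = 0.
Proof. by move=> fx; rewrite cmap_diff fx ghom0. Qed.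

Definition ker_diff n : ghom (ker_mod (f n)) (ker_mod (f (n + 1))) :=
  ker_lift (u := comp (c := MOD k J) (diff X n) (ker_inc (f n)))
    (fun x => ker_diff_closed (ker_valP x)).

Lemma ker_diff_diff n x : ker_diff (n + 1) (ker_diff n x) = 0.
Proof. by apply: ker_val_inj; rewrite /= diff_diff. Qed.

Definition ker_complex : complex k J := Complex ker_diff_diff.

Definition ker_complex_inc : chain ker_complex X :=
  @Chain _ _ J ker_complex X (fun n => ker_inc (f n)) (fun n x => erefl).

Section Factor.
Variables (Z : complex k J) (u : chain Z X).
Hypothesis fu : forall n z, f n (u n z) = 0.

Lemma ker_complex_lift_diff n z :
  ker_lift (@fu (n + 1)) (diff Z n z) = diff ker_complex n (ker_lift (@fu n) z).
Proof. by apply: ker_val_inj; apply: (cmap_diff u). Qed.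

Definition ker_complex_lift : chain Z ker_complex :=
  @Chain _ _ J Z ker_complex (fun n => ker_lift (@fu n)) ker_complex_lift_diff.
End Factor.

(** The section [r] is only [k]-linear: as a [k]-module the kernel is a quotient
    of [X], and the term types only depend on the [k]-module. *)
Lemma ker_complex_in_C c (r : forall n, Y n -> X n) :
  (forall n, linear (r n)) -> (forall n y, f n (r n y) = y) -> in_C c X -> in_C c ker_complex.
Proof.
move=> rlin rP [tX bX]; split=> [n|]; first exact: (ker_term_type (rlin n)).
have ab : bounded_above X -> bounded_above ker_complex.
  by move=> [N NP]; exists N => n lt x; apply: ker_val_inj; rewrite [LHS]NP // -[RHS](NP n lt).
have be : bounded_below X -> bounded_below ker_complex.
  by move=> [N NP]; exists N => n lt x; apply: ker_val_inj; rewrite [LHS]NP // -[RHS](NP n lt).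
by case: c.2 bX => [|/ab|/be|[/ab ? /be ?]].
Qed.
End Complex.
End Kernel.

(** * Splitting the identity off a functor *)

Section Summand.
Variables (k : comPzRingType) (gT : finGroupType) (J : {group gT}).
Variables (c : term_type * bound_type) (h : homotopy_type) (V : gmod k J).
Let KJ := Kcat c h V.

(** The complement sends f to q F(f) i, where i is the inclusion of the kernel of p and q is 1 - s p
    with values in it. Since p and s are natural as chain maps, so is q; the functor laws of F, and
    hence of the complement, hold modulo [hequiv]. *)
Lemma split_functor_summand (F : functor KJ KJ)
    (p : forall X : KJ, chain (sval (F X)) (sval X)) (s : forall X : KJ, chain (sval X) (sval (F
      X))) :
  (forall X n x, p X n (s X n x) = x) ->
  (forall (X Y : KJ) (f : hom X Y) n z,
     p Y n ((fmap F f : chain (sval (F X)) (sval (F Y))) n z) =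
     (f : chain (sval X) (sval Y)) n (p X n z)) ->
  (forall (X Y : KJ) (f : hom X Y) n z,
     (fmap F f : chain (sval (F X)) (sval (F Y))) n (s X n z) =
     s Y n ((f : chain (sval X) (sval Y)) n z)) ->
  exists F' : functor KJ KJ, naturally_iso F (sumF (idF _) F').
Proof.
move=> ps pN sN.
have inC X : in_C c (ker_complex (p X)).
  apply: (ker_complex_in_C (r := fun n => s X n)) (svalP (F X)) => n; last exact: ps.
  exact: gfun_linear.
pose ob X : KJ := exist _ (ker_complex (p X)) (inC X).
have qP X n z : p X n ((add_chain (idm (sval (F X) : CX k J))
    (opp_chain (comp (c := CX k J) (s X) (p X)))) n z) = 0.
  by rewrite ghomB /= ps subrr.
pose q X : chain (sval (F X)) (ker_complex (p X)) := ker_complex_lift (qP X).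
pose i X : chain (ker_complex (p X)) (sval (F X)) := ker_complex_inc (p X).
have iP X n (z : ker_complex (p X) n) : p X n (i X n z) = 0 := ker_valP z.
have qi X n (z : ker_complex (p X) n) : q X n (i X n z) = z.
  by apply: ker_val_inj; rewrite /= [p X n _]ker_valP ghom0 subr0.
have iq X n z : i X n (q X n z) = z - s X n (p X n z) by [].
pose map (X Y : KJ) (f : hom X Y) : chain (ker_complex (p X)) (ker_complex (p Y)) :=
  comp (c := CX k J) (q Y) (comp (c := CX k J) (fmap F f : chain (sval (F X)) (sval (F Y))) (i X)).
have mapE (X Y : KJ) (f : hom X Y) n z :
  map X Y f n z = q Y n ((fmap F f : chain (sval (F X)) (sval (F Y))) n (i X n z)) by [].
have qs X n x : q X n (s X n x) = 0.
  by apply: ker_val_inj; rewrite -[LHS]/(i X n (q X n (s X n x))) iq ps subrr.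
have qN (X Y : KJ) (f : hom X Y) n z :
    q Y n ((fmap F f : chain (sval (F X)) (sval (F Y))) n z) = map X Y f n (q X n z).
  by rewrite mapE iq !ghomB sN qs subr0.
have map_heq (X Y : KJ) (f g : hom X Y) : heq f g -> hequiv c h V (map X Y f) (map X Y g).
  move=> e; apply: hequiv_comp; first exact: hequiv_heq (heq_refl _).
  by apply: hequiv_comp; [exact: (fmap_heq F e)|exact: hequiv_heq (heq_refl _)].
have map_id (X : KJ) : hequiv c h V (map X X (idm X)) (idm (ob X)).
  apply: (hequiv_trans (g := comp (c := CX k J) (q X)
    (comp (c := CX k J) (idm (sval (F X) : CX k J)) (i X)))).
    apply: hequiv_comp; first exact: hequiv_heq (heq_refl _).
    by apply: hequiv_comp; [exact: (fmap_id F X)|exact: hequiv_heq (heq_refl _)].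
  by apply: hequiv_heq => n z; apply: qi.
have map_comp (X Y Z : KJ) (f : hom Y Z) (g : hom X Y) :
    hequiv c h V (map X Z (comp f g)) (comp (c := CX k J) (map Y Z f) (map X Y g)).
  apply: (hequiv_trans (g := comp (c := CX k J) (q Z) (comp (c := CX k J)
    (comp (c := CX k J) (fmap F f : chain (sval (F Y)) (sval (F Z)))
       (fmap F g : chain (sval (F X)) (sval (F Y)))) (i X)))).
    apply: hequiv_comp; first exact: hequiv_heq (heq_refl _).
    by apply: hequiv_comp; [exact: (fmap_comp F f g)|exact: hequiv_heq (heq_refl _)].
  apply: hequiv_heq => n z; rewrite -[LHS]/(q Z n ((fmap F f : chain (sval (F Y)) (sval (F Z))) n
    ((fmap F g : chain (sval (F X)) (sval (F Y))) n (i X n z)))).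
  by rewrite qN qN qi.
exists (@Functor KJ KJ ob map map_heq map_id map_comp).
pose F' := @Functor KJ KJ ob map map_heq map_id map_comp.
pose alpha X : hom (F X) (sumF (idF KJ) F' X) := cpair (p X) (q X).
have alphaN (X Y : KJ) (f : hom X Y) :
    heq (comp (alpha Y) (fmap F f)) (comp (fmap (sumF (idF KJ) F') f) (alpha X)).
  apply: hequiv_heq => n z; congr pair; [exact: pN|exact: qN].
exists (@NatTrans KJ KJ F (sumF (idF KJ) F') alpha alphaN) => X.
exists (add_chain (comp (c := CX k J) (s X) (cfst (sval X) (ker_complex (p X))))
  (comp (c := CX k J) (i X) (csnd (sval X) (ker_complex (p X))))).
split; apply: hequiv_heq => n.
  by move=> z; rewrite -[LHS]/(s X n (p X n z) + i X n (q X n z)) iq addrC subrK.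
move=> [x w]; rewrite -[LHS]/(p X n (s X n x + i X n w), q X n (s X n x + i X n w)).
by rewrite !ghomD ps iP qs qi addr0 add0r.
Qed.
End Summand.

(** * Mackey's formula *)

Section Biproduct.
Variables (k : comPzRingType) (gT : finGroupType) (J : {group gT}).
Variables (c : term_type * bound_type) (h : homotopy_type) (V : gmod k J).
Variables (D : category) (R : functor D (Kcat c h V)).
Variables (I : eqType) (F : I -> functor D (Kcat c h V)).
Variables (pr : forall i x, chain (sval (R x)) (sval (F i x))).
Variables (inj : forall i x, chain (sval (F i x)) (sval (R x))).

Local Notation "F ^m f" := (fmap F f : chain (sval (F _)) (sval (F _))) (at level 30).

Hypothesis prN : forall i (x y : D) (f : hom x y) n z,
  pr i y n ((R ^m f) n z) = (F i ^m f) n (pr i x n z).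
Hypothesis pr_inj : forall i x n z, pr i x n (inj i x n z) = z.
Hypothesis pr_inj0 : forall i j x n z, i != j -> pr i x n (inj j x n z) = 0.

(** The last clause is what makes the induction run: a summand outside the list is orthogonal to the
    partial sum already built, so it can be added to it. *)
Lemma big_sum_biproduct (s : seq I) : uniq s ->
  exists (a : forall x, chain (sval (R x)) (sval ((\big[@sumF k gT J c h V D/zeroF c h V D]_(i
    <- s) F i) x)))
         (b : forall x, chain (sval ((\big[@sumF k gT J c h V D/zeroF c h V D]_(i <- s) F i) x))
           (sval (R x))),
  [/\ forall (x y : D) (f : hom x y) n z,
        a y n ((R ^m f) n z) = ((\big[@sumF k gT J c h V D/zeroF c h V D]_(i <- s) F i) ^m f) n
          (a x n z),
      forall x n z, b x n (a x n z) = \sum_(i <- s) inj i x n (pr i x n z),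
      forall x n w, a x n (b x n w) = w
    & forall j x n, j \notin s -> (forall z, a x n (inj j x n z) = 0) /\
        forall w, pr j x n (b x n w) = 0].
Proof.
elim: s => [_|i s IH].
  rewrite big_nil; exists (fun x => zero_chain _ _), (fun x => zero_chain _ _); split=> //.
  - by move=> x n z; rewrite big_nil.
  - by move=> x n w; rewrite (zmodule0 w).
  - by move=> j x n _; split=> // w; rewrite ghom0.
case/andP=> nis /IH{IH}; rewrite big_cons.
move: (\big[_/_]_(j <- s) _) => B [a [b [aN ba ab ab0]]].
exists (fun x => cpair (pr i x) (a x)).
exists (fun x => add_chain (comp (c := CX k J) (inj i x) (cfst _ _)) (comp (c := CX k J) (b x)
  (csnd _ _))).
split.
- by move=> x y f n z; congr pair; [apply: prN|apply: aN].
- by move=> x n z; rewrite big_cons -ba.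
- move=> x n [z w]; have [a0 p0] := ab0 i x n nis.
  rewrite -[LHS]/(pr i x n (inj i x n z + b x n w), a x n (inj i x n z + b x n w)).
  by rewrite !ghomD pr_inj ab a0 p0 addr0 add0r.
- move=> j x n; rewrite inE negb_or => /andP[ji js]; have [a0 p0] := ab0 j x n js.
  split=> [z|[z w]].
    rewrite -[LHS]/(pr i x n (inj j x n z), a x n (inj j x n z)) a0 pr_inj0 //.
    by rewrite eq_sym.
  rewrite -[LHS]/(pr j x n (inj i x n z + b x n w)) ghomD p0 addr0.
  by rewrite pr_inj0.
Qed.

Lemma big_sum_iso (s : seq I) : uniq s ->
  (forall x n z, \sum_(i <- s) inj i x n (pr i x n z) = z) ->
  naturally_iso R (\big[@sumF k gT J c h V D/zeroF c h V D]_(i <- s) F i).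
Proof.
move=> us sum1; have [a [b [aN ba ab _]]] := big_sum_biproduct us.
set B := \big[_/_]_(i <- s) F i in a b aN ba ab *.
have aK (x y : D) (f : hom x y) :
    heq (comp (c := Kcat c h V) (a y) (fmap R f)) (comp (c := Kcat c h V) (fmap B f) (a x)).
  by apply: hequiv_heq => n z; apply: aN.
exists (@NatTrans D (Kcat c h V) R B a aK) => x.
exists (b x); split; apply: hequiv_heq => n z; last exact: ab.
by rewrite -[LHS]/(b x n (a x n z)) ba sum1.
Qed.
End Biproduct.

(** * The contribution of one double coset *)

Section Mackey.
Variables (k : comPzRingType) (gT : finGroupType) (G H K : {group gT}).
Hypotheses (sHG : H \subset G) (sKG : K \subset G).

Section OneCoset.
Variables (t : gT) (tG : t \in G).
Let L : {group gT} := (K :&: H :^ t^-1)%G.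
Let sLK : L \subset K := subsetIl K (H :^ t^-1)%g.
Let cX (X : gmod k H) : gmod k L :=
  conj_mod (conj_double_coset K H t) (res (subsetIr (K :^ t)%g H) X).

Lemma mem_double_coset_stab g : g \in K -> (g \in L) = ((g ^ t)%g \in H).
Proof. by move=> gK; rewrite inE gK mem_conjgV. Qed.

Section OneModule.
Variable X : gmod k H.

Lemma mackey_coind (z : res sKG (ind G X)) :
  coind_fun K (X := cX X) (fun r => ind_coord sHG X (r * t)%g z).
Proof.
move=> r s rK sL; have sK := subsetP sLK _ sL.
have -> : (r * s * t = (r * t) * (s ^ t))%g by rewrite conjgE !mulgA mulgK.
rewrite ind_coordM -?mem_double_coset_stab //.
by rewrite -[RHS]/(@act _ _ H X (s^-1 ^ t)%g _) conjVg.
Qed.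

(** Restriction of z, as a function on G, to the translate Kt. Its values there determine z on KtH,
    and those at r t and r s t with s in L differ by the conjugated action of s^-1. *)
Definition mackey_pr_fun (z : res sKG (ind G X)) : ind K (cX X) :=
  coind K (X := cX X) (fun r => ind_coord sHG X (r * t)%g z).

Lemma mackey_pr_linear : linear mackey_pr_fun.
Proof.
move=> c x y; apply: (@ind_coord_inj _ _ _ _ sLK (cX X)) => g gK.
rewrite (linearP (ind_coord sLK _ g)) !ind_coord_coind //; try exact: mackey_coind.
exact: linearP.
Qed.

Lemma mackey_pr_act u z : u \in K -> mackey_pr_fun (act u z) = act u (mackey_pr_fun z).
Proof.
move=> uK; rewrite (act_coind sLK) //; last exact: mackey_coind.
apply: eq_coset_sum => // g gK; congr ind_gen.
rewrite -[act u z]/(@act _ _ G (ind G X) u z) ind_coord_act ?(subsetP sKG) //.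
by rewrite mulgA.
Qed.

Definition mackey_pr : ghom (res sKG (ind G X)) (ind K (cX X)) :=
  Ghom mackey_pr_linear mackey_pr_act.

Definition mackey_inj_fun (x : cX X) : res sLK (res sKG (ind G X)) := ind_gen G (X := X) t x.

Lemma mackey_inj_linear : linear mackey_inj_fun.
Proof. exact: (@ind_gen_linear _ _ G H X t). Qed.

Lemma mackey_inj_act s x : s \in L -> mackey_inj_fun (act s x) = act s (mackey_inj_fun x).
Proof.
move=> sL; have sK := subsetP sLK _ sL; have sG := subsetP sKG _ sK.
rewrite -[RHS]/(@act _ _ G (ind G X) s (ind_gen G (X := X) t x)) act_ind_gen //.
rewrite -[LHS]/(ind_gen G (X := X) t (@act _ _ H X (s ^ t)%g x)) ind_gen_act //.
  by rewrite conjgE !mulgA mulgV mul1g.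
by rewrite -mem_double_coset_stab.
Qed.

Definition mackey_inj : ghom (ind K (cX X)) (res sKG (ind G X)) :=
  ind_lift (sHG := sLK) (Ghom mackey_inj_linear mackey_inj_act).

Lemma mackey_inj_gen r x : r \in K ->
  mackey_inj (ind_gen K (X := cX X) r x) = ind_gen G (X := X) (r * t)%g x.
Proof.
move=> rK; rewrite [LHS]ind_liftE //.
rewrite -[LHS]/(@act _ _ G (ind G X) r (ind_gen G (X := X) t x)) act_ind_gen //.
exact: subsetP sKG _ rK.
Qed.

Lemma mackey_pr_inj z : mackey_pr (mackey_inj z) = z.
Proof.
move: z; apply: (ind_ext_gen (f := mackey_pr \o mackey_inj) (f' := idfun)) => r x rK.
rewrite -[LHS]/(mackey_pr (mackey_inj (ind_gen K (X := cX X) r x))) mackey_inj_gen //.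
apply: (@ind_coord_inj _ _ _ _ sLK (cX X)) => s sK.
rewrite ind_coord_coind //; last exact: mackey_coind.
have rtG : (r * t)%g \in G by rewrite groupM // (subsetP sKG).
rewrite !ind_coord_gen //.
have -> : ((s * t)^-1 * (r * t) = (s^-1 * r) ^ t)%g by rewrite invMg conjgE !mulgA.
by rewrite -mem_double_coset_stab // groupM ?groupV.
Qed.
End OneModule.

Lemma mackey_pr_natural (X Y : gmod k H) (f : ghom X Y) (z : res sKG (ind G X)) :
  mackey_pr Y (ind_map G f z) =
  ind_map K (fmap (ConjM k (conj_double_coset K H t)) (fmap (ResM k (subsetIr (K :^ t)%g H)) f))
    (mackey_pr X z).
Proof.
rewrite ind_map_coind; apply: eq_coset_sum => // r rK; congr ind_gen.
exact: (ind_coord_map sHG f (r * t)%g z).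
Qed.

Lemma mackey_inj_natural (X Y : gmod k H) (f : ghom X Y) (z : ind K (cX X)) :
  mackey_inj Y
    (ind_map K (fmap (ConjM k (conj_double_coset K H t)) (fmap (ResM k (subsetIr (K :^ t)%g H))
      f)) z) =
  ind_map G f (mackey_inj X z).
Proof.
pose u := fmap (ConjM k (conj_double_coset K H t)) (fmap (ResM k (subsetIr (K :^ t)%g H)) f).
move: z; apply: (ind_ext_gen (f := mackey_inj Y \o ind_map K u)
  (f' := ind_map_lin G f \o mackey_inj X)) => r x rK.
rewrite -[LHS]/(mackey_inj Y (ind_map K u (ind_gen K (X := cX X) r x))).
rewrite -[RHS]/(ind_map G f (mackey_inj X (ind_gen K (X := cX X) r x))).
by rewrite ind_map_gen !mackey_inj_gen // ind_map_gen.
Qed.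
End OneCoset.

Lemma mackey_pr_inj0 (X : gmod k H) t u (tG : t \in G) z :
  (forall r s h, r \in K -> s \in K -> h \in H -> (r * t)%g <> (s * u * h)%g) ->
  mackey_pr u X (mackey_inj tG X z) = 0.
Proof.
move=> disj; move: z.
apply: (ind_ext_gen (f := mackey_pr u X \o mackey_inj tG X) (f' := \0)) => r x rK.
rewrite -[LHS]/(mackey_pr u X (mackey_inj tG X (ind_gen K r x))) mackey_inj_gen //.
apply: big1 => C /(repr_lcosets (subsetIl K _))[rC _].
have rtG : (r * t)%g \in G by rewrite groupM // (subsetP sKG).
rewrite ind_coord_gen //; case: ifP => [iH|_]; last exact: linear0.
by case: (disj r (repr C) _ rK rC iH); rewrite mulgA mulgV mul1g.
Qed.
End Mackey.

(** The two modules differ only in their proofs of [actM]. The formula restricts V in two steps,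
    through K or H, whereas conjugation by t compares restrictions made directly from G. *)
Lemma res_res (k : comPzRingType) (gT : finGroupType) (L H G : {group gT})
    (sLH : L \subset H) (sHG : H \subset G) (sLG : L \subset G) (V : gmod k G) :
  res sLH (res sHG V) = res sLG V.
Proof. by rewrite /res; congr Gmod; apply: Prop_irrelevance. Qed.

(** * The sum over a transversal of the double cosets *)

Section MackeyFormula.
Variables (k : comPzRingType) (gT : finGroupType) (G H K : {group gT}).
Hypotheses (sHG : H \subset G) (sKG : K \subset G).
Variable T : {set gT}.
Hypothesis Ttrans : is_transversal T (double_cosets K G H) G.

Lemma mem_double_coset g x : reflect (exists r h, [/\ r \in K, h \in H & x = r * g * h]%g)
  (x \in (K :* g * H)%g).
Proof.
apply: (iffP mulsgP) => [[y h /rcosetP[r rK ->] hH ->]|[r [h [rK hH ->]]]].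
  by exists r, h.
by exists (r * g)%g h => //; apply/rcosetP; exists r.
Qed.

Lemma transversal_in_group t : t \in T -> t \in G.
Proof. by case/and3P: Ttrans => _ /subsetP sT _; apply: sT. Qed.

Lemma transversal_card g : g \in G -> #|T :&: (K :* g * H)%g| = 1%N.
Proof.
by move=> gG; case/and3P: Ttrans => _ _ /forall_inP h; apply/eqP/h/imset_f.
Qed.

Lemma transversal_ex g : g \in G ->
  exists t r h, [/\ t \in T, r \in K, h \in H & g = (r * t * h)%g].
Proof.
move=> gG; have /eqP/cards1P[t e] := transversal_card gG.
have : t \in T :&: (K :* g * H)%g by rewrite e set11.
rewrite inE => /andP[tT /mem_double_coset[r [h [rK hH et]]]].
exists t, r^-1%g, h^-1%g; rewrite !groupV; split=> //.
by rewrite et -!mulgA mulgV mulg1 mulKg.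
Qed.

Lemma transversal_uniq t u r s h : t \in T -> u \in T -> r \in K -> s \in K -> h \in H ->
  (r * t)%g = (s * u * h)%g -> t = u.
Proof.
move=> tT uT rK sK hH e; have /eqP/cards1P[v ev] := transversal_card (transversal_in_group uT).
have inv x : x \in T -> x \in (K :* u * H)%g -> x = v.
  by move=> xT xD; apply/set1P; rewrite -ev inE xT.
apply: etrans (inv t tT _) (esym (inv u uT _)); apply/mem_double_coset.
  exists (r^-1 * s)%g, h; split=> //; first by rewrite groupM ?groupV.
  by rewrite -[t](mulKg r) e !mulgA.
by exists 1%g, 1%g; rewrite !group1 mul1g mulg1.
Qed.

Variables (c : term_type * bound_type) (h : homotopy_type) (V : gmod k G).
Let VK := res sKG V.
Let VH := res sHG V.
Let Vl (t : gT) := res (subsetIl K (H :^ t^-1)%g) VK.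
Let Vr (t : gT) := res (subsetIr (K :^ t)%g H) VH.

Lemma Conj_double_coset_induces t : t \in G ->
  induces c h (Vr t) (Vl t) (Conj k (conj_double_coset K H t)).
Proof.
move=> tG; have sl : (K :&: H :^ t^-1)%G \subset G := subset_trans (subsetIl _ _) sKG.
have sr : (K :^ t :&: H)%G \subset G := subset_trans (subsetIr _ _) sHG.
have := Conj_induces c h sr sl tG (conj_double_coset K H t) V.
rewrite -(res_res (subsetIl K (H :^ t^-1)%g) sKG sl).
by rewrite -(res_res (subsetIr (K :^ t)%g H) sHG sr).
Qed.

Lemma mackey_orthogonal (t u : {t | t \in T}) (X : gmod k H) z : t != u ->
  mackey_pr sHG sKG (val t) X (mackey_inj sHG sKG (transversal_in_group (valP u)) X z) = 0.
Proof.
move=> tu.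
apply: (mackey_pr_inj0 sHG sKG (u := val t) (transversal_in_group (valP u)) z).
move=> r s y rK sK yH e; case/negP: tu; apply/eqP/val_inj/esym.
exact: transversal_uniq (valP u) (valP t) rK sK yH e.
Qed.

Lemma mackey_sum (X : gmod k H) (z : ind G X) :
  \sum_(t : {t | t \in T})
     mackey_inj sHG sKG (transversal_in_group (valP t)) X (mackey_pr sHG sKG (val t) X z) = z.
Proof.
have lin : linear (fun z : ind_car G X => \sum_(t : {t | t \in T})
    (mackey_inj sHG sKG (transversal_in_group (valP t)) X (mackey_pr sHG sKG (val t) X z)
      : ind_car G X)).
  move=> a x y; rewrite scaler_sumr -big_split; apply: eq_bigr => t _.
  by rewrite !ghomD !ghomZ.
move: z; apply: (ind_ext_gen (f := mklinear lin) (f' := idfun)) => g x gG.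
rewrite -[LHS]/(\sum_(t : {t | t \in T})
  mackey_inj sHG sKG (transversal_in_group (valP t)) X (mackey_pr sHG sKG (val t) X (ind_gen G g
    x))).
rewrite -[RHS]/(ind_gen G g x).
have [t [r [y [tT rK yH ->]]]] := transversal_ex gG.
have rtG : (r * t)%g \in G by rewrite groupM ?(transversal_in_group tT) // (subsetP sKG).
(* Moving y into the module leaves r t (x) y x, the image of r (x) y x under the injection of the
   coset of t; the other projections kill it. *)
rewrite -ind_gen_act //.
pose tt : {t | t \in T} := exist _ t tT.
have <- := mackey_inj_gen sHG sKG (transversal_in_group (valP tt)) (act y x) rK.
rewrite (bigD1 tt) // mackey_pr_inj big1 => [|u ut]; first exact: addr0.
by rewrite mackey_orthogonal // linear0.
Qed.

Section Formula.
Variables (iInd : induces c h VH V (Ind k G H)) (iResK : induces c h V VK (Res k sKG)).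
Variable iRest : forall t : {t | t \in T},
  induces c h VH (Vr (val t)) (Res k (subsetIr (K :^ val t)%g H)).
Variable iConj : forall t : {t | t \in T},
  induces c h (Vr (val t)) (Vl (val t)) (Conj k (conj_double_coset K H (val t))).
Variable iIndt : forall t : {t | t \in T},
  induces c h (Vl (val t)) VK (Ind k K (K :&: H :^ (val t)^-1)%G).

Let F (t : {t | t \in T}) : functor (Kcat c h VH) (Kcat c h VK) :=
  compF (Kfunctor (iIndt t)) (compF (Kfunctor (iConj t)) (Kfunctor (iRest t))).
Let R : functor (Kcat c h VH) (Kcat c h VK) := compF (Kfunctor iResK) (Kfunctor iInd).

Definition mackey_pr_chain t (X : Kcat c h VH) : chain (sval (R X)) (sval (F t X)) :=
  @Chain _ _ K (sval (R X)) (sval (F t X))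
    (fun n => mackey_pr sHG sKG (val t) (sval X n))
    (fun n => mackey_pr_natural sHG (sKG := sKG) (val t) (diff (sval X) n)).

Definition mackey_inj_chain t (X : Kcat c h VH) : chain (sval (F t X)) (sval (R X)) :=
  @Chain _ _ K (sval (F t X)) (sval (R X))
    (fun n => mackey_inj sHG sKG (transversal_in_group (valP t)) (sval X n))
    (fun n => mackey_inj_natural sHG sKG (transversal_in_group (valP t)) (diff (sval X) n)).

Lemma mackey_iso : naturally_iso R
  (\big[@sumF k gT K c h VK _ / zeroF c h VK _]_(t : {t | t \in T}) F t).
Proof.
apply: (@big_sum_iso k gT K c h VK _ R _ F mackey_pr_chain mackey_inj_chain).
- by move=> t X Y f n z; apply: (mackey_pr_natural sHG (sKG := sKG) (val t)).
- by move=> t X n z; apply: mackey_pr_inj.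
- by move=> t u X n z tu; apply: mackey_orthogonal.
- exact: index_enum_uniq.
- by move=> X n z; apply: mackey_sum.
Qed.
End Formula.
End MackeyFormula.

(** * A criterion for projectivity *)

Section BilinearLift.
Variables (k : comPzRingType) (gT : finGroupType) (J : {group gT}).
Variables V X : gmod k J.

Lemma vpure_linl (x : X) : linear (fun v : V => vpure v x).
Proof. exact: pure_linl. Qed.
Lemma vpure_linr (v : V) : linear (fun x : X => vpure v x).
Proof. exact: pure_linr. Qed.

Lemma act_vpure g (v : V) (x : X) : act g (vpure v x) = vpure (act g v) (act g x).
Proof. exact: (dt_actE (M := fun _ : unit => V) (N := fun _ : unit => X) g). Qed.

Section Lift.
Variables (P : lmodType k) (b : V -> X -> P).
Hypotheses (b1 : forall x, linear (b^~ x)) (b2 : forall v, linear (b v)).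

Lemma vlift_balanced : balanced (no_op (fun _ : unit => V)) (no_op (fun _ : unit => X)) (fun _
  => b).
Proof. by split=> // a []. Qed.

Definition vlift : {linear vtens V X -> P} := tlift vlift_balanced.

Lemma vliftE v x : vlift (vpure v x) = b v x.
Proof. exact: tlift_pure. Qed.
End Lift.

Section LiftHom.
Variables (Y : gmod k J) (b : V -> X -> Y).
Hypotheses (b1 : forall x, linear (b^~ x)) (b2 : forall v, linear (b v)).
Hypothesis bA : forall g v x, g \in J -> b (act g v) (act g x) = act g (b v x).

Lemma vlift_act g w : g \in J -> vlift b1 b2 (act g w) = act g (vlift b1 b2 w).
Proof.
move=> gJ; move: w; apply: (vtens_ext (f := vlift b1 b2 \o @act _ _ J (vtens V X) g)
  (g := @act _ _ J Y g \o vlift b1 b2)) => v x.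
rewrite -[LHS]/(vlift b1 b2 (act g (vpure v x))) act_vpure vliftE bA //.
by rewrite -[RHS]/(act g (vlift b1 b2 (vpure v x))) vliftE.
Qed.

Definition vlift_hom : ghom (vtens V X) Y :=
  @Ghom _ _ J (vtens V X) Y (vlift b1 b2) (fun c x y => linearP (vlift b1 b2) c x y) vlift_act.

Lemma vlift_homE v x : vlift_hom (vpure v x) = b v x.
Proof. exact: vliftE. Qed.
End LiftHom.
End BilinearLift.

(** * Matrices under conjugation: trace, product, Casimir element *)

Section MatrixModule.
Variables (k : comPzRingType) (gT : finGroupType) (J : {group gT}).

(** Only the matrices of V in a basis enter the criterion. In this form V, k and 0 are instances of
    one structure, and trace and matrix units are explicit. *)
Record matrix_rep := MatrixRep {
  rdim : nat;
  rho :> gT -> 'M[k]_rdim;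
  rho1 : rho 1%g = 1%:M;
  rhoM : forall g h, g \in J -> h \in J -> rho (g * h)%g = rho g *m rho h }.

Variable r : matrix_rep.
Local Notation n := (rdim r).

Lemma rhoVr g : g \in J -> r g *m r g^-1%g = 1%:M.
Proof. by move=> gJ; rewrite -rhoM ?groupV // mulgV rho1. Qed.
Lemma rhoVl g : g \in J -> r g^-1%g *m r g = 1%:M.
Proof. by move=> gJ; rewrite -rhoM ?groupV // mulVg rho1. Qed.

Definition mx_act (g : gT) (m : 'M[k]_n) : 'M[k]_n := r g *m m *m r g^-1%g.

Lemma mx_act_linear g : linear (mx_act g).
Proof. by move=> c x y; rewrite /mx_act mulmxDr mulmxDl -scalemxAr -scalemxAl. Qed.
Lemma mx_act1 m : mx_act 1%g m = m.
Proof. by rewrite /mx_act invg1 rho1 mul1mx mulmx1. Qed.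
Lemma mx_actM g h m : g \in J -> h \in J -> mx_act (g * h)%g m = mx_act g (mx_act h m).
Proof. by move=> gJ hJ; rewrite /mx_act invMg !rhoM ?groupV // !mulmxA. Qed.

Lemma mx_act_mul g m m' : g \in J -> mx_act g m *m mx_act g m' = mx_act g (m *m m').
Proof.
move=> gJ; rewrite /mx_act -!mulmxA; congr (_ *m (_ *m _)).
by rewrite mulmxA rhoVl // mul1mx.
Qed.

(** [End_k(V)] when [r] is the matrix form of [V] *)
Definition mx_mod : gmod k J := Gmod mx_act_linear mx_act1 mx_actM.
Local Notation E := mx_mod.

Section OneModule.
Variable X : gmod k J.

Lemma mx_trace_linl (x : X) : linear (fun m : E => \tr m *: x).
Proof. by move=> c a b; rewrite linearP scalerDl scalerA. Qed.
Lemma mx_trace_linr (m : E) : linear (fun x : X => \tr m *: x).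
Proof. by move=> c a b; rewrite scalerDr !scalerA mulrC. Qed.
Lemma mx_trace_act g (m : E) (x : X) : g \in J -> \tr (act g m) *: act g x = act g (\tr m *: x).
Proof.
by move=> gJ; rewrite actZ /= /mx_act mxtrace_mulC mulmxA rhoVl // mul1mx.
Qed.

Definition mx_trace : ghom (vtens E X) X := vlift_hom mx_trace_linl mx_trace_linr mx_trace_act.

Lemma mx_traceE (m : E) x : mx_trace (vpure m x) = \tr m *: x.
Proof. exact: vlift_homE. Qed.

Lemma mx_mul1_linl (m : E) (x : X) : linear (fun m' : E => vpure (m *m m' : E) x).
Proof. by move=> c a b; rewrite mulmxDr -scalemxAr vpure_linl. Qed.
Lemma mx_mul1_linr (m m' : E) : linear (fun x : X => vpure (m *m m' : E) x).
Proof. exact: vpure_linr. Qed.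

Definition mx_mul1 (m : E) : {linear vtens E X -> vtens E X} :=
  vlift (mx_mul1_linl m) (mx_mul1_linr m).

Lemma mx_mul1E (m m' : E) x : mx_mul1 m (vpure m' x) = vpure (m *m m' : E) x.
Proof. exact: vliftE. Qed.

Lemma mx_mul_linl w : linear (mx_mul1^~ w).
Proof.
move=> c a b; move: w; apply: (vtens_ext (f := mx_mul1 (c *: a + b))
  (g := c \*: mx_mul1 a \+ mx_mul1 b)) => m x.
rewrite -[RHS]/(c *: mx_mul1 a (vpure m x) + mx_mul1 b (vpure m x)) !mx_mul1E.
by rewrite mulmxDl -scalemxAl vpure_linl.
Qed.

Lemma mx_mul_act g (m : E) w : g \in J -> mx_mul1 (act g m) (act g w) = act g (mx_mul1 m w).
Proof.
move=> gJ; move: w; apply: (vtens_ext (f := mx_mul1 (act g m) \o @act _ _ J (vtens E X) g)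
  (g := @act _ _ J (vtens E X) g \o mx_mul1 m)) => m' x.
rewrite -[LHS]/(mx_mul1 (act g m) (act g (vpure m' x))).
rewrite -[RHS]/(act g (mx_mul1 m (vpure m' x))) act_vpure !mx_mul1E act_vpure.
by congr vpure; apply: mx_act_mul.
Qed.

Definition mx_mul : ghom (vtens E (vtens E X)) (vtens E X) :=
  vlift_hom mx_mul_linl (fun m c x y => linearP (mx_mul1 m) c x y) mx_mul_act.

Lemma mx_mulE (m : E) w : mx_mul (vpure m w) = mx_mul1 m w.
Proof. exact: vlift_homE. Qed.


(** The Casimir element commutes with matrices: left multiplication of its first factor equals right
    multiplication of its second. An arbitrary bilinear b allows further multiplications to be
    carried along. *)
Lemma casimir_mul (P : lmodType k) (b : E -> E -> P) :
  (forall m, linear (b^~ m)) -> (forall m, linear (b m)) -> forall a : E,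
  \sum_i \sum_j b (a *m delta_mx i j) (delta_mx j i) =
  \sum_i \sum_j b (delta_mx i j) (delta_mx j i *m a).
Proof.
move=> b1 b2 a.
have e1 i j : b (a *m delta_mx i j) (delta_mx j i) =
    \sum_l a l i *: b (delta_mx l j) (delta_mx j i).
  pose f := mklinear (b1 (delta_mx j i)); rewrite -[LHS]/(f (a *m delta_mx i j)).
  have -> : a *m delta_mx i j = \sum_l a l i *: delta_mx l j :> E.
    rewrite {1}[a]matrix_sum_delta mulmx_suml; apply: eq_bigr => l _.
    rewrite mulmx_suml (bigD1 i) //= -scalemxAl mul_delta_mx [X in _ + X]big1 ?addr0 // => u ui.
    by rewrite -scalemxAl mul_delta_mx_0 // scaler0.
  by rewrite linear_sum; apply: eq_bigr => l _; rewrite linearZ.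
have e2 i j : b (delta_mx i j) (delta_mx j i *m a) =
    \sum_l a i l *: b (delta_mx i j) (delta_mx j l).
  pose f := mklinear (b2 (delta_mx i j)); rewrite -[LHS]/(f (delta_mx j i *m a)).
  have -> : delta_mx j i *m a = \sum_l a i l *: delta_mx j l :> E.
    rewrite {1}[a]matrix_sum_delta mulmx_sumr (bigD1 i) //= mulmx_sumr [X in _ + X]big1 ?addr0.
      by apply: eq_bigr => l _; rewrite -scalemxAr mul_delta_mx.
    move=> u ui; rewrite mulmx_sumr big1 // => l _.
    by rewrite -scalemxAr mul_delta_mx_0 ?scaler0 // eq_sym.
  by rewrite linear_sum; apply: eq_bigr => l _; rewrite linearZ.
under eq_bigr do under eq_bigr do rewrite e1.
under [RHS]eq_bigr do under eq_bigr do rewrite e2.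
under eq_bigr do rewrite exchange_big.
rewrite exchange_big; apply: eq_bigr => l _.
by rewrite exchange_big.
Qed.

Definition casimir_fun (x : X) : vtens E (vtens E X) :=
  \sum_i \sum_j vpure (delta_mx i j : E) (vpure (delta_mx j i : E) x).

Lemma casimir_linear : linear casimir_fun.
Proof.
move=> c x y; rewrite scaler_sumr -big_split; apply: eq_bigr => i _.
rewrite scaler_sumr -big_split; apply: eq_bigr => j _.
by rewrite !vpure_linr.
Qed.

Lemma casimir_act g x : g \in J -> casimir_fun (act g x) = act g (casimir_fun x).
Proof.
move=> gJ; pose A := r g; pose B := r g^-1%g.
have AB : A *m B = 1%:M := rhoVr gJ.
pose b1 (m m' : E) : vtens E (vtens E X) :=
  vpure (m *m B : E) (vpure (A *m m' *m B : E) (act g x)).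
have b1l m : linear (b1^~ m).
  by move=> c a b; rewrite /b1 mulmxDl -scalemxAl vpure_linl.
have b1r m : linear (b1 m).
  move=> c a b; rewrite /b1 mulmxDr mulmxDl -scalemxAr -scalemxAl.
  by rewrite vpure_linl vpure_linr.
pose b2 (m' m : E) : vtens E (vtens E X) := vpure m (vpure (A *m m' : E) (act g x)).
have b2l m : linear (b2^~ m).
  by move=> c a b; rewrite /b2 mulmxDr -scalemxAr vpure_linl vpure_linr.
have b2r m : linear (b2 m) by move=> c a b; rewrite /b2 vpure_linl.
(* Both conjugations are undone by two moves. First A passes from the first factor to the right end
   of the second, where it cancels B; then the B left in the first factor passes to the second,
   where it cancels the remaining A. *)
transitivity (\sum_i \sum_j b1 (A *m delta_mx i j) (delta_mx j i)); last first.
  rewrite linear_sum; apply: eq_bigr => i _; rewrite linear_sum; apply: eq_bigr => j _.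
  by rewrite /b1 -[RHS]/(act g (vpure (delta_mx i j : E) _)) !act_vpure.
rewrite casimir_mul //.
transitivity (\sum_i \sum_j b2 (delta_mx i j) (delta_mx j i *m B)); last first.
  rewrite exchange_big; apply: eq_bigr => i _; apply: eq_bigr => j _.
  by rewrite /b1 /b2 -!mulmxA AB mulmx1.
rewrite -casimir_mul // exchange_big; apply: eq_bigr => i _; apply: eq_bigr => j _.
by rewrite /b2 mulmxA AB mul1mx.
Qed.

Definition casimir : ghom X (vtens E (vtens E X)) := Ghom casimir_linear casimir_act.

(** Since e_ji has trace 1 for i = j and 0 otherwise, the Casimir element splits the trace in the
    sense of [mx_split]; this puts the trace cover in its class. *)
Lemma casimir_trace x : vmap E mx_trace (casimir x) = vpure (1%:M : E) x.
Proof.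
rewrite linear_sum mx1_sum_delta.
pose f := mklinear (@vpure_linl k gT J E X x); rewrite -[RHS]/(f _) linear_sum.
apply: eq_bigr => i _; rewrite linear_sum (bigD1 i) //= big1 => [|j ji].
  rewrite addr0 -[LHS]/(vmap E mx_trace (vpure (delta_mx i i : E) _)) vmapE mx_traceE.
  rewrite /mxtrace (bigD1 i) //= mxE !eqxx big1 ?addr0 ?scale1r // => j ji.
  by rewrite mxE (negPf ji).
rewrite -[LHS]/(vmap E mx_trace (vpure (delta_mx i j : E) _)) vmapE mx_traceE.
rewrite /mxtrace big1 ?scale0r => [|l _]; first exact: (linear_fun0 (@vpure_linr k gT J E X
  (delta_mx i j))).
rewrite mxE; case: eqVneq => //= ->.
by case: eqVneq => // e; rewrite e eqxx in ji.
Qed.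

Lemma mx_one_linear : linear (fun x : X => vpure (1%:M : E) x).
Proof. exact: vpure_linr. Qed.
Lemma mx_one_act g (x : X) : g \in J -> vpure (1%:M : E) (act g x) = act g (vpure (1%:M : E) x).
Proof. by move=> gJ; rewrite act_vpure /= /mx_act mulmx1 rhoVr. Qed.
Definition mx_one : ghom X (vtens E X) := Ghom mx_one_linear mx_one_act.

Lemma mx_mul_one w : mx_mul (vmap E mx_one w) = w.
Proof.
move: w; apply: (vtens_ext (f := mx_mul \o vmap E mx_one) (g := idfun)) => m x.
rewrite -[LHS]/(mx_mul (vmap E mx_one (vpure m x))) vmapE mx_mulE.
by rewrite -[mx_one x]/(vpure (1%:M : E) x) mx_mul1E mulmx1.
Qed.

Lemma mx_trace_one (x : X) : mx_trace (mx_one x) = (n%:R : k) *: x.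
Proof. by rewrite [LHS]mx_traceE mxtrace1. Qed.
End OneModule.

Section Naturality.
Variables (X Y : gmod k J) (f : ghom X Y).

Lemma mx_trace_natural w : mx_trace Y (vmap E f w) = f (mx_trace X w).
Proof.
move: w; apply: (vtens_ext (f := mx_trace Y \o vmap E f) (g := f \o mx_trace X)) => m x.
rewrite -[LHS]/(mx_trace Y (vmap E f (vpure m x))) -[RHS]/(f (mx_trace X (vpure m x))).
by rewrite vmapE !mx_traceE ghomZ.
Qed.

Lemma mx_mul1_natural m w : mx_mul1 Y m (vmap E f w) = vmap E f (mx_mul1 X m w).
Proof.
move: w; apply: (vtens_ext (f := mx_mul1 Y m \o vmap E f) (g := vmap E f \o mx_mul1 X m)) => m' x.
rewrite -[LHS]/(mx_mul1 Y m (vmap E f (vpure m' x))).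
rewrite -[RHS]/(vmap E f (mx_mul1 X m (vpure m' x))).
by rewrite vmapE !mx_mul1E vmapE.
Qed.

Lemma mx_mul_natural w : mx_mul Y (vmap E (vmap E f) w) = vmap E f (mx_mul X w).
Proof.
move: w; apply: (vtens_ext (f := mx_mul Y \o vmap E (vmap E f)) (g := vmap E f \o mx_mul X)) => m w.
rewrite -[LHS]/(mx_mul Y (vmap E (vmap E f) (vpure m w))).
rewrite -[RHS]/(vmap E f (mx_mul X (vpure m w))).
by rewrite vmapE !mx_mulE mx_mul1_natural.
Qed.

Lemma casimir_natural x : casimir Y (f x) = vmap E (vmap E f) (casimir X x).
Proof.
rewrite linear_sum; apply: eq_bigr => i _; rewrite linear_sum; apply: eq_bigr => j _.
rewrite -[RHS]/(vmap E (vmap E f) (vpure (delta_mx i j : E) (vpure (delta_mx j i : E) x))).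
by rewrite !vmapE.
Qed.

Lemma mx_one_natural x : mx_one Y (f x) = vmap E f (mx_one X x).
Proof. by rewrite -[mx_one X x]/(vpure _ x) vmapE. Qed.
End Naturality.
End MatrixModule.

(** * The four classes in terms of matrix modules *)

Section MatrixClasses.
Variables (k : comPzRingType) (gT : finGroupType) (J : {group gT}).

(** For [r] the matrix form of [V], a section of [V (x) p] amounts to such an [s],
    by the transposition [Hom(V (x) C, V (x) B) = Hom(C, End(V) (x) B)]. *)
Definition mx_split (r : matrix_rep k J) (E : cseq k J) : Prop :=
  exists s : chain (seqC E) (Tens_with (mx_mod r) (seqB E)),
    forall n z, vmap (mx_mod r) (seq_p E n) (s n z) = mx_one r _ z.

Definition mx_term_split (r : matrix_rep k J) (E : cseq k J) : Prop :=
  forall n, exists s : ghom (seqC E n) (vtens (mx_mod r) (seqB E n)),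
    forall z, vmap (mx_mod r) (seq_p E n) (s z) = mx_one r _ z.

(** For 0 x 0 matrices the identity matrix is 0, so both splitting conditions become void; for 1 x 1
    matrices with trivial action, the trace turns them into ordinary splitting. *)
Definition zero_rep : matrix_rep k J :=
  @MatrixRep k gT J 0 (fun=> 1%:M) erefl (fun _ _ _ _ => esym (mul1mx 1%:M)).
Definition triv_rep : matrix_rep k J :=
  @MatrixRep k gT J 1 (fun=> 1%:M) erefl (fun _ _ _ _ => esym (mul1mx 1%:M)).

Lemma zero_rep_one (X : gmod k J) (x : X) : mx_one zero_rep X x = 0.
Proof.
have e : (1%:M : mx_mod zero_rep) = 0 by apply: flatmx0.
by rewrite -[LHS]/(vpure (1%:M : mx_mod zero_rep) x) e (linear_fun0 (@vpure_linl _ _ _ _ X x)).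
Qed.

Lemma zero_rep_split E : mx_split zero_rep E.
Proof. by exists (zero_chain _ _) => n z; rewrite zero_rep_one ghom0. Qed.
Lemma zero_rep_term_split E : mx_term_split zero_rep E.
Proof. by move=> n; exists (zero_hom _ _) => z; rewrite zero_rep_one ghom0. Qed.

Lemma triv_rep_term_split E : mx_term_split triv_rep E <-> term_split E.
Proof.
split=> sE n; have [s sP] := sE n.
  exists (comp (c := MOD k J) (mx_trace triv_rep _) s) => z.
  rewrite -[LHS]/(seq_p E n (mx_trace triv_rep _ (s z))) -mx_trace_natural sP mx_trace_one.
  exact: scale1r.
exists (comp (c := MOD k J) (mx_one triv_rep _) s) => z.
rewrite -[LHS]/(vmap _ (seq_p E n) (mx_one triv_rep _ (s z))).
by rewrite -mx_one_natural sP.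
Qed.

Section BasedModule.
Variables (V : gmod k J) (n : nat) (e : 'I_n -> V).
Hypothesis eP : forall v, exists! c : {ffun 'I_n -> k}, v = \sum_i c i *: e i.

Definition coords (v : V) : 'cV[k]_n := \col_i projT1 (cid (eP v)) i.
Definition of_coords (x : 'cV[k]_n) : V := \sum_i x i 0 *: e i.

Lemma coordsK v : of_coords (coords v) = v.
Proof.
rewrite /of_coords /coords; case: cid => c /= [{2}-> _].
by apply: eq_bigr => i _; rewrite mxE.
Qed.

Lemma of_coordsK x : coords (of_coords x) = x.
Proof.
apply/colP => i; rewrite mxE; case: cid => c /= [_ /(_ [ffun j => x j 0])].
move=> -> //; first by rewrite ffunE.
by apply: eq_bigr => j _; rewrite ffunE.
Qed.

Lemma of_coords_linear : linear of_coords.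
Proof.
move=> c x y; rewrite scaler_sumr -big_split; apply: eq_bigr => i _.
by rewrite !mxE scalerDl scalerA.
Qed.

Lemma coords_linear : linear coords.
Proof.
move=> c v w; rewrite -[in LHS](coordsK v) -[in LHS](coordsK w).
by rewrite -of_coords_linear of_coordsK.
Qed.

Lemma coords_basis j : coords (e j) = delta_mx j 0.
Proof.
rewrite -[RHS]of_coordsK; congr coords; rewrite /of_coords (bigD1 j) //= mxE !eqxx scale1r.
by rewrite big1 ?addr0 // => i ij; rewrite mxE (negPf ij) scale0r.
Qed.

Definition based_mx (g : gT) : 'M[k]_n := \matrix_(i, j) coords (act g (e j)) i 0.

Lemma coords_act g v : coords (act g v) = based_mx g *m coords v.
Proof.
pose f := mklinear coords_linear.
rewrite -{1}(coordsK v) /of_coords linear_sum -[LHS]/(f _) linear_sum.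
have fE j : f (act g (coords v j 0 *: e j)) = coords v j 0 *: coords (act g (e j)).
  by rewrite actZ linearZ.
apply/colP => i; rewrite summxE [RHS]mxE; apply: eq_bigr => j _.
by rewrite fE [LHS]mxE [based_mx g i j]mxE mulrC.
Qed.

Lemma based_mx1 : based_mx 1%g = 1%:M.
Proof.
by apply/matrixP => i j; rewrite [LHS]mxE act1 coords_basis !mxE eqxx andbT.
Qed.

Lemma based_mxM g h : g \in J -> h \in J -> based_mx (g * h)%g = based_mx g *m based_mx h.
Proof.
move=> gJ hJ; apply/matrixP => i j; rewrite [LHS]mxE actM // coords_act !mxE.
by apply: eq_bigr => l _; rewrite [based_mx h l j]mxE.
Qed.

Definition based_rep : matrix_rep k J := MatrixRep based_mx1 based_mxM.
Local Notation E := (mx_mod based_rep).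

Lemma of_coords_act g x : g \in J -> act g (of_coords x) = of_coords (based_mx g *m x).
Proof. by move=> gJ; rewrite -[LHS]coordsK coords_act of_coordsK. Qed.

Section Column.
Variable X : gmod k J.

Lemma to_column_linl j (x : X) : linear (fun v : V => vpure (coords v *m delta_mx 0 j : E) x).
Proof. by move=> c a b; rewrite coords_linear mulmxDl -scalemxAl vpure_linl. Qed.
Lemma to_column_linr j (v : V) : linear (fun x : X => vpure (coords v *m delta_mx 0 j : E) x).
Proof. exact: vpure_linr. Qed.

Definition to_column j : {linear vtens V X -> vtens E X} :=
  vlift (to_column_linl j) (to_column_linr j).

Lemma to_columnE j v x : to_column j (vpure v x) = vpure (coords v *m delta_mx 0 j : E) x.
Proof. exact: vliftE. Qed.

Lemma mx_apply_linl (v : V) (x : X) : linear (fun m : E => vpure (of_coords (m *m coords v)) x).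
Proof.
by move=> c a b; rewrite mulmxDl -scalemxAl of_coords_linear vpure_linl.
Qed.
Lemma mx_apply_linr (v : V) (m : E) : linear (fun x : X => vpure (of_coords (m *m coords v)) x).
Proof. exact: vpure_linr. Qed.

Definition mx_apply (v : V) : {linear vtens E X -> vtens V X} :=
  vlift (mx_apply_linl v) (mx_apply_linr v).

Lemma mx_applyE v (m : E) x : mx_apply v (vpure m x) = vpure (of_coords (m *m coords v)) x.
Proof. exact: vliftE. Qed.

Lemma mx_apply_linear w : linear (mx_apply^~ w).
Proof.
move=> c a b; move: w; apply: (vtens_ext (f := mx_apply (c *: a + b))
  (g := c \*: mx_apply a \+ mx_apply b)) => m x.
rewrite -[RHS]/(c *: mx_apply a (vpure m x) + mx_apply b (vpure m x)) !mx_applyE.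
by rewrite coords_linear mulmxDr -scalemxAr of_coords_linear vpure_linl.
Qed.

Lemma mx_apply_act g v w : g \in J -> mx_apply (act g v) (act g w) = act g (mx_apply v w).
Proof.
move=> gJ; move: w; apply: (vtens_ext (f := mx_apply (act g v) \o @act _ _ J (vtens E X) g)
  (g := @act _ _ J (vtens V X) g \o mx_apply v)) => m x.
rewrite -[LHS]/(mx_apply (act g v) (act g (vpure m x))).
rewrite -[RHS]/(act g (mx_apply v (vpure m x))) act_vpure !mx_applyE act_vpure.
rewrite of_coords_act // coords_act; congr (vpure (of_coords _) _).
by rewrite -!mulmxA [based_mx g^-1%g *m _]mulmxA (rhoVl based_rep) // mul1mx.
Qed.
End Column.

Lemma to_column_natural (X Y : gmod k J) (f : ghom X Y) j w :
  to_column Y j (vmap V f w) = vmap E f (to_column X j w).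
Proof.
move: w; apply: (vtens_ext (f := to_column Y j \o vmap V f) (g := vmap E f \o to_column X j)) =>
  v x.
rewrite -[LHS]/(to_column Y j (vmap V f (vpure v x))).
rewrite -[RHS]/(vmap E f (to_column X j (vpure v x))).
by rewrite vmapE !to_columnE vmapE.
Qed.

Lemma mx_apply_natural (X Y : gmod k J) (f : ghom X Y) v w :
  mx_apply Y v (vmap E f w) = vmap V f (mx_apply X v w).
Proof.
move: w; apply: (vtens_ext (f := mx_apply Y v \o vmap E f) (g := vmap V f \o mx_apply X v)) => m x.
rewrite -[LHS]/(mx_apply Y v (vmap E f (vpure m x))).
rewrite -[RHS]/(vmap V f (mx_apply X v (vpure m x))).
by rewrite vmapE !mx_applyE vmapE.
Qed.

Section Transpose.
Variables (X Y : gmod k J).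

(** The matrix over Y whose j-th column is s (e_j (x) x). In the other direction, [untranspose]
    applies the matrix t(x) to the vector v. *)
Definition transpose_fun (s : ghom (vtens V X) (vtens V Y)) (x : X) : vtens E Y :=
  \sum_j to_column Y j (s (vpure (e j) x)).

Lemma transpose_linear s : linear (transpose_fun s).
Proof.
move=> c x y; rewrite scaler_sumr -big_split; apply: eq_bigr => j _.
by rewrite vpure_linr ghomD ghomZ linearP.
Qed.

Lemma transpose_sum_linear g l : linear (fun w : vtens V Y =>
  \sum_j based_mx g^-1%g l j *: to_column Y j (act g w)).
Proof.
move=> c x y; rewrite scaler_sumr -big_split; apply: eq_bigr => j _.
by rewrite actD actZ linearP scalerDr !scalerA mulrC.
Qed.

Lemma transpose_act s g x : g \in J -> transpose_fun s (act g x) = act g (transpose_fun s x).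
Proof.
move=> gJ.
(* Writing e_j as g (g^-1 e_j) and expanding g^-1 e_j in the basis produces the coefficients of the
   matrix of g^-1, which account for the right factor of the conjugation action. *)
have eV j : e j = act g (of_coords (based_mx g^-1%g *m delta_mx j 0)).
  by rewrite of_coords_act // mulmxA (rhoVr based_rep) // mul1mx -coords_basis coordsK.
have step j : to_column Y j (s (vpure (e j) (act g x))) =
   \sum_l based_mx g^-1%g l j *: to_column Y j (act g (s (vpure (e l) x))).
  rewrite eV -act_vpure gfun_act //.
  have lin : linear (fun v => to_column Y j (act g (s (vpure v x)))).
    by move=> c v w; rewrite vpure_linl ghomD ghomZ actD actZ linearP.
  pose f := mklinear lin; rewrite -[LHS]/(f _) linear_sum.
  by apply: eq_bigr => l _; rewrite linearZ -colE mxE.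
rewrite /transpose_fun linear_sum.
under eq_bigr do rewrite step.
rewrite exchange_big; apply: eq_bigr => l _.
move: (s (vpure (e l) x)) => w; apply: esym; move: w.
apply: (vtens_ext (f := @act _ _ J (vtens E Y) g \o to_column Y l)
  (g := mklinear (transpose_sum_linear g l))) => v y.
rewrite -[LHS]/(act g (to_column Y l (vpure v y))) to_columnE act_vpure.
rewrite -[RHS]/(\sum_j based_mx g^-1%g l j *: to_column Y j (act g (vpure v y))).
pose f := mklinear (@vpure_linl k gT J E Y (act g y)).
have -> : act g (coords v *m delta_mx 0 l : E) =
    \sum_j based_mx g^-1%g l j *: (coords (act g v) *m delta_mx 0 j) :> E.
  rewrite -[LHS]/(based_mx g *m (coords v *m delta_mx 0 l) *m based_mx g^-1%g).
  rewrite coords_act !mulmxA -[LHS]mulmxA -rowE.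
  rewrite [row l _]matrix_sum_delta big_ord1 mulmx_sumr; apply: eq_bigr => j _.
  by rewrite mxE -scalemxAr.
rewrite -[LHS]/(f _) linear_sum; apply: eq_bigr => j _.
by rewrite act_vpure to_columnE linearZ.
Qed.

Definition transpose s : ghom X (vtens E Y) := Ghom (transpose_linear s) (@transpose_act s).

Lemma untranspose_linl (t : ghom X (vtens E Y)) (x : X) : linear (fun v => mx_apply Y v (t x)).
Proof. by move=> c v w; rewrite mx_apply_linear. Qed.
Lemma untranspose_linr (t : ghom X (vtens E Y)) (v : V) : linear (fun x => mx_apply Y v (t x)).
Proof. by move=> c x y; rewrite ghomD ghomZ linearP. Qed.
Lemma untranspose_act (t : ghom X (vtens E Y)) g v x : g \in J ->
  mx_apply Y (act g v) (t (act g x)) = act g (mx_apply Y v (t x)).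
Proof. by move=> gJ; rewrite gfun_act // mx_apply_act. Qed.

Definition untranspose t : ghom (vtens V X) (vtens V Y) :=
  vlift_hom (untranspose_linl t) (untranspose_linr t) (@untranspose_act t).

Lemma untransposeE t v x : untranspose t (vpure v x) = mx_apply Y v (t x).
Proof. exact: vlift_homE. Qed.
End Transpose.

Lemma transposeP (X Y : gmod k J) (p : ghom Y X) (s : ghom (vtens V X) (vtens V Y)) :
  (forall w, vmap V p (s w) = w) -> forall x, vmap E p (transpose s x) = mx_one based_rep X x.
Proof.
move=> sP x; rewrite linear_sum.
pose f := mklinear (@vpure_linl k gT J E X x).
rewrite -[RHS]/(f _) mx1_sum_delta linear_sum; apply: eq_bigr => j _.
rewrite -[LHS]/(vmap E p (to_column Y j (s (vpure (e j) x)))) -to_column_natural sP.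
by rewrite to_columnE coords_basis mul_delta_mx.
Qed.

Lemma untransposeP (X Y : gmod k J) (p : ghom Y X) (t : ghom X (vtens E Y)) :
  (forall x, vmap E p (t x) = mx_one based_rep X x) -> forall w, vmap V p (untranspose t w) = w.
Proof.
move=> tP; apply: (vtens_ext (f := vmap V p \o untranspose t) (g := idfun)) => v x.
rewrite -[LHS]/(vmap V p (untranspose t (vpure v x))) untransposeE -mx_apply_natural tP.
by rewrite mx_applyE mul1mx coordsK.
Qed.

Lemma based_split (S : cseq k J) : split_seq (tensor_seq V S) <-> mx_split based_rep S.
Proof.
split=> [[s sP]|[t tP]].
  have td m x : transpose (s (m + 1)) (diff (seqC S) m x) =
      vmap E (diff (seqB S) m) (transpose (s m) x).
    rewrite linear_sum; apply: eq_bigr => j _.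
    rewrite -[RHS]/(vmap E (diff (seqB S) m) (to_column _ j (s m (vpure (e j) x)))).
    rewrite -to_column_natural; congr (to_column _ j _).
    by rewrite -(cmap_diff s) /= -[RHS]/(s _ (vmap V _ _)) vmapE.
  exists (@Chain _ _ J (seqC S) (Tens_with E (seqB S)) (fun m => transpose (s m)) td) => m z.
  exact: transposeP (sP m) z.
have ud m w : untranspose (t (m + 1)) (vmap V (diff (seqC S) m) w) =
    vmap V (diff (seqB S) m) (untranspose (t m) w).
  move: w; apply: (vtens_ext (f := untranspose (t (m + 1)) \o vmap V (diff (seqC S) m))
    (g := vmap V (diff (seqB S) m) \o untranspose (t m))) => v x.
  rewrite -[LHS]/(untranspose (t (m + 1)) (vmap V (diff (seqC S) m) (vpure v x))).
  rewrite -[RHS]/(vmap V (diff (seqB S) m) (untranspose (t m) (vpure v x))).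
  by rewrite vmapE !untransposeE -mx_apply_natural (cmap_diff t).
exists (@Chain _ _ J (Tens_with V (seqC S)) (Tens_with V (seqB S)) (fun m => untranspose (t m)) ud).
by move=> m z; apply: untransposeP (tP m) z.
Qed.

Lemma based_term_split (S : cseq k J) : term_split (tensor_seq V S) <-> mx_term_split based_rep S.
Proof.
split=> sS m; have [s sP] := sS m.
  by exists (transpose s); apply: transposeP sP.
by exists (untranspose s); apply: untransposeP sP.
Qed.
End BasedModule.

(** All four classes have this form, with [r1] and [r2] among [V], [k] and [0]. *)
Definition class_reps (r1 r2 : matrix_rep k J) (S : cseq k J) : Prop :=
  mx_split r1 S /\ mx_term_split r2 S.

(** For V = 0 the V-split and V-term split classes would receive two representations of dimension 0,
    and no surjective trace cover; the bound on n excludes this. The other two classes contain the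
    trivial representation. *)
Lemma in_E_class_reps (V : gmod k J) n h : free_of_rank V n ->
  (h = VSplit \/ h = VTermSplit -> (0 < n)%N) ->
  exists r1 r2 : matrix_rep k J, (0 < rdim r1 + rdim r2)%N /\
    forall S, in_E h V S <-> class_reps r1 r2 S.
Proof.
move=> [e eP] n0; case: h n0 => n0.
- exists zero_rep, triv_rep; split=> // S; split=> [sS|[_ sS]]; last exact/triv_rep_term_split.
  by split; [apply: zero_rep_split|apply/triv_rep_term_split].
- exists (based_rep eP), zero_rep; split; first by rewrite addn0; apply: n0; left.
  move=> S; split=> [/(based_split eP) ?|[? _]]; last exact/(based_split eP).
  by split=> //; apply: zero_rep_term_split.
- exists zero_rep, (based_rep eP); split; first by apply: n0; right.
  move=> S; split=> [/(based_term_split eP) ?|[_ ?]]; last exact/(based_term_split eP).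
  by split=> //; apply: zero_rep_split.
- exists (based_rep eP), triv_rep; split; first by rewrite addn1.
  move=> S; split=> [[? /(based_split eP) ?]|[? ?]].
    by split=> //; apply/triv_rep_term_split.
  by split; [apply/triv_rep_term_split|apply/(based_split eP)].
Qed.
End MatrixClasses.

(** * From a traced contraction to lifts *)

Section Contractions.
Variables (k : comPzRingType) (gT : finGroupType) (J : {group gT}).

(** Formulas involving a map of degree -1 live in degrees n + 1, and an integer m equals (m - 1) + 1
    only up to a cast; the cast is confined to this statement. *)
Lemma int_succ_family (Q : int -> Type) (q : forall n, Q (n + 1)) :
  exists f : forall m, Q m, forall n, f (n + 1) = q n.
Proof.
exists (fun m => eq_rect _ Q (q (m - 1)) m (subrK 1 m)) => n.
have key n' : n' = n -> forall e : n' + 1 = n + 1, eq_rect _ Q (q n') _ e = q n.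
  by move=> -> e; rewrite (eq_irrelevance e erefl).
exact: key (addrK 1 n) _.
Qed.

Section Sum.
Variables (X Y : gmod k J) (f g : ghom X Y).
Lemma gadd_linear : linear (fun x => f x + g x).
Proof. by move=> c x y; rewrite !ghomD !ghomZ addrACA scalerDr. Qed.
Lemma gadd_act u x : u \in J -> f (act u x) + g (act u x) = act u (f x + g x).
Proof. by move=> uJ; rewrite !gfun_act // actD. Qed.
Definition gadd : ghom X Y := Ghom gadd_linear gadd_act.
End Sum.

Section Cast.
Variable X : complex k J.

Definition gcast m n (e : m = n) : ghom (X m) (X n) :=
  match e in _ = n return ghom (X m) (X n) with erefl => idm (X m : MOD k J) end.

Lemma gcast_id m (e : m = m) x : gcast e x = x.
Proof. by rewrite (eq_irrelevance e erefl). Qed.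

Lemma gcast_comp l m n (e : l = m) (e' : m = n) x :
  gcast e' (gcast e x) = gcast (etrans e e') x.
Proof. by case: n / e'. Qed.

Lemma gcast_irr m n (e e' : m = n) x : gcast e x = gcast e' x.
Proof. by rewrite (eq_irrelevance e e'). Qed.

Lemma diff_gcast m n (e : m = n) x :
  diff X n (gcast e x) = gcast (congr1 (fun i => i + 1) e) (diff X m x).
Proof. by case: n / e. Qed.
End Cast.

Variables r1 r2 : matrix_rep k J.
Local Notation E1 := (mx_mod r1).
Local Notation E2 := (mx_mod r2).

(** A Higman-type criterion: the identity of [P] is the trace of [a] plus
    [d s + s d], where [s] is a trace of homomorphisms of degree [-1]. *)
Definition traced_contraction (P : complex k J) : Prop :=
  exists (a : chain P (Tens_with E1 P)) (s : forall m n, m = n + 1 -> ghom (P m) (vtens E2 (P n))),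
    forall n (x : P (n + 1)),
      x = mx_trace r1 _ (a (n + 1) x) + diff P n (mx_trace r2 _ (s (n + 1) n erefl x)) +
          mx_trace r2 _ (s (n + 1 + 1) (n + 1) erefl (diff P (n + 1) x)).

(** If sigma : C -> E (x) B satisfies the splitting equation for p, then tr o mul o (E (x) sigma) o
    phi lifts tr o phi for every phi into E (x) C. Applied to [a] followed by f this gives a chain
    map v, applied to [s] followed by f a family u of degree -1, and v + d u + u d lifts f. *)
Lemma traced_contraction_lifts P S : traced_contraction P -> class_reps r1 r2 S -> has_lifts P S.
Proof.
move=> [a [s as1]] [[t tP] t2] f.
pose t' n : ghom (seqC S n) (vtens E2 (seqB S n)) := projT1 (cid (t2 n)).
have t'P n z : vmap E2 (seq_p S n) (t' n z) = mx_one r2 _ z by rewrite /t'; case: cid.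
pose u n : ghom (P (n + 1)) (seqB S n) := comp (c := MOD k J) (mx_trace r2 _)
  (comp (c := MOD k J) (mx_mul r2 _) (comp (c := MOD k J) (vmap E2 (t' n))
  (comp (c := MOD k J) (vmap E2 (f n)) (s (n + 1) n erefl)))).
have pu n x : seq_p S n (u n x) = f n (mx_trace r2 _ (s (n + 1) n erefl x)).
  set w := s _ _ _ x; rewrite -[u n x]/(mx_trace r2 _ (mx_mul r2 _ (vmap E2 (t' n) (vmap E2 (f
    n) w)))).
  rewrite -!mx_trace_natural -mx_mul_natural -[in RHS](mx_mul_one (vmap E2 (f n) w)).
  congr (mx_trace _ _ (mx_mul _ _ _)).
  move: (vmap E2 (f n) w); apply: (vtens_ext (f := vmap E2 (vmap E2 (seq_p S n)) \o vmap E2 (t' n))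
    (g := vmap E2 (mx_one r2 _))) => m z.
  rewrite -[LHS]/(vmap E2 (vmap E2 (seq_p S n)) (vmap E2 (t' n) (vpure m z))).
  rewrite -[RHS]/(vmap E2 (mx_one r2 _) (vpure m z)).
  by rewrite !vmapE t'P.
pose v n : ghom (P n) (seqB S n) := comp (c := MOD k J) (mx_trace r1 _)
  (comp (c := MOD k J) (mx_mul r1 _) (comp (c := MOD k J) (vmap E1 (t n))
  (comp (c := MOD k J) (vmap E1 (f n)) (a n)))).
have pv n x : seq_p S n (v n x) = f n (mx_trace r1 _ (a n x)).
  set w := a n x; rewrite -[v n x]/(mx_trace r1 _ (mx_mul r1 _ (vmap E1 (t n) (vmap E1 (f n) w)))).
  rewrite -!mx_trace_natural -mx_mul_natural -[in RHS](mx_mul_one (vmap E1 (f n) w)).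
  congr (mx_trace _ _ (mx_mul _ _ _)).
  move: (vmap E1 (f n) w); apply: (vtens_ext (f := vmap E1 (vmap E1 (seq_p S n)) \o vmap E1 (t n))
    (g := vmap E1 (mx_one r1 _))) => m z.
  rewrite -[LHS]/(vmap E1 (vmap E1 (seq_p S n)) (vmap E1 (t n) (vpure m z))).
  rewrite -[RHS]/(vmap E1 (mx_one r1 _) (vpure m z)).
  by rewrite !vmapE tP.
have vd n x : v (n + 1) (diff P n x) = diff (seqB S) n (v n x).
  rewrite -[RHS]/(diff _ n (mx_trace r1 _ (mx_mul r1 _ (vmap E1 (t n) (vmap E1 (f n) (a n x)))))).
  rewrite -mx_trace_natural -mx_mul_natural.
  rewrite -[LHS]/(mx_trace r1 _ (mx_mul r1 _ (vmap E1 (t (n + 1)) (vmap E1 (f (n + 1)) (a (n +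
    1) (diff P n x)))))).
  rewrite (cmap_diff a); congr (mx_trace _ _ (mx_mul _ _ _)).
  move: (a n x); apply: (vtens_ext
    (f := vmap E1 (t (n + 1)) \o (vmap E1 (f (n + 1)) \o vmap E1 (diff P n)))
    (g := vmap E1 (vmap E1 (diff (seqB S) n)) \o (vmap E1 (t n) \o vmap E1 (f n)))) => m z.
  rewrite -[LHS]/(vmap E1 (t (n + 1)) (vmap E1 (f (n + 1)) (vmap E1 (diff P n) (vpure m z)))).
  rewrite -[RHS]/(vmap E1 (vmap E1 (diff (seqB S) n)) (vmap E1 (t n) (vmap E1 (f n) (vpure m z)))).
  by rewrite !vmapE !cmap_diff.
pose w n : ghom (P (n + 1)) (seqB S (n + 1)) :=
  gadd (v (n + 1)) (gadd (comp (c := MOD k J) (diff (seqB S) n) (u n))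
    (comp (c := MOD k J) (u (n + 1)) (diff P (n + 1)))).
have wE n x : w n x = v (n + 1) x + (diff (seqB S) n (u n x) + u (n + 1) (diff P (n + 1) x)) by [].
have [g gE] := int_succ_family (Q := fun m => ghom (P m) (seqB S m)) w.
have gd m x : g (m + 1) (diff P m x) = diff (seqB S) m (g m x).
  rewrite -[m](subrK 1) in x *; rewrite !gE !wE !diff_diff vd ghom0 addr0 !ghomD diff_diff.
  by rewrite add0r.
exists (Chain gd) => m x; rewrite -[m](subrK 1) in x *.
rewrite -[LHS]/(seq_p S _ (g _ x)) gE wE !ghomD pv pu cmap_diff pu -cmap_diff.
by rewrite addrA -!ghomD -as1.
Qed.

End Contractions.

(** * The trace cover and the criterion *)

Section Cover.
Variables (k : comPzRingType) (gT : finGroupType) (J : {group gT}).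

Section Disk.
Variable M : complex k J.

(** The differential of M is moved from here into [disk_proj_fun]. In these coordinates a chain map
    P -> [disk] is an arbitrary family y : P^m -> M^(m-1), its second component being forced to be y
    d. *)
Definition disk_diff_fun n (z : msum (M (n - 1)) (M n)) : msum (M (n + 1 - 1)) (M (n + 1)) :=
  (gcast M (esym (addrK 1 n)) z.2, 0).

Lemma disk_diff_linear n : linear (@disk_diff_fun n).
Proof. by move=> c x y; congr pair; rewrite /= ?ghomD ?ghomZ // scaler0 addr0. Qed.
Lemma disk_diff_act n g z : g \in J -> @disk_diff_fun n (act g z) = act g (disk_diff_fun z).
Proof. by move=> gJ; congr pair; rewrite /= ?gfun_act // linear0. Qed.

Definition disk_diff n : ghom (msum (M (n - 1)) (M n)) (msum (M (n + 1 - 1)) (M (n + 1))) :=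
  Ghom (@disk_diff_linear n) (@disk_diff_act n).

Lemma disk_diff_diff n z : disk_diff (n + 1) (disk_diff n z) = 0.
Proof. by congr pair; rewrite ghom0. Qed.

(** the cone of the identity of [M], shifted and with a change of coordinates *)
Definition disk : complex k J := @Complex _ _ J (fun n => msum (M (n - 1)) (M n)) disk_diff
  disk_diff_diff.

Definition disk_proj_fun n (z : msum (M (n - 1)) (M n)) : M n :=
  gcast M (subrK 1 n) (diff M (n - 1) z.1) + z.2.

Lemma disk_proj_linear n : linear (@disk_proj_fun n).
Proof. by move=> c x y; rewrite /disk_proj_fun !ghomD !ghomZ scalerDr addrACA. Qed.
Lemma disk_proj_act n g z : g \in J -> @disk_proj_fun n (act g z) = act g (disk_proj_fun z).
Proof. by move=> gJ; rewrite /disk_proj_fun /= !gfun_act // actD. Qed.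
Lemma disk_proj_diff n z : disk_proj_fun (disk_diff n z) = diff M n (disk_proj_fun z).
Proof.
rewrite /disk_proj_fun addr0 ghomD !diff_gcast gcast_comp gcast_id diff_diff ghom0.
by rewrite add0r.
Qed.

Definition disk_proj : chain disk M :=
  @Chain _ _ J disk M (fun n => Ghom (@disk_proj_linear n) (@disk_proj_act n)) disk_proj_diff.

Lemma disk_in_C c : in_C c M -> in_C c disk.
Proof.
move=> [tM bM]; split=> [n|].
  have : has_term_type c.1 (M (n - 1)) /\ has_term_type c.1 (M n) by [].
  case: c.1 => //= -[]; [exact: finitely_generated_sum|exact: finite_length_sum].
have ab : bounded_above M -> bounded_above disk.
  (* The summand M^(n-1) survives one degree further up, whence N + 1. *)
  move=> [N NP]; exists (N + 1) => n lt [x y].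
  have lt1 : N < n - 1 by rewrite ltrBrDr.
  have lt2 : N < n by rewrite (lt_trans _ lt) // ltrDl.
  by rewrite (NP _ lt1 x) (NP _ lt2 y).
have be : bounded_below M -> bounded_below disk.
  move=> [N NP]; exists N => n lt [x y].
  have lt1 : n - 1 < N by rewrite (lt_trans _ lt) // ltrBlDr ltrDl.
  by rewrite (NP _ lt1 x) (NP _ lt y).
by case: c.2 bM => [|/ab|/be|[/ab ? /be ?]].
Qed.
End Disk.

Section MatrixComplex.
Variable r : matrix_rep k J.
Local Notation E := (mx_mod r).

Definition trace_chain (X : complex k J) : chain (Tens_with E X) X :=
  @Chain _ _ J (Tens_with E X) X (fun n => mx_trace r (X n))
    (fun n w => mx_trace_natural (diff X n) w).

Definition casimir_chain (X : complex k J) : chain X (Tens_with E (Tens_with E X)) :=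
  @Chain _ _ J X (Tens_with E (Tens_with E X)) (fun n => casimir r (X n))
    (fun n x => casimir_natural r (diff X n) x).

Lemma mx_coord_linl (X : gmod k J) (ij : 'I_(rdim r) * 'I_(rdim r)) (x : X) :
  linear (fun m : E => m ij.1 ij.2 *: x).
Proof. by move=> c a b; rewrite !mxE scalerDl scalerA. Qed.
Lemma mx_coord_linr (X : gmod k J) (ij : 'I_(rdim r) * 'I_(rdim r)) (m : E) :
  linear (fun x : X => m ij.1 ij.2 *: x).
Proof. by move=> c a b; rewrite scalerDr !scalerA mulrC. Qed.

Lemma mx_term_type s (X : gmod k J) : has_term_type s X -> has_term_type s (vtens E X).
Proof.
move=> /has_term_type_linear tX; apply/has_term_type_linear.
pose f (ij : 'I_(rdim r) * 'I_(rdim r)) :=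
  mklinear (@vpure_linr k gT J E X (delta_mx ij.1 ij.2)).
apply: (linear_term_type_cover (f := f)) tX => w.
pose q ij := vlift (@mx_coord_linl X ij) (@mx_coord_linr X ij).
have lin : linear (fun w => \sum_ij f ij (q ij w)).
  by move=> c x y; rewrite scaler_sumr -big_split; apply: eq_bigr => ij _; rewrite !linearP.
exists (fun ij => q ij w); move: w.
apply: (vtens_ext (f := idfun) (g := mklinear lin)) => m x.
rewrite -[RHS]/(\sum_ij f ij (q ij (vpure m x))).
pose g := mklinear (@vpure_linl k gT J E X x).
rewrite -[LHS]/(g m) {1}[m]matrix_sum_delta pair_big linear_sum; apply: eq_bigr => ij _.
by rewrite vliftE linearZ [RHS]linearZ.
Qed.

Lemma mx_in_C c (X : complex k J) : in_C c X -> in_C c (Tens_with E X).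
Proof. by apply: degreewise_in_C => Y; apply: mx_term_type. Qed.
End MatrixComplex.

Variables (r1 r2 : matrix_rep k J) (P : complex k J).
Local Notation E1 := (mx_mod r1).
Local Notation E2 := (mx_mod r2).

Definition cover : complex k J := csum (Tens_with E1 P) (disk (Tens_with E2 P)).

Definition cover_proj : chain cover P :=
  add_chain (comp (c := CX k J) (trace_chain r1 P) (cfst _ _))
    (comp (c := CX k J) (trace_chain r2 P)
       (comp (c := CX k J) (disk_proj (Tens_with E2 P)) (csnd _ _))).

Lemma cover_in_C c : in_C c P -> in_C c cover.
Proof. by move=> cP; apply: in_C_sum; [|apply: disk_in_C]; apply: mx_in_C. Qed.

(** A diagonal matrix unit has trace 1, so x |-> e_ii (x) x is a section as soon as one dimension is
    positive. It is only k-linear, which is enough for exactness and for the term type of the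
    kernel. *)
Lemma cover_section : (0 < rdim r1 + rdim r2)%N ->
  exists s : forall n, P n -> cover n,
    (forall n, linear (s n)) /\ forall n x, cover_proj n (s n x) = x.
Proof.
have sec (r : matrix_rep k J) (i : 'I_(rdim r)) (X : gmod k J) :
    exists2 s : X -> vtens (mx_mod r) X, linear s & forall x, mx_trace r X (s x) = x.
  exists (fun x => vpure (delta_mx i i : mx_mod r) x); first exact: vpure_linr.
  move=> x; rewrite mx_traceE /mxtrace (bigD1 i) //= mxE !eqxx big1 ?addr0 ?scale1r // => j ji.
  by rewrite mxE (negPf ji).
case: (posnP (rdim r1)) => [-> r2_gt0|r1_gt0 _].
  pose s n := projT1 (cid2 (sec r2 (Ordinal r2_gt0) (P n))).
  have slin n : linear (s n) by rewrite /s; case: cid2.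
  have sP n x : mx_trace r2 (P n) (s n x) = x by rewrite /s; case: cid2.
  exists (fun n x => (0, (0, s n x))); split=> n; last first.
    move=> x; rewrite -[LHS]/(mx_trace r1 _ 0 + mx_trace r2 _
      (gcast (Tens_with E2 P) (subrK 1 n) (diff (Tens_with E2 P) (n - 1) 0) + s n x)).
    by rewrite !ghom0 !add0r sP.
  by move=> c x y; congr (_, (_, _)); rewrite ?slin //= scaler0 addr0.
pose s n := projT1 (cid2 (sec r1 (Ordinal r1_gt0) (P n))).
have slin n : linear (s n) by rewrite /s; case: cid2.
have sP n x : mx_trace r1 (P n) (s n x) = x by rewrite /s; case: cid2.
exists (fun n x => (s n x, 0)); split=> n; last first.
  move=> x; rewrite -[LHS]/(mx_trace r1 _ (s n x) + mx_trace r2 _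
     (gcast (Tens_with E2 P) (subrK 1 n) (diff (Tens_with E2 P) (n - 1) 0) + 0)).
  by rewrite !ghom0 add0r ghom0 addr0 sP.
by move=> c x y; congr (_, _); rewrite ?slin //= scaler0 addr0.
Qed.

Definition cover_seq : cseq k J := Cseq (ker_complex_inc cover_proj) cover_proj.

Lemma cover_exact : (0 < rdim r1 + rdim r2)%N -> Defs.exact cover_seq.
Proof.
move=> r_gt0 n; have [s [_ sP]] := cover_section r_gt0; split.
- exact: ker_val_inj.
- move=> y; split=> [e|[x ->]]; last exact: ker_valP.
  by exists (ker_intro e).
- by move=> z; exists (s n z); apply: sP.
Qed.

(** Both splittings come from the Casimir element. The inclusion of the first summand is a chain
    map, whereas w |-> (0, w) into the disk is not compatible with the differentials, hence only a
    degreewise splitting for [r2]. *)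
Lemma cover_class : class_reps r1 r2 cover_seq.
Proof.
split.
  pose i1 : chain (Tens_with E1 P) cover := cinl _ _.
  exists (comp (c := CX k J) (fmap (Tens_with E1) i1) (casimir_chain r1 P)) => n z.
  rewrite -[RHS]casimir_trace.
  rewrite -[LHS]/(vmap E1 (cover_proj n) (vmap E1 (i1 n) (casimir r1 _ z))).
  rewrite -[LHS](fmap_comp (TensM E1) (cover_proj n) (i1 n) _).
  apply: (@fmap_heq _ _ (TensM E1)) => w.
  rewrite -[LHS]/(mx_trace r1 _ w + mx_trace r2 _
     (gcast (Tens_with E2 P) (subrK 1 n) (diff (Tens_with E2 P) (n - 1) 0) + 0)).
  by rewrite !ghom0 add0r ghom0 addr0.
move=> n.
have lin : linear (fun w : vtens E2 (P n) => (0, (0, w)) : cover n).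
  by move=> c x y; congr (_, (_, _)); rewrite //= scaler0 addr0.
have actE g (w : vtens E2 (P n)) : g \in J -> (0, (0, act g w)) = act g ((0, (0, w)) : cover n).
  by move=> gJ; congr (_, (_, _)); apply: esym; apply: (linear0 (@act _ _ J _ g)).
pose i2 : ghom (vtens E2 (P n)) (cover n) := Ghom lin actE.
exists (comp (c := MOD k J) (vmap E2 i2) (casimir r2 _)) => z.
rewrite -[RHS]casimir_trace.
rewrite -[LHS]/(vmap E2 (cover_proj n) (vmap E2 i2 (casimir r2 _ z))).
rewrite -[LHS](fmap_comp (TensM E2) (cover_proj n) i2 _).
apply: (@fmap_heq _ _ (TensM E2)) => w.
rewrite -[LHS]/(mx_trace r1 _ 0 + mx_trace r2 _
   (gcast (Tens_with E2 P) (subrK 1 n) (diff (Tens_with E2 P) (n - 1) 0) + w)).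
by rewrite !ghom0 !add0r.
Qed.

Lemma split_cover_traced_contraction (s : chain P cover) :
  (forall n x, cover_proj n (s n x) = x) -> traced_contraction r1 r2 P.
Proof.
move=> sP.
pose a : chain P (Tens_with E1 P) := comp (c := CX k J) (cfst _ _) s.
pose b : chain P (disk (Tens_with E2 P)) := comp (c := CX k J) (csnd _ _) s.
pose M := Tens_with E2 P.
pose y m : ghom (P m) (M (m - 1)) := @Ghom _ _ J (P m) (M (m - 1)) (fun x => (b m x).1)
  (fun c x x' => congr1 fst (gfun_linear (b m) c x x'))
  (fun g x gJ => congr1 fst (gfun_act (b m) x gJ)).
have e1 (m n : int) : m = n + 1 -> m - 1 = n by move=> ->; apply: addrK.
pose t m n (e : m = n + 1) : ghom (P m) (vtens E2 (P n)) :=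
  comp (c := MOD k J) (gcast M (e1 m n e)) (y m).
exists a, t => n x.
(* The chain condition on the disk: the second component of the section is y d, which becomes the
   term s d of the contraction; d s comes from [disk_proj]. *)
have yd m z : y (m + 1) (diff P m z) = gcast M (esym (addrK 1 m)) (b m z).2.
  by have := congr1 fst (cmap_diff b z).
have bE m z : mx_trace r1 _ (a m z) +
    mx_trace r2 _ (gcast M (subrK 1 m) (diff M (m - 1) (y m z)) + (b m z).2) = z.
  exact: sP.
apply: etrans (esym (bE (n + 1) x)) _; rewrite -[RHS]addrA; congr (_ + _); rewrite ghomD; congr
  (_ + _).
  rewrite -[RHS]/(diff P n (mx_trace r2 _ (gcast M _ (y _ x)))).
  rewrite -mx_trace_natural; congr (mx_trace _ _ _).
  rewrite -[RHS]/(diff M n (gcast M _ (y _ x))) diff_gcast.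
  exact: (@gcast_irr _ _ _ M _ _ (subrK 1 (n + 1))).
rewrite -[RHS]/(mx_trace r2 _ (gcast M _ (y _ (diff P (n + 1) x)))).
by rewrite yd gcast_comp gcast_id.
Qed.
End Cover.

Lemma E_projective_traced_contraction (k : comPzRingType) (gT : finGroupType) (J : {group gT})
    c h (V : gmod k J) (r1 r2 : matrix_rep k J) :
  (0 < rdim r1 + rdim r2)%N -> (forall S, in_E h V S <-> class_reps r1 r2 S) ->
  forall P, E_projective c h V P <-> in_C c P /\ traced_contraction r1 r2 P.
Proof.
move=> r_gt0 inE P; split.
  move=> /E_projectiveP[cP lP]; split=> //.
  have cQ := cover_in_C r1 r2 cP.
  have [r [rlin rP]] := cover_section P r_gt0.
  have cK := ker_complex_in_C rlin rP cQ.
  have [s sP] := lP (cover_seq r1 r2 P) cK cQ cP (cover_exact P r_gt0)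
    ((inE _).2 (cover_class r1 r2 P)) (idm (P : CX k J)).
  exact: split_cover_traced_contraction sP.
move=> [cP tP]; apply/E_projectiveP; split=> // S _ _ _ _ /inE.
exact: traced_contraction_lifts.
Qed.

(** * Tensor products with projective complexes *)

Section TensorContraction.
Variables (k : comPzRingType) (gT : finGroupType) (J : {group gT}).

Section Put.
Variables (r : matrix_rep k J) (X Y : complex k J) (i j n : int) (e : i + j == n).
Local Notation E := (mx_mod r).
Let p : bideg n := exist _ (i, j) e.

(** A form of [tpure] with i and j as variables instead of the components of an element of
    [bideg n], so that equations between degrees can be substituted; by [put_irr] the proof e is
    immaterial. *)
Definition put (x : X i) (y : Y j) : tc_term X Y n := @tpure _ _ _ X Y n p x y.

Lemma put_linl y : linear (put^~ y). Proof. exact: (@tpure_linl _ _ _ X Y n p y). Qed.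
Lemma put_linr x : linear (put x). Proof. exact: (@tpure_linr _ _ _ X Y n p x). Qed.

Definition putl (y : Y j) : {linear vtens E (X i) -> vtens E (tc_term X Y n)} :=
  vlift (V := E) (b := fun m x => vpure m (put x y))
    (fun x c a b => vpure_linl (put x y) c a b)
    (fun m c x x' => etrans (congr1 (vpure m) (put_linl y c x x')) (vpure_linr m c _ _)).

Definition putr (x : X i) : {linear vtens E (Y j) -> vtens E (tc_term X Y n)} :=
  vlift (V := E) (b := fun m y => vpure m (put x y))
    (fun y c a b => vpure_linl (put x y) c a b)
    (fun m c y y' => etrans (congr1 (vpure m) (put_linr x c y y')) (vpure_linr m c _ _)).

Lemma putlE y (m : E) x : putl y (vpure m x) = vpure m (put x y).
Proof. exact: vliftE. Qed.
Lemma putrE x (m : E) y : putr x (vpure m y) = vpure m (put x y).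
Proof. exact: vliftE. Qed.

Lemma putl_linear w : linear (putl^~ w).
Proof.
move=> c a b; move: w; apply: (vtens_ext (f := putl (c *: a + b)) (g := c \*: putl a \+ putl b)).
move=> m x; rewrite -[RHS]/(c *: putl a (vpure m x) + putl b (vpure m x)) !putlE.
by rewrite put_linr vpure_linr.
Qed.

Lemma putr_linear w : linear (putr^~ w).
Proof.
move=> c a b; move: w; apply: (vtens_ext (f := putr (c *: a + b)) (g := c \*: putr a \+ putr b)).
move=> m x; rewrite -[RHS]/(c *: putr a (vpure m x) + putr b (vpure m x)) !putrE.
by rewrite put_linl vpure_linr.
Qed.

Lemma putl_act g y w : putl (act g y) (act g w) = act g (putl y w).
Proof.
move: w; apply: (vtens_ext (f := putl (act g y) \o @act _ _ J (vtens E (X i)) g)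
  (g := @act _ _ J (vtens E (tc_term X Y n)) g \o putl y)) => m x.
rewrite -[LHS]/(putl (act g y) (act g (vpure m x))) -[RHS]/(act g (putl y (vpure m x))).
by rewrite act_vpure !putlE act_vpure tc_actE.
Qed.

Lemma putr_act g x w : putr (act g x) (act g w) = act g (putr x w).
Proof.
move: w; apply: (vtens_ext (f := putr (act g x) \o @act _ _ J (vtens E (Y j)) g)
  (g := @act _ _ J (vtens E (tc_term X Y n)) g \o putr x)) => m y.
rewrite -[LHS]/(putr (act g x) (act g (vpure m y))) -[RHS]/(act g (putr x (vpure m y))).
by rewrite act_vpure !putrE act_vpure tc_actE.
Qed.

Lemma putl_trace y w : mx_trace r _ (putl y w) = put (mx_trace r _ w) y.
Proof.
move: w; apply: (vtens_ext (f := mx_trace r _ \o putl y) (g := mklinear (put_linl y) \o mx_trace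
  r _)).
move=> m x; rewrite -[LHS]/(mx_trace r _ (putl y (vpure m x))).
rewrite -[RHS]/(mklinear (put_linl y) (mx_trace r _ (vpure m x))) putlE !mx_traceE.
by rewrite linearZ.
Qed.

Lemma putr_trace x w : mx_trace r _ (putr x w) = put x (mx_trace r _ w).
Proof.
move: w; apply: (vtens_ext (f := mx_trace r _ \o putr x) (g := mklinear (put_linr x) \o mx_trace
  r _)).
move=> m y; rewrite -[LHS]/(mx_trace r _ (putr x (vpure m y))).
rewrite -[RHS]/(mklinear (put_linr x) (mx_trace r _ (vpure m y))) putrE !mx_traceE.
by rewrite linearZ.
Qed.
End Put.
Arguments putl r {X Y i j n} e y.
Arguments putr r {X Y i j n} e x.

Lemma put_irr (X Y : complex k J) i j n (e e' : i + j == n) (x : X i) (y : Y j) :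
  put e x y = put e' x y.
Proof. by rewrite (bool_irrelevance e e'). Qed.

Section Diff.
Variables (r : matrix_rep k J) (X Y : complex k J) (i j n : int) (e : i + j == n).
Local Notation E := (mx_mod r).
Variables (e1 : i + 1 + j == n + 1) (e2 : i + (j + 1) == n + 1).

Lemma put_diff (x : X i) (y : Y j) : tc_diff X Y n (put e x y) =
  put e1 (diff X i x) y + koszul k i *: put e2 x (diff Y j y).
Proof.
rewrite [LHS]tc_diffE /tc_diff_fun.
by congr (_ + koszul k i *: _); apply: put_irr.
Qed.

Lemma putl_diff y w : vmap E (tc_diff X Y n) (putl r e y w) =
  putl r e1 y (vmap E (diff X i) w) + koszul k i *: putl r e2 (diff Y j y) w.
Proof.
move: w; apply: (vtens_ext (f := vmap E (tc_diff X Y n) \o putl r e y)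
  (g := (putl r e1 y \o vmap E (diff X i)) \+ koszul k i \*: putl r e2 (diff Y j y))) => m x.
rewrite -[LHS]/(vmap E (tc_diff X Y n) (putl r e y (vpure m x))).
rewrite -[RHS]/(putl r e1 y (vmap E (diff X i) (vpure m x)) +
   koszul k i *: putl r e2 (diff Y j y) (vpure m x)).
rewrite putlE !vmapE !putlE put_diff.
by rewrite [in LHS](addrC (put e1 _ _)) vpure_linr [LHS]addrC.
Qed.

Lemma putr_diff x w : vmap E (tc_diff X Y n) (putr r e x w) =
  putr r e1 (diff X i x) w + koszul k i *: putr r e2 x (vmap E (diff Y j) w).
Proof.
move: w; apply: (vtens_ext (f := vmap E (tc_diff X Y n) \o putr r e x)
  (g := putr r e1 (diff X i x) \+ koszul k i \*: (putr r e2 x \o vmap E (diff Y j)))) => m y.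
rewrite -[LHS]/(vmap E (tc_diff X Y n) (putr r e x (vpure m y))).
rewrite -[RHS]/(putr r e1 (diff X i x) (vpure m y) +
   koszul k i *: putr r e2 x (vmap E (diff Y j) (vpure m y))).
rewrite putrE !vmapE !putrE put_diff.
by rewrite [in LHS](addrC (put e1 _ _)) vpure_linr [LHS]addrC.
Qed.
End Diff.

Section Left.
Variables (r : matrix_rep k J) (X Y : complex k J) (n n' : int).
Local Notation E := (mx_mod r).
Variables (i' : bideg n -> int) (e : forall p, i' p + (val p).2 == n').
Variable f : forall p : bideg n, ghom (X (val p).1) (vtens E (X (i' p))).

Lemma tensl_balanced : balanced (no_op (fun p : bideg n => X (val p).1))
  (no_op (fun p : bideg n => Y (val p).2)) (fun p x y => putl r (e p) y (f p x)).
Proof.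
split=> [p y c x x'|p x c y y'|p []]; first by rewrite ghomD ghomZ linearP.
by rewrite putl_linear.
Qed.

Definition tensl_lin : {linear tc_term X Y n -> vtens E (tc_term X Y n')} := tlift tensl_balanced.

Lemma tensl_linE (p : bideg n) (x : X (val p).1) (y : Y (val p).2) :
  tensl_lin (tpure x y) = putl r (e p) y (f p x).
Proof. exact: tlift_pure. Qed.

Lemma tensl_act g z : g \in J -> tensl_lin (act g z) = act g (tensl_lin z).
Proof.
move=> gJ; move: z; apply: (tc_ext (f := tensl_lin \o @act _ _ J (tc_term X Y n) g)
  (g := @act _ _ J (vtens E (tc_term X Y n')) g \o tensl_lin)) => p x y.
rewrite -[LHS]/(tensl_lin (act g (tpure x y))) -[RHS]/(act g (tensl_lin (tpure x y))).
by rewrite tc_actE !tensl_linE gfun_act // putl_act.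
Qed.

Definition tensl : ghom (tc_term X Y n) (vtens E (tc_term X Y n')) :=
  @Ghom _ _ J (tc_term X Y n) (vtens E (tc_term X Y n')) tensl_lin
    (fun c x y => linearP tensl_lin c x y) tensl_act.
End Left.

Section Right.
Variables (r : matrix_rep k J) (X Y : complex k J) (n n' : int).
Local Notation E := (mx_mod r).
Variables (j' : bideg n -> int) (e : forall p, (val p).1 + j' p == n') (c : bideg n -> k).
Variable f : forall p : bideg n, ghom (Y (val p).2) (vtens E (Y (j' p))).

Lemma tensr_balanced : balanced (no_op (fun p : bideg n => X (val p).1))
  (no_op (fun p : bideg n => Y (val p).2)) (fun p x y => c p *: putr r (e p) x (f p y)).
Proof.
split=> [p y d x x'|p x d y y'|p []].
  by rewrite putr_linear scalerDr !scalerA mulrC.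
by rewrite ghomD ghomZ linearP scalerDr !scalerA mulrC.
Qed.

Definition tensr_lin : {linear tc_term X Y n -> vtens E (tc_term X Y n')} := tlift tensr_balanced.

Lemma tensr_linE (p : bideg n) (x : X (val p).1) (y : Y (val p).2) :
  tensr_lin (tpure x y) = c p *: putr r (e p) x (f p y).
Proof. exact: tlift_pure. Qed.

Lemma tensr_act g z : g \in J -> tensr_lin (act g z) = act g (tensr_lin z).
Proof.
move=> gJ; move: z; apply: (tc_ext (f := tensr_lin \o @act _ _ J (tc_term X Y n) g)
  (g := @act _ _ J (vtens E (tc_term X Y n')) g \o tensr_lin)) => p x y.
rewrite -[LHS]/(tensr_lin (act g (tpure x y))) -[RHS]/(act g (tensr_lin (tpure x y))).
by rewrite tc_actE !tensr_linE gfun_act // putr_act actZ.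
Qed.

Definition tensr : ghom (tc_term X Y n) (vtens E (tc_term X Y n')) :=
  @Ghom _ _ J (tc_term X Y n) (vtens E (tc_term X Y n')) tensr_lin
    (fun c x y => linearP tensr_lin c x y) tensr_act.
End Right.

Variables r1 r2 : matrix_rep k J.

Lemma bideg_pred1 m n (p : bideg m) : m = n + 1 -> (val p).1 - 1 + (val p).2 == n.
Proof. by move=> e; rewrite addrAC (eqP (valP p)) e addrK. Qed.
Lemma bideg_pred2 m n (p : bideg m) : m = n + 1 -> (val p).1 + ((val p).2 - 1) == n.
Proof. by move=> e; rewrite addrA (eqP (valP p)) e addrK. Qed.

Lemma koszul2 i : koszul k i * koszul k i = 1.
Proof. by rewrite /koszul -expr2 sqrr_sign. Qed.

(** The data are a (x) 1 and s (x) 1. The terms with the differential of Y cancel between d s and s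
    d, because s lowers the degree of the left factor by one and thus changes the Koszul sign. *)
Lemma tensor_traced_contractionl P Y :
  traced_contraction r1 r2 P -> traced_contraction r1 r2 (tc P Y).
Proof.
move=> [a [s as1]].
pose A n := tensl (r := r1) (X := P) Y (n := n) (n' := n) (i' := fun p => (val p).1)
  (fun p => valP p) (fun p => a (val p).1).
have AE n (p : bideg n) (x : P (val p).1) (y : Y (val p).2) :
    A n (tpure x y) = putl r1 (valP p) y (a _ x) by apply: tensl_linE.
have Ad n z : A (n + 1) (tc_diff P Y n z) = vmap (mx_mod r1) (tc_diff P Y n) (A n z).
  move: z; apply: (tc_ext (f := A (n + 1) \o tc_diff_lin P Y n)
    (g := vmap (mx_mod r1) (tc_diff P Y n) \o A n)) => p x y.
  rewrite -[LHS]/(A (n + 1) (tc_diff_lin P Y n (tpure x y))).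
  rewrite -[RHS]/(vmap (mx_mod r1) (tc_diff P Y n) (A n (tpure x y))).
  rewrite tc_diffE AE (putl_diff _ (valP (bideg1 p)) (valP (bideg2 p))).
  rewrite /tc_diff_fun ghomD ghomZ; congr (_ + _ *: _).
    by rewrite AE (cmap_diff a).
  by rewrite AE.
(* Here s runs from degree i to i - 1, with [subrK] as the proof that i = (i - 1) + 1; the equation
   argument in [traced_contraction] makes room for this. [SE] then frees the indices. *)
pose S m n (e : m = n + 1) := tensl (r := r2) (X := P) Y (n := m) (n' := n)
  (i' := fun p => (val p).1 - 1) (fun p => bideg_pred1 p e)
  (fun p => s (val p).1 ((val p).1 - 1) (esym (subrK 1 (val p).1))).
have SE m n (e : m = n + 1) (i i' j : int) (ei : i = i' + 1) (e0 : i + j == m) (e1 : i' + j == n)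
   (x : P i) (y : Y j) : S m n e (put e0 x y) = putl r2 e1 y (s i i' ei x).
  apply: etrans (tensl_linE _ _ _ _) _ => /=.
  have ei' : i - 1 = i' by rewrite ei addrK.
  move: (bideg_pred1 _ _) (esym _) => /=; rewrite ei' => e2 ei2.
  by rewrite (bool_irrelevance e2 e1) (eq_irrelevance ei2 ei).
exists (@Chain _ _ J (tc P Y) (Tens_with (mx_mod r1) (tc P Y)) A Ad), S => n.
pose R (z : tc_term P Y (n + 1)) := mx_trace r1 _ (A (n + 1) z) +
  tc_diff P Y n (mx_trace r2 _ (S (n + 1) n erefl z)) +
  mx_trace r2 _ (S (n + 1 + 1) (n + 1) erefl (tc_diff P Y (n + 1) z)).
have Rlin : linear R.
  move=> c z z'; rewrite /R !(ghomD, ghomZ) !scalerDr.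
  by apply: etrans (congr1 (fun u => u + _) (addrACA _ _ _ _)) _; apply: addrACA.
have AP m i j (e0 : i + j == m) (x : P i) (y : Y j) : A m (put e0 x y) = putl r1 e0 y (a i x).
  apply: etrans (AE m (exist _ (i, j) e0) x y) _; congr (putl r1 _ y _).
  exact: bool_irrelevance.
have cancel (Z : zmodType) (u v w d : Z) : u + (v + d) + (w - d) = u + v + w.
  by rewrite [w - d]addrC !addrA addrK.
(* [traced_contraction] speaks of degrees n + 1, so the left degree is written i' + 1; every integer
   has this form. *)
have key i' j (e0 : i' + 1 + j == n + 1) (x : P (i' + 1)) (y : Y j) :
    put e0 x y = R (put e0 x y).
  have e1 : i' + j == n by move: e0; rewrite addrAC (inj_eq (addIr 1)).
  have e2 : i' + (j + 1) == n + 1 by rewrite addrA (eqP e1).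
  have e3 : i' + 1 + 1 + j == n + 1 + 1 by rewrite -(eqP e0) addrAC.
  have e4 : i' + 1 + (j + 1) == n + 1 + 1 by rewrite addrA (eqP e0).
  rewrite /R [tc_diff P Y (n + 1) _](put_diff e0 e3 e4) AP putl_trace.
  rewrite (SE _ _ _ _ _ _ erefl e0 e1) putl_trace (put_diff e1 e0 e2).
  rewrite !ghomD !ghomZ (SE _ _ _ _ _ _ erefl e3 e0) (SE _ _ _ _ _ _ erefl e4 e2) !putl_trace.
  rewrite koszulS scaleNr cancel [LHS](congr1 (fun x => put e0 x y) (as1 i' x)).
  have pD u v : put e0 (u + v) y = put e0 u y + put e0 v y.
    exact: (linearD (mklinear (put_linl e0 y))).
  by rewrite !pD.
suff e : idfun =1 mklinear Rlin by move=> z; apply: (e z).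
apply: tc_ext => -[[i j] e0] x y; have ei : i = (i - 1) + 1 by rewrite subrK.
move: (i - 1) ei => i' ei; subst i; exact: key.
Qed.

(** A map of degree -1 moved past an element of degree j acquires the sign (-1)^j, which is built
    into S. On the wanted terms it meets the sign of the differential and squares to 1; the cross
    terms get opposite signs and cancel. *)
Lemma tensor_traced_contractionr P Y :
  traced_contraction r1 r2 P -> traced_contraction r1 r2 (tc Y P).
Proof.
move=> [a [s as1]].
pose A n := tensr (r := r1) Y (Y := P) (n := n) (n' := n) (j' := fun p => (val p).2)
  (fun p => valP p) (fun=> 1) (fun p => a (val p).2).
have AE n (p : bideg n) (y : Y (val p).1) (x : P (val p).2) :
    A n (tpure y x) = putr r1 (valP p) y (a _ x).
  by apply: etrans (tensr_linE _ _ _ _ _) _; rewrite scale1r.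
have Ad n z : A (n + 1) (tc_diff Y P n z) = vmap (mx_mod r1) (tc_diff Y P n) (A n z).
  move: z; apply: (tc_ext (f := A (n + 1) \o tc_diff_lin Y P n)
    (g := vmap (mx_mod r1) (tc_diff Y P n) \o A n)) => p y x.
  rewrite -[LHS]/(A (n + 1) (tc_diff_lin Y P n (tpure y x))).
  rewrite -[RHS]/(vmap (mx_mod r1) (tc_diff Y P n) (A n (tpure y x))).
  rewrite tc_diffE AE (putr_diff _ (valP (bideg1 p)) (valP (bideg2 p))).
  rewrite /tc_diff_fun ghomD ghomZ; congr (_ + _ *: _).
    by rewrite AE.
  by rewrite AE (cmap_diff a).
pose S m n (e : m = n + 1) := tensr (r := r2) Y (Y := P) (n := m) (n' := n)
  (j' := fun p => (val p).2 - 1) (fun p => bideg_pred2 p e) (fun p => koszul k (val p).1)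
  (fun p => s (val p).2 ((val p).2 - 1) (esym (subrK 1 (val p).2))).
have SE m n (e : m = n + 1) (i i' j : int) (ei : i = i' + 1) (e0 : j + i == m) (e1 : j + i' == n)
   (x : P i) (y : Y j) : S m n e (put e0 y x) = koszul k j *: putr r2 e1 y (s i i' ei x).
  apply: etrans (tensr_linE _ _ _ _ _) _ => /=.
  have ei' : i - 1 = i' by rewrite ei addrK.
  move: (bideg_pred2 _ _) (esym _) => /=; rewrite ei' => e2 ei2.
  by rewrite (bool_irrelevance e2 e1) (eq_irrelevance ei2 ei).
exists (@Chain _ _ J (tc Y P) (Tens_with (mx_mod r1) (tc Y P)) A Ad), S => n.
pose R (z : tc_term Y P (n + 1)) := mx_trace r1 _ (A (n + 1) z) +
  tc_diff Y P n (mx_trace r2 _ (S (n + 1) n erefl z)) +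
  mx_trace r2 _ (S (n + 1 + 1) (n + 1) erefl (tc_diff Y P (n + 1) z)).
have Rlin : linear R.
  move=> c z z'; rewrite /R !(ghomD, ghomZ) !scalerDr.
  by apply: etrans (congr1 (fun u => u + _) (addrACA _ _ _ _)) _; apply: addrACA.
have AP m i j (e0 : j + i == m) (x : P i) (y : Y j) : A m (put e0 y x) = putr r1 e0 y (a i x).
  apply: etrans (AE m (exist _ (j, i) e0) y x) _; congr (putr r1 _ y _).
  exact: bool_irrelevance.
have cancel (Z : zmodType) (u v w d : Z) : u + (d + v) + (- d + w) = u + v + w.
  by rewrite [d + v]addrC !addrA addrK.
have key i' j (e0 : j + (i' + 1) == n + 1) (x : P (i' + 1)) (y : Y j) :
    put e0 y x = R (put e0 y x).
  have e1 : j + i' == n by move: e0; rewrite addrA (inj_eq (addIr 1)).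
  have e2 : j + 1 + i' == n + 1 by rewrite addrAC (eqP e1).
  have e3 : j + (i' + 1 + 1) == n + 1 + 1 by rewrite -(eqP e0) !addrA.
  have e4 : j + 1 + (i' + 1) == n + 1 + 1 by rewrite addrAC (eqP e0).
  rewrite /R [tc_diff Y P (n + 1) _](put_diff e0 e4 e3) AP putr_trace.
  rewrite (SE _ _ _ _ _ _ erefl e0 e1) ghomZ putr_trace ghomZ (put_diff e1 e2 e0).
  rewrite !ghomD !ghomZ (SE _ _ _ _ _ _ erefl e3 e0) (SE _ _ _ _ _ _ erefl e4 e2).
  rewrite !ghomZ !putr_trace scalerDr !scalerA koszul2 !scale1r.
  rewrite koszulS scaleNr cancel [LHS](congr1 (put e0 y) (as1 i' x)).
  have pD u v : put e0 y (u + v) = put e0 y u + put e0 y v.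
    exact: (linearD (mklinear (put_linr e0 y))).
  by rewrite !pD.
suff e : idfun =1 mklinear Rlin by move=> z; apply: (e z).
apply: tc_ext => -[[j i] e0] y x; have ei : i = (i - 1) + 1 by rewrite subrK.
move: (i - 1) ei => i' ei; subst i; exact: key.
Qed.
End TensorContraction.

(** * Descent of the tensor product to the homotopy categories *)

Section TensorInduced.
Variables (k : comPzRingType) (gT : finGroupType) (J : {group gT}).

(** The identity f (x) g - f' (x) g' = (f - f') (x) g + f' (x) (g - g'), arranged so that the two
    terms factor through P (x) Y and X (x) Q. *)
Lemma tc_map_sub (X X' Y Y' P Q : complex k J) (f f' : chain X X') (g g' : chain Y Y')
    (a : chain X P) (b : chain P X') (a' : chain Y Q) (b' : chain Q Y') :
  (forall n x, f n x - f' n x = b n (a n x)) -> (forall n y, g n y - g' n y = b' n (a' n y)) ->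
  forall n z, tc_map f g n z - tc_map f' g' n z =
    tc_map b g n (tc_map a (idm (Y : CX k J)) n z) +
    tc_map f' b' n (tc_map (idm (X : CX k J)) a' n z).
Proof.
move=> ef eg n.
apply: (tc_ext (f := tc_map_deg f g n \- tc_map_deg f' g' n)
  (g := (tc_map_deg b g n \o tc_map_deg a (idm (Y : CX k J)) n) \+
    (tc_map_deg f' b' n \o tc_map_deg (idm (X : CX k J)) a' n))) => p x y.
rewrite -[LHS]/(tc_map_deg f g n (tpure x y) - tc_map_deg f' g' n (tpure x y)).
rewrite -[RHS]/(tc_map_deg b g n (tc_map_deg a (idm (Y : CX k J)) n (tpure x y)) +
  tc_map_deg f' b' n (tc_map_deg (idm (X : CX k J)) a' n (tpure x y))).
rewrite !tc_mapE -ef -eg.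
have lD u v w : @tpure _ _ _ X' Y' n p (u - v) w = tpure u w - tpure v w.
  exact: (linearB (mklinear (@tpure_linl _ _ _ X' Y' n p w))).
have rD u v w : @tpure _ _ _ X' Y' n p u (v - w) = tpure u v - tpure u w.
  exact: (linearB (mklinear (@tpure_linr _ _ _ X' Y' n p u))).
by rewrite lD rD /= addrA subrK.
Qed.

Lemma Tens_induces c h (V : gmod k J) n : free_of_rank V n ->
  (h = VSplit \/ h = VTermSplit -> (0 < n)%N) ->
  (forall X Y : complex k J, in_C c X -> in_C c Y -> in_C c (tc X Y)) ->
  induces2 c h V (Tens k J).
Proof.
move=> Vfree n0 tcC; split=> // X X' Y Y' f f' g g' cX cX' cY cY'.
have [r1 [r2 [r_gt0 inE]]] := in_E_class_reps Vfree n0.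
have projP := E_projective_traced_contraction c r_gt0 inE.
move=> [P [a [b [/projP[cP tP] e]]]] [Q [a' [b' [/projP[cQ tQ] e']]]].
apply: (hequiv2 (P := tc P Y) (Q := tc X Q) _ _ (tc_map_sub e e')).
- by apply/projP; split; [apply: tcC|apply: tensor_traced_contractionl].
- by apply/projP; split; [apply: tcC|apply: tensor_traced_contractionr].
Qed.
End TensorInduced.

(** * The projection formula for complexes *)

Section ProjectionComplex.
Variables (k : comPzRingType) (gT : finGroupType) (G H : {group gT}).
Hypothesis sHG : H \subset G.
Variables (X : complex k G) (Y : complex k H).

Let pr n := projection sHG (fun p : bideg n => X (val p).1) (fun p : bideg n => Y (val p).2).
Let pi n := projection_inv sHG (fun p : bideg n => X (val p).1) (fun p : bideg n => Y (val p).2).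

(** As for naturality, the inverse is treated first, being explicit on generators. The Koszul signs
    agree because they depend on the degree in X alone. *)
Lemma projection_inv_diff n w :
  pi (n + 1) (ind_map G (tc_diff (Res k sHG X) Y n) w) = tc_diff X (Ind k G H Y) n (pi n w).
Proof.
pose Z := tc_term (Res k sHG X) Y n; pose Z' := tc_term (Res k sHG X) Y (n + 1).
move: w; apply: (ind_ext_gen (f := pi (n + 1) \o ind_map_lin G (tc_diff (Res k sHG X) Y n))
  (f' := tc_diff_lin X (Ind k G H Y) n \o pi n)) => g w gG.
pose q := mklinear (@ind_gen_linear _ _ G H Z g).
move: w; apply: (tc_ext (X := Res k sHG X) (f := pi (n + 1) \o ind_map_lin G (tc_diff (Res k sHG
  X) Y n) \o q)
  (g := tc_diff_lin X (Ind k G H Y) n \o pi n \o q)) => p x y.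
rewrite -[LHS]/(pi (n + 1) (ind_map G (tc_diff (Res k sHG X) Y n) (ind_gen G (X := Z) g (tpure
  (X := Res k sHG X) x y)))).
rewrite -[RHS]/(tc_diff_lin X (Ind k G H Y) n (pi n (ind_gen G (X := Z) g (tpure (X := Res k sHG
  X) x y)))).
rewrite ind_map_gen [pi n _]projection_inv_gen //.
rewrite [tc_diff _ _ _ _]tc_diffE [RHS](tc_diffE (X := X) (Y := Ind k G H Y)) /tc_diff_fun.
rewrite (linearD (mklinear (@ind_gen_linear _ _ G H Z' g))).
rewrite (linearZZ (mklinear (@ind_gen_linear _ _ G H Z' g))) ghomD ghomZ.
congr (_ + _ *: _).
  apply: etrans (projection_inv_gen sHG (M := fun p : bideg (n + 1) => X (val p).1)
    (N := fun p : bideg (n + 1) => Y (val p).2) (a := bideg1 p) (diff X _ x) y gG) _.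
  by rewrite -(gfun_act (diff X (val p).1)).
apply: etrans (projection_inv_gen sHG (M := fun p : bideg (n + 1) => X (val p).1)
  (N := fun p : bideg (n + 1) => Y (val p).2) (a := bideg2 p) x (diff Y _ y) gG) _.
by rewrite -(ind_map_gen G (diff Y (val p).2)).
Qed.

Lemma projection_diff n z :
  pr (n + 1) (tc_diff X (Ind k G H Y) n z) = ind_map G (tc_diff (Res k sHG X) Y n) (pr n z).
Proof.
rewrite -{1}(projectionK sHG z) -[projection_inv _ _ _ _]/(pi n (pr n z)).
by rewrite -projection_inv_diff [LHS]projection_invK.
Qed.

Definition projection_chain : chain (tc X (Ind k G H Y)) (Ind k G H (tc (Res k sHG X) Y)) :=
  @Chain _ _ G (tc X (Ind k G H Y)) (Ind k G H (tc (Res k sHG X) Y)) pr projection_diff.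
Definition projection_inv_chain : chain (Ind k G H (tc (Res k sHG X) Y)) (tc X (Ind k G H Y)) :=
  @Chain _ _ G (Ind k G H (tc (Res k sHG X) Y)) (tc X (Ind k G H Y)) pi projection_inv_diff.
End ProjectionComplex.

Lemma projection_iso (k : comPzRingType) (gT : finGroupType) (G H : {group gT})
    (sHG : H \subset G) (V : gmod k G) c h
    (iInd : induces c h (res sHG V) V (Ind k G H)) (iRes : induces c h V (res sHG V) (Res k sHG))
    (iTG : induces2 c h V (Tens k G)) (iTH : induces2 c h (res sHG V) (Tens k H)) :
  naturally_iso
    (compF (Kfunctor2 iTG) (prodF (idF _) (Kfunctor iInd)))
    (compF (Kfunctor iInd) (compF (Kfunctor2 iTH) (prodF (Kfunctor iRes) (idF _)))).
Proof.
set F1 := compF _ _; set F2 := compF _ _.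
pose alpha (X : prodC (Kcat c h V) (Kcat c h (res sHG V))) : hom (F1 X) (F2 X) :=
  projection_chain sHG (sval X.1) (sval X.2).
have alphaN (X Y : prodC (Kcat c h V) (Kcat c h (res sHG V))) (f : hom X Y) :
    heq (comp (alpha Y) (fmap F1 f)) (comp (fmap F2 f) (alpha X)).
  apply: hequiv_heq => n z.
  exact: (projection_natural sHG
    (fun p : bideg n => (f.1 : chain (sval X.1) (sval Y.1)) (val p).1)
    (fun p : bideg n => (f.2 : chain (sval X.2) (sval Y.2)) (val p).2) z).
exists (NatTrans alphaN) => X.
exists (projection_inv_chain sHG (sval X.1) (sval X.2)).
by split; apply: hequiv_heq => n z; [apply: projectionK|apply: projection_invK].
Qed.

Theorem theorem7p2 (k : comPzRingType) (gT : finGroupType) (G : {group gT})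
    (V : gmod k G) (n : nat) (Vfree : free_of_rank V n)
    (c : term_type * bound_type) (h : homotopy_type)
    (H : {group gT}) (sHG : H \subset G) :
  exists (iInd : induces c h (res sHG V) V (Ind k G H))
         (iRes : induces c h V (res sHG V) (Res k sHG)),
  let IndHG := Kfunctor iInd in
  let ResGH := Kfunctor iRes in
  [/\
    (* (a) *)
    forall (K : {group gT}) (sKG : K \subset G) (T : {set gT}),
      is_transversal T (double_cosets K G H) G ->
      let VK := res sKG V in
      let VH := res sHG V in
      (* V restricted to K :&: H :^ t^-1 and to K :^ t :&: H *)
      let Vl (t : gT) := res (subsetIl K (H :^ t^-1)%g) VK in
      let Vr (t : gT) := res (subsetIr (K :^ t)%g H) VH in
      exists (iResK : induces c h V VK (Res k sKG))
             (iRest : forall t : {t | t \in T},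
                induces c h VH (Vr (val t)) (Res k (subsetIr (K :^ val t)%g H)))
             (iConj : forall t : {t | t \in T},
                induces c h (Vr (val t)) (Vl (val t))
                  (Conj k (conj_double_coset K H (val t))))
             (iIndt : forall t : {t | t \in T},
                induces c h (Vl (val t)) VK
                  (Ind k K (K :&: H :^ (val t)^-1)%G)),
      naturally_iso
        (compF (Kfunctor iResK) IndHG)
        (\big[@sumF k gT K c h VK _ / zeroF c h VK _]_(t : {t | t \in T})
           compF (Kfunctor (iIndt t))
             (compF (Kfunctor (iConj t)) (Kfunctor (iRest t)))),
    (* (b) *)
    (forall X Y : complex k G, in_C c X -> in_C c Y -> in_C c (tc X Y)) ->
    (forall X Y : complex k H, in_C c X -> in_C c Y -> in_C c (tc X Y)) ->
    (* for these two types, V <> 0: if V = 0, tensoring does not descend *)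
    (h = VSplit \/ h = VTermSplit -> (0 < n)%N) ->
    exists (iTG : induces2 c h V (Tens k G))
           (iTH : induces2 c h (res sHG V) (Tens k H)),
      naturally_iso
        (compF (Kfunctor2 iTG) (prodF (idF _) IndHG))
        (compF IndHG (compF (Kfunctor2 iTH) (prodF ResGH (idF _)))),
    (* (c) *)
    adjoint IndHG ResGH /\ adjoint ResGH IndHG
    &
    (* (d) *)
    exists F : functor (Kcat c h (res sHG V)) (Kcat c h (res sHG V)),
      naturally_iso (compF ResGH IndHG) (sumF (idF _) F)].
Proof.
have iInd := Ind_induces c h sHG V; have iRes := Res_induces c h sHG V.
exists iInd, iRes => IndHG ResGH; split.
- move=> K sKG T Ttrans VK VH Vl Vr.
  exists (Res_induces c h sKG V), (fun t => Res_induces c h (subsetIr (K :^ val t)%g H) VH).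
  exists (fun t => Conj_double_coset_induces sHG sKG c h V (transversal_in_group Ttrans (valP t))).
  exists (fun t => Ind_induces c h (subsetIl K (H :^ (val t)^-1)%g) VK).
  exact: mackey_iso.
- move=> tcG tcH n0.
  (* Freeness and rank concern the underlying k-module, which restriction does not change, so
     [Vfree] serves for H as well. *)
  exists (Tens_induces Vfree n0 tcG), (Tens_induces (V := res sHG V) Vfree n0 tcH).
  exact: projection_iso.
- split; apply: adjoint_Kfunctor; apply: degreewise_adjoint.
    exact: Ind_Res_adjoint.
  exact: Res_Ind_adjoint.
- pose p (X : Kcat c h (res sHG V)) : chain (Res k sHG (Ind k G H (sval X))) (sval X) :=
    @Chain _ _ H (Res k sHG (Ind k G H (sval X))) (sval X) (fun m => coind_counit sHG (sval X m))
      (fun m z => ind_coord_map sHG (diff (sval X) m) 1%g z).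
  pose s (X : Kcat c h (res sHG V)) : chain (sval X) (Res k sHG (Ind k G H (sval X))) :=
    @Chain _ _ H (sval X) (Res k sHG (Ind k G H (sval X))) (fun m => ind_unit sHG (sval X m))
      (fun m x => esym (ind_map_gen G (diff (sval X) m) 1%g x)).
  apply: (@split_functor_summand _ _ _ c h (res sHG V) (compF ResGH IndHG) p s).
  + move=> X m x; rewrite -[LHS]/(ind_coord sHG _ 1%g (ind_gen G 1%g x)).
    by rewrite ind_coord_gen // invg1 mul1g group1 act1.
  + by move=> X Y f m z; apply: (ind_coord_map sHG ((f : chain (sval X) (sval Y)) m) 1%g z).
  + by move=> X Y f m z; apply: (ind_map_gen G ((f : chain (sval X) (sval Y)) m) 1%g z).
Qed.
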